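(* As $n\to\infty$, $$T(n)\sim\frac{\pi}{6\sqrt[4]{3}}\,n^{-7/4}\exp\left(2\pi\sqrt{\tfrac{n}{3}}\right).$$
   Context: $T(n)$ denotes the number of distinct multisets of rectangular blocks of sizes $2\times k$ and $1\times k$ ($k\ge1$ an integer; a block of size $a\times b$ is indistinguishable from one of size $b\times a$, so blocks may be rotated by 90 degrees) that can fill (tile) a $2\times n$ rectangle in such a way that a horizontally symmetric arrangement is possible, i.e. an arrangement invariant under the reflection exchanging the two rows (the upper and lower $1\times n$ halves) of the rectangle. By convention $T(0)=1$. Equivalently, as derived in the paper, $\sum_{n\ge0}T(n)x^n=P(x)^2(1-x^2)$ where $P(x)=\prod_{k=1}^\infty\frac{1}{1-x^k}$, i.e. $T(n)=\sum_{k=0}^n p(k)p(n-k)-\sum_{k=0}^{n-2}p(k)p(n-2-k)$ with $p$ the integer partition function. The notation $f(n)\sim g(n)$ means $f(n)/g(n)\to1$. *)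

(* Defs.v *)
From mathcomp Require Import all_boot finmap multiset.

Set Implicit Arguments.
Unset Strict Implicit.
Unset Printing Implicit Defensive.

Local Open Scope nat_scope.

(* Cells of the 2 x n rectangle, as pairs (row, column). *)
Definition cell (n : nat) : finType := ('I_2 * 'I_n)%type.

(* Rows r, ..., r + h - 1 and columns c, ..., c + w - 1. *)
Definition rectangle (n r c h w : nat) : {set cell n} :=
  [set z : cell n | (r <= z.1 < r + h) && (c <= z.2 < c + w)].

(* Up to rotation, an h x w block is of size 1 x k or 2 x k with k >= 1
   exactly when its smaller side is 1 or 2. *)
Definition admissible_size (h w : nat) : bool := minn h w \in [:: 1; 2].

(* A placed block is identified with the set of cells it covers; it has to lie
   entirely inside the 2 x n rectangle. *)
Definition is_block (n : nat) (B : {set cell n}) : bool :=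
  [exists r : 'I_2, exists c : 'I_n, exists h : 'I_3, exists w : 'I_n.+1,
    [&& admissible_size h w, r + h <= 2, c + w <= n
      & B == rectangle n r c h w]].

Definition is_tiling (n : nat) (P : {set {set cell n}}) : bool :=
  partition P [set: cell n] && [forall B in P, is_block B].

Definition flip (n : nat) (z : cell n) : cell n := (rev_ord z.1, z.2).

Definition is_symmetric (n : nat) (P : {set {set cell n}}) : bool :=
  [forall B in P, (@flip n @: B) \in P].

(* Height and width are the numbers of rows and columns met by the block;
   sorting them identifies an a x b block with a b x a block. *)
Definition size_of (n : nat) (B : {set cell n}) : nat * nat :=
  let h := #|[set z.1 | z in B]| in
  let w := #|[set z.2 | z in B]| in
  (minn h w, maxn h w).

Definition blocks_of (n : nat) (P : {set {set cell n}}) : {mset (nat * nat)}%mset :=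
  seq_mset [seq size_of B | B <- enum P].

Definition symmetric_tilings (n : nat) : {set {set {set cell n}}} :=
  [set P | is_tiling P && is_symmetric P].

(* Counts the multisets of blocks, not the tilings. *)
Definition T (n : nat) : nat :=
  #|` [fset blocks_of P | P in symmetric_tilings n]%fset |.

(* Main.v *)
Require Import Defs.
From mathcomp Require Import all_boot finmap multiset zify.
Set Implicit Arguments.
Unset Strict Implicit.
Unset Printing Implicit Defensive.

(** Combinatorics. The reflection exchanging the two rows maps a block of
    height 2 to itself and a strip lying in one row to its mirror image in the
    other row. So the blocks of a symmetric tiling come as self-symmetric
    columns of width k, contributing one block 2 x k (one block 1 x 2 when
    k = 1), and as mirror pairs of strips 1 x k. Conversely, columns and pairs
    of strips whose widths add up to n can be set side by side in any order.
    Two upright dominoes are the same multiset as a pair of flat ones, hence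
    pairs of strips of width 2 are left out; after that the multiset determines
    the multiplicities. So T(n) counts the ways to write n as a sum of parts of
    two colours, the second colour lacking the part 2 ([T_config_count]), and
    it is the n-th coefficient of F(x) = (1 - x^2) prod_k (1 - x^k)^-2.

    Analysis. Put x = e^(-s) and make each part k a geometric random variable
    with mean 1/(e^(ks) - 1), all independent: a configuration of weight m then
    has probability e^(-ms) / F, so that T(n) = e^(ns) F P(weight = n). For
    s = pi / sqrt(3n) the expected weight is close to n and its variance is
    asymptotic to 2 pi^2 / (3 s^3), so a local limit theorem gives the value of
    P(weight = n): it is an integral of the characteristic function at the
    frequency u s^(3/2), which tends to exp(- pi^2 u^2 / 3), dominatedly
    ([fourier_inversion], [cvg_integrand], [integrand_bound],
    [config_count_limit]). What is left is an expansion of log F with error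
    o(1) ([log_error_small]).

    The expansion and the local limit theorem rest on the function
    L(s) = - sum_k ln (1 - e^(-ks)).
    - L(s) = zeta(2)/s + ln (s / 2 pi) / 2 + O(s) ([logPoo_asymp]) is obtained
      without the modularity of the eta function. The combination
      2 L(2s) - L(s) is an alternating sum of values of ln (1 - e^(-x)); after
      the logarithm of x is split off, it is a Wallis product and an
      alternating sum of values of a convex function, so it equals
      ln (2s / pi) / 2 + O(s) ([logPoo_doubling]). Hence the error
      E of the expansion satisfies E(s) = 2 E(2s) + O(s), which together with
      the crude s E(s) -> 0 forces E(s) = O(s) ([logPerr_le]).
    - The expected weight and the variance are - 2 L' and 2 L'', up to the
      contribution of the missing part 2. As L and - L' are convex, difference
      quotients of L bound L', and those of L' bound L'' ([mean_asymp],
      [variance_asymp]); no asymptotic relation is ever differentiated.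
    - The modulus of the characteristic function is bounded by the factors of
      the parts k <= 1/(2s), where each factor is at most
      exp (- (2/9) (1 - cos kt)); the sum of these cosines is estimated by
      Jordan's inequality for small t and by the Dirichlet kernel for the other
      frequencies ([modulus_dominated]).
    All products and sums are truncated at parts of size at most n + 2, which
    costs an exponentially small error ([tail_small], [truncation_small]). *)

(** * Symmetric tilings as families of part multiplicities *)

Section Combinatorics.
Local Open Scope nat_scope.

(** [inl k] stands for a self-symmetric column of width [k + 1], [inr k] for a
    mirror pair of strips; [bump 1] skips one value, so that the widths of
    the pairs are 1, 3, 4, ..., [N + 1] and both colours stop at the same
    size. *)
Definition part_index (N : nat) : finType := ('I_N.+1 + 'I_N)%type.

Definition part_size (N : nat) (i : part_index N) : nat :=
  match i with
  | inl k => k.+1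
  | inr k => (bump 1 k).+1
  end.

Lemma part_size_gt0 N (i : part_index N) : (0 < part_size i)%N.
Proof. by case: i. Qed.

Definition weight (I : finType) (w : I -> nat) J (f : {ffun I -> 'I_J.+1}) : nat :=
  (\sum_i w i * f i)%N.

(** The sizes [n + 1] and [n + 2], and multiplicities above [n], cannot occur in
    a configuration of weight [n], so these finite ranges lose nothing; with
    [n + 1] pairs of strips the second summand of the index is nonempty even
    for [n = 0]. *)
Definition config_count n : nat :=
  #|[pred f : {ffun part_index n.+1 -> 'I_n.+1} | weight (@part_size n.+1) f == n]|.

(** A repeated block would cover each of its cells twice. *)
Lemma uniq_of_disjoint (X : finType) (l : seq {set X}) :
  (forall x, \sum_(B <- l) (x \in B) <= 1) -> set0 \notin l -> uniq l.
Proof.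
elim: l => //= B l IH le1; rewrite inE negb_or => /andP[].
rewrite eq_sym => /set0Pn[x xB] l0; apply/andP; split; last first.
  by apply: IH l0 => y; have := le1 y; rewrite big_cons; lia.
apply/negP => Bl; have := le1 x.
by rewrite big_cons (big_rem _ Bl) /= xB.
Qed.

(** Counting the blocks over each point with multiplicity makes disjointness and
    covering of a list of blocks a single statement, which is stable under
    concatenation. *)
Lemma seq_partition (X : finType) (l : seq {set X}) :
  (forall x, \sum_(B <- l) (x \in B) = 1) -> set0 \notin l ->
  partition [set B in l] [set: X].
Proof.
move=> cover1 l0; have ul : uniq l by apply: uniq_of_disjoint => // x; rewrite cover1.
have l0' : set0 \notin [set B in l] by rewrite inE.
apply/and3P; split=> //.
  apply/eqP/setP => x; rewrite inE; apply/bigcupP.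
  have := cover1 x; have [/hasP[B Bl xB] _|/hasPn no] := boolP (has (fun B : {set X} => x \in B) l).
    by exists B; rewrite ?inE.
  by rewrite big_seq big1 // => B Bl; rewrite (negPf (no B Bl)).
apply/trivIsetP => A B; rewrite !inE => Al Bl AB.
apply/pred0P => x /=; apply/negP => /andP[xA xB].
have := cover1 x; rewrite (big_rem _ Al) /= xA.
have Bl' : B \in rem A l by rewrite rem_filter // mem_filter /= eq_sym AB.
by rewrite (big_rem _ Bl') /= xB.
Qed.

Section Blocks.
Variable n : nat.
Implicit Types (B : {set cell n}) (P : {set {set cell n}}) (r c h w : nat).

Lemma in_rectangle r c h w (z : cell n) :
  (z \in rectangle n r c h w) = (r <= z.1 < r + h) && (c <= z.2 < c + w).
Proof. by rewrite inE. Qed.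

Lemma rectangleE r c h w :
  rectangle n r c h w = setX [set i : 'I_2 | r <= i < r + h] [set j : 'I_n | c <= j < c + w].
Proof. by apply/setP => -[i j]; rewrite !inE. Qed.

Lemma card_interval m a k : a + k <= m -> #|[set i : 'I_m | a <= i < a + k]| = k.
Proof.
move=> akm.
rewrite -[RHS]card_ord.
have f (i : 'I_k) : a + i < m by have := ltn_ord i; lia.
have finj : injective (fun i : 'I_k => Ordinal (f i)).
  by move=> i j [] /addnI/val_inj.
rewrite -(card_imset _ finj); apply: eq_card => j; rewrite !inE.
apply/idP/imsetP => [/andP[aj jk]|[i _ ->] /=]; last by have := ltn_ord i; lia.
have h : j - a < k by lia.
by exists (Ordinal h) => //; apply: val_inj => /=; lia.
Qed.

Lemma card_rectangle r c h w : r + h <= 2 -> c + w <= n ->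
  #|rectangle n r c h w| = h * w.
Proof. by move=> rh cw; rewrite rectangleE cardsX !card_interval. Qed.

Lemma size_of_rectangle r c h w : 0 < h -> 0 < w -> r + h <= 2 -> c + w <= n ->
  size_of (rectangle n r c h w) = (minn h w, maxn h w).
Proof.
move=> h0 w0 rh cw; rewrite /size_of.
have r2 : r < 2 by lia.
have cn : c < n by lia.
have -> : [set z.1 | z in rectangle n r c h w] = [set i : 'I_2 | r <= i < r + h].
  apply/setP => i; apply/imsetP/idP => [[z + ->]|]; first by rewrite !inE => /andP[].
  rewrite inE => hi; exists (i, Ordinal cn) => //.
  by rewrite in_rectangle hi /=; lia.
have -> : [set z.2 | z in rectangle n r c h w] = [set j : 'I_n | c <= j < c + w].
  apply/setP => j; apply/imsetP/idP => [[z + ->]|]; first by rewrite !inE => /andP[].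
  rewrite inE => hj; exists (Ordinal r2, j) => //.
  by rewrite in_rectangle hj /=; lia.
by rewrite !card_interval.
Qed.

Lemma flipK : involutive (@flip n).
Proof. by case=> i j; rewrite /flip /= rev_ordK. Qed.

Lemma in_flip B z : (z \in @flip n @: B) = (flip z \in B).
Proof. by rewrite -{1}[z]flipK mem_imset //; exact: inv_inj flipK. Qed.

Lemma flip_rectangle r c h w : r + h <= 2 ->
  @flip n @: rectangle n r c h w = rectangle n (2 - (r + h)) c h w.
Proof.
move=> rh; apply/setP => -[i j]; rewrite in_flip !in_rectangle /=.
by congr (_ && _); have := ltn_ord i; lia.
Qed.

Lemma flip_imsetK : involutive (fun B => @flip n @: B).
Proof. by move=> B; apply/setP => z; rewrite !in_flip flipK. Qed.

Lemma is_blockP B : reflect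
  (exists r c h w, [/\ [&& 0 < h, 0 < w, r + h <= 2 & c + w <= n] &
      B = rectangle n r c h w])
  (is_block B).
Proof.
apply: (iffP existsP) => [[r /existsP[c /existsP[h /existsP[w]]]]|].
  case/and4P => + rh cw /eqP ->; rewrite /admissible_size !inE => adm.
  by exists r, c, h, w; split=> //; lia.
move=> [r [c [h [w [/and4P[h0 w0 rh cw] ->]]]]].
have r2 : r < 2 by lia.
have cn : c < n by lia.
have h3 : h < 3 by lia.
have wn : w < n.+1 by lia.
exists (Ordinal r2); apply/existsP; exists (Ordinal cn).
apply/existsP; exists (Ordinal h3); apply/existsP; exists (Ordinal wn).
by rewrite /= rh cw eqxx !andbT /admissible_size !inE; lia.
Qed.

End Blocks.

Definition block_height N (i : part_index N) := if i is inl _ then 2 else 1.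
Definition copies N (i : part_index N) := if i is inl _ then 1 else 2.
Definition block_size N (i : part_index N) :=
  (minn (block_height i) (part_size i), maxn (block_height i) (part_size i)).

(** This is where the pairs of flat dominoes have to be left out: they would
    have the size [(1, 2)] of the column of width 1. *)
Lemma block_size_inj N : injective (@block_size N).
Proof.
move=> [i|i] [j|j]; rewrite /block_size /= /bump => -[] *.
- by congr inl; apply: val_inj => /=; lia.
- lia.
- lia.
- by congr inr; apply: val_inj => /=; lia.
Qed.

(** What makes the weight of a configuration half of the area of the tiling. *)
Lemma block_area N (i : part_index N) :
  copies i * ((block_size i).1 * (block_size i).2) = 2 * part_size i.
Proof. by case: i => k; rewrite /block_size /=; lia. Qed.

Definition multiset_of n (f : {ffun part_index n.+1 -> 'I_n.+1}) : seq (nat * nat) :=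
  flatten [seq nseq (copies i * f i) (block_size i) | i <- enum (part_index n.+1)].

Lemma count_multiset_of n (f : {ffun part_index n.+1 -> 'I_n.+1}) i :
  count_mem (block_size i) (multiset_of f) = copies i * f i.
Proof.
rewrite count_flatten -map_comp sumnE big_map big_enum /= (bigD1 i) //= big1.
  by rewrite count_nseq /= eqxx mul1n addn0.
by move=> j ji; rewrite count_nseq /= (inj_eq (@block_size_inj _)) (negPf ji).
Qed.

Lemma multiset_of_inj n : injective (fun f => seq_mset (@multiset_of n f)).
Proof.
move=> f g /eq_seq_msetP/permP fg; apply/ffunP => i; apply: val_inj.
have := fg (pred1 (block_size i)); rewrite !count_multiset_of.
by case: i => i /=; lia.
Qed.

(** A multiset of admissible block sizes is known from its multiplicities. *)
Lemma perm_multiset_of n (f : {ffun part_index n.+1 -> 'I_n.+1}) l :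
  {subset l <= codom (@block_size n.+1)} ->
  (forall i, count_mem (block_size i) l = copies i * f i) ->
  perm_eq l (multiset_of f).
Proof.
move=> lsub cl; apply/allP => x; rewrite mem_cat => xl /=.
have : x \in codom (@block_size n.+1).
  case/orP: xl => [/lsub //|/flattenP[_ /mapP[i _ ->]]].
  by rewrite mem_nseq => /andP[_ /eqP ->]; exact: codom_f.
by case/codomP => i ->; rewrite cl count_multiset_of.
Qed.

Section Columns.
Variable n : nat.
Local Notation I := (part_index n.+1).
Implicit Types (i : I) (s : seq I) (c : nat).

Definition column i c : seq {set cell n} :=
  [seq rectangle n r c (block_height i) (part_size i) | r <- iota 0 (copies i)].

(** When each part is repeated in [s] according to its multiplicity, these
    blocks form a tiling that realizes the configuration, see
    [tiling_exists]. *)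
Fixpoint columns s c : seq {set cell n} :=
  if s is i :: s' then column i c ++ columns s' (c + part_size i) else [::].

Definition width s := sumn [seq part_size i | i <- s].

(** Covering counted with multiplicity is additive under concatenation, which
    reduces the claim to the columns of a single part. *)
Lemma columns_cover s c (z : cell n) :
  \sum_(B <- columns s c) (z \in B) = (c <= z.2 < c + width s).
Proof.
elim: s c => [|i s IH] c /=; first by rewrite big_nil /width /= addn0; lia.
rewrite big_cat /= IH big_map /width /=; have := @part_size_gt0 n.+1 i.
have := ltn_ord z.1; move: (sumn _) => W.
case: i => k; rewrite /= ?big_cons big_nil !in_rectangle /=; lia.
Qed.

Lemma columns_block s c B : c + width s <= n -> B \in columns s c ->
  is_block B /\ @flip n @: B \in columns s c.
Proof.
elim: s c => // i s IH c; rewrite /width /= -/(width s) addnA => cn.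
have i0 := @part_size_gt0 n.+1 i; have h : c + part_size i <= n by lia.
rewrite !mem_cat => /orP[|/(IH _ cn)[? ->]]; last by rewrite orbT.
rewrite /column; case: i i0 h {cn} => k i0 h; rewrite /= !inE.
  move=> /eqP ->; rewrite flip_rectangle // eqxx; split=> //.
  by apply/is_blockP; exists 0, c, 2, k.+1.
by case/orP => /eqP ->; rewrite flip_rectangle // eqxx ?orbT; split=> //;
   apply/is_blockP; [exists 0, c, 1, (bump 1 k).+1|exists 1, c, 1, (bump 1 k).+1].
Qed.

Lemma size_of_columns s c : c + width s <= n ->
  [seq size_of B | B <- columns s c] = flatten [seq nseq (copies i) (block_size i) | i <- s].
Proof.
elim: s c => // i s IH c; rewrite /width /= -/(width s) addnA => cn.
rewrite map_cat IH //; congr (_ ++ _).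
have i0 := @part_size_gt0 n.+1 i; have h : c + part_size i <= n by lia.
by rewrite /column /block_size; case: i i0 h {cn} => k i0 h; rewrite /= !size_of_rectangle.
Qed.

Lemma tiling_exists (f : {ffun I -> 'I_n.+1}) : weight (@part_size n.+1) f = n ->
  exists2 P, P \in symmetric_tilings n & blocks_of P = seq_mset (multiset_of f).
Proof.
move=> wf; pose s := flatten [seq nseq (f i) i | i <- enum I].
have ws : width s = n.
  rewrite /width map_flatten sumn_flatten -2!map_comp sumnE big_map big_enum -[RHS]wf /=.
  by apply: eq_bigr => i _; rewrite map_nseq sumn_nseq mulnC.
have s0 : 0 + width s <= n by rewrite ws.
have cov z : \sum_(B <- columns s 0) (z \in B) = 1.
  by rewrite columns_cover ws /= ltn_ord.
have ne : set0 \notin columns s 0.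
  apply/negP => /(columns_block s0)[/is_blockP[r [c [h [w [/and4P[h0 w0 rh cw] e]]]]] _].
  by have := card_rectangle rh cw; rewrite -e cards0; lia.
exists [set B in columns s 0].
  rewrite inE /is_tiling seq_partition //=; apply/andP; split.
    by apply/forall_inP => B; rewrite inE => /(columns_block s0)[].
  by apply/forall_inP => B; rewrite !inE => /(columns_block s0)[].
apply/eq_seq_msetP.
have pe : perm_eq (enum [set B in columns s 0]) (columns s 0).
  apply: uniq_perm; first exact: enum_uniq.
    by apply: uniq_of_disjoint => // z; rewrite cov.
  by move=> B; rewrite mem_enum inE.
rewrite (perm_trans (perm_map _ pe)) // size_of_columns //.
apply: perm_multiset_of => [x /flattenP[_ /mapP[i _ ->]]|i].
  by rewrite mem_nseq => /andP[_ /eqP ->]; exact: codom_f.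
rewrite count_flatten -map_comp sumnE big_map /s big_flatten /= big_map big_enum /=.
rewrite (bigD1 i) //= [X in _ + X = _]big1.
  rewrite big_nseq iter_addn_0 count_nseq /= eqxx; lia.
move=> j ji; rewrite big_nseq iter_addn_0 count_nseq /= (inj_eq (@block_size_inj _)).
by rewrite (negPf ji).
Qed.

End Columns.

Section SymmetricTilings.
Variables (n : nat) (P : {set {set cell n}}).
Hypothesis symP : P \in symmetric_tilings n.
Local Notation I := (part_index n.+1).
Implicit Types (i : I) (B : {set cell n}).

Definition of_size i := [set B in P | size_of B == block_size i].

Lemma tiling_block B : B \in P -> is_block B.
Proof. by move: symP; rewrite inE => /andP[/andP[_ /forall_inP h] _] /h. Qed.

Lemma tiling_flip B : B \in P -> @flip n @: B \in P.
Proof. by move: symP; rewrite inE => /andP[_ /forall_inP h] /h. Qed.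

Lemma size_of_codom B : B \in P -> size_of B \in codom (@block_size n.+1).
Proof.
move=> /tiling_block/is_blockP[r [c [h [w [/and4P[h0 w0 rh cw] ->]]]]].
rewrite size_of_rectangle //.
have [h2|h1] : h = 2 \/ h = 1 by lia.
  have k : w.-1 < n.+2 by lia.
  by apply/codomP; exists (inl (Ordinal k)); rewrite /block_size /= h2 prednK.
have [w2|w2] := eqVneq w 2.
  by apply/codomP; exists (inl ord0); rewrite h1 w2.
have k : (if w == 1 then 0 else w.-2) < n.+1 by case: ifP => _; lia.
apply/codomP; exists (inr (Ordinal k)).
rewrite /block_size /= h1 (_ : (bump 1 _).+1 = w) //.
by rewrite /bump; case: eqP => [->|] //=; lia.
Qed.

Lemma card_of_size B : B \in P -> #|B| = (size_of B).1 * (size_of B).2.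
Proof.
move=> /tiling_block/is_blockP[r [c [h [w [/and4P[h0 w0 rh cw] ->]]]]].
by rewrite size_of_rectangle // card_rectangle //=; lia.
Qed.

(** Of a strip and its mirror image exactly one is contained in the row [0]. *)
Definition upper B := [forall z in B, z.1 == ord0].

(** For a strip size other than [(1, 2)] all blocks are strips lying in one row,
    so the reflection matches those in row 0 with those in row 1. For the
    size [(1, 2)] there is no parity condition, since upright dominoes are
    their own mirror images. *)
Lemma copies_dvd i : copies i %| #|of_size i|.
Proof.
case: i => [k|k]; rewrite [copies _]/=; first exact: dvd1n.
set A := of_size _; pose U := [set B in A | upper B].
have row B : B \in A -> exists r c, [/\ r < 2, c + (bump 1 k).+1 <= n &
    B = rectangle n r c 1 (bump 1 k).+1].
  rewrite inE => /andP[/tiling_block/is_blockP[r [c [h [w [/and4P[h0 w0 rh cw] ->]]]]]].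
  rewrite size_of_rectangle // /block_size /= => /eqP[e1 e2].
  have [h1 w1] : h = 1 /\ w = (bump 1 k).+1 by move: e1 e2; rewrite /bump; lia.
  by exists r, c; subst h w; split=> //; lia.
have flipA B : B \in A -> @flip n @: B \in A.
  move=> BA; have [r [c [r2 cw e]]] := row B BA.
  move: BA; rewrite !inE => /andP[BP]; rewrite tiling_flip //= e flip_rectangle; last by lia.
  by rewrite !size_of_rectangle //; lia.
have upperE r c : r < 2 -> c + (bump 1 k).+1 <= n ->
    upper (rectangle n r c 1 (bump 1 k).+1) = (r == 0).
  move=> r2 cw; apply/forall_inP/eqP => [h|-> z].
    have cn : c < n by lia.
    have hz : (Ordinal r2, Ordinal cn) \in rectangle n r c 1 (bump 1 k).+1.
      by rewrite in_rectangle /=; lia.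
    by have /eqP[] := h _ hz.
  by rewrite in_rectangle => /andP[/andP[_ z0] _]; rewrite -val_eqE /= -leqn0 -ltnS.
have AE : A = U :|: [set @flip n @: (B : {set cell n}) | B in U].
  apply/setP => B; rewrite in_setU; apply/idP/orP.
    move=> BA; have [r [c [r2 cw e]]] := row B BA.
    have [r0|r1] : r = 0 \/ r = 1 by lia.
      by left; rewrite inE BA e upperE // r0.
    right; rewrite -[B]flip_imsetK; apply: imset_f; rewrite inE flipA //=.
    by rewrite e flip_rectangle ?upperE //; lia.
  by move=> []; [rewrite inE => /andP[]|move=> /imsetP[C + ->]; rewrite inE => /andP[/flipA]].
have disj : [disjoint U & [set @flip n @: (B : {set cell n}) | B in U]].
  apply/pred0P => B /=; apply/negP => /andP[].
  rewrite inE => /andP[BA uB] /imsetP[C]; rewrite inE => /andP[CA uC] BC.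
  have [r [c [r2 cw e]]] := row C CA; move: uC uB; rewrite BC e flip_rectangle; last by lia.
  by rewrite !upperE //; lia.
move: (cardsUI U [set @flip n @: (B : {set cell n}) | B in U]); rewrite -AE (eqP (_ : _ :&: _ == set0)) ?setI_eq0 //.
rewrite cards0 addn0 card_imset => [->|]; last exact: inv_inj (@flip_imsetK n).
by rewrite addnn -muln2 dvdn_mull.
Qed.

Definition multiplicity i := #|of_size i| %/ copies i.

Lemma multiplicityE i : copies i * multiplicity i = #|of_size i|.
Proof. by rewrite mulnC divnK // copies_dvd. Qed.

(** Comparing areas: the part [i] covers [2 * part_size i] cells, once for each
    unit of its multiplicity. *)
Lemma sum_multiplicity : \sum_(i : I) part_size i * multiplicity i = n.
Proof.
have tP : partition P [set: cell n] by move: symP; rewrite inE => /andP[/andP[]].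
have area := card_partition tP; rewrite cardsT card_prod !card_ord in area.
have : 2 * n = \sum_(i : I) #|of_size i| * ((block_size i).1 * (block_size i).2).
  rewrite area (eq_bigr _ card_of_size).
  transitivity (\sum_(B in P) \sum_(i : I | size_of B == block_size i)
                  (block_size i).1 * (block_size i).2).
    apply: eq_bigr => B BP; have /codomP[i e] := size_of_codom BP.
    by rewrite (big_pred1 i) e // => j; rewrite /= (inj_eq (@block_size_inj _)) eq_sym.
  rewrite (exchange_big_dep predT) //=; apply: eq_bigr => i _.
  by rewrite sum_nat_const; congr (_ * _); apply: eq_card => B; rewrite !inE.
under eq_bigr do rewrite -multiplicityE mulnAC block_area -mulnA.
by rewrite -big_distrr /= => /eqP; rewrite eqn_pmul2l // => /eqP.
Qed.

Lemma tiling_config : exists2 f : {ffun I -> 'I_n.+1},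
  weight (@part_size n.+1) f = n & blocks_of P = seq_mset (multiset_of f).
Proof.
have small i : multiplicity i < n.+1.
  rewrite ltnS -[leqRHS]sum_multiplicity (bigD1 i) //=.
  by rewrite (leq_trans (leq_pmull _ (part_size_gt0 i))) // leq_addr.
pose f : {ffun I -> 'I_n.+1} := [ffun i => Ordinal (small i)].
exists f; first by rewrite -[RHS]sum_multiplicity; apply: eq_bigr => i _; rewrite ffunE.
apply/eq_seq_msetP/perm_multiset_of => [x /mapP[B + ->]|i].
  by rewrite mem_enum; exact: size_of_codom.
rewrite ffunE /= multiplicityE count_map -size_filter cardE.
apply/perm_size/uniq_perm => [||B]; [exact: filter_uniq (enum_uniq _)|exact: enum_uniq|].
by rewrite mem_filter !mem_enum inE [B \in of_size i]inE andbC.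
Qed.

End SymmetricTilings.

Theorem T_config_count n : T n = config_count n.
Proof.
rewrite /T.
have -> : [fset blocks_of P | P in symmetric_tilings n]%fset =
  [fset seq_mset (multiset_of f) | f in [pred f | weight (@part_size n.+1) f == n]]%fset.
  apply/fsetP => x; apply/imfsetP/imfsetP => -[y /= hy ->].
    by have [f wf ->] := tiling_config hy; exists f => //=; apply/eqP.
  by have [P hP <-] := tiling_exists (eqP hy); exists P.
rewrite card_imfset; last exact: multiset_of_inj.
rewrite /config_count cardE; apply/perm_size/uniq_perm => [||f].
- exact: enum_finmem_uniq.
- exact: enum_uniq.
- by rewrite [RHS]mem_enum enum_finmemE.
Qed.

End Combinatorics.

From mathcomp Require Import all_order all_algebra.
From mathcomp Require Import all_classical all_reals all_analysis.
From mathcomp Require Import measurable_realfun ring lra.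
From mathcomp Require complex.
Import Order.TTheory GRing.Theory Num.Theory.
Import numFieldNormedType.Exports.
Local Open Scope classical_set_scope.
Local Open Scope ring_scope.

(** * Derivatives, Wallis integrals and the sum of inverse squares *)

Section PointwiseDerivatives.
Variable R : realType.
Implicit Types (f g F : R -> R) (a b x : R).

(** A copy of [is_derive] that is not a type class: no instance search is
    started on it, and [der] below can work by syntactic recursion. *)
Definition has_der f x (d : R) : Prop := is_derive x 1 f d.

Lemma has_der_eq f x (d d' : R) : has_der f x d -> d = d' -> has_der f x d'.
Proof. by move=> ? <-. Qed.

Lemma der_id x : has_der (fun y : R => y) x 1.
Proof. exact: is_derive_id. Qed.

Lemma der_cst a x : has_der (fun=> a) x 0.
Proof. exact: is_derive_cst. Qed.

Lemma der_add f g x (df dg : R) : has_der f x df -> has_der g x dg ->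
  has_der (fun y => f y + g y) x (df + dg).
Proof. exact: is_deriveD. Qed.

Lemma der_opp f x (df : R) : has_der f x df -> has_der (fun y => - f y) x (- df).
Proof. exact: is_deriveN. Qed.

Lemma der_mul f g x (df dg : R) : has_der f x df -> has_der g x dg ->
  has_der (fun y => f y * g y) x (f x * dg + g x * df).
Proof. exact: is_deriveM. Qed.

Lemma der_exp f n x (df : R) : has_der f x df ->
  has_der (fun y => f y ^+ n) x (n%:R * f x ^+ n.-1 * df).
Proof. by move=> fx; have := is_deriveX n fx; rewrite exprfctE. Qed.

Lemma der_comp f g x (df dg : R) : has_der f (g x) df -> has_der g x dg ->
  has_der (fun y => f (g y)) x (df * dg).
Proof. by move=> hf hg; apply: (is_derive1_comp hf hg). Qed.

Lemma der_sin g x (dg : R) : has_der g x dg ->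
  has_der (fun y => sin (g y)) x (cos (g x) * dg).
Proof. by apply: der_comp; exact: is_derive_sin. Qed.

Lemma der_cos g x (dg : R) : has_der g x dg ->
  has_der (fun y => cos (g y)) x (- sin (g x) * dg).
Proof. by apply: der_comp; exact: is_derive_cos. Qed.

Lemma der_expR g x (dg : R) : has_der g x dg ->
  has_der (fun y => expR (g y)) x (expR (g x) * dg).
Proof. by apply: der_comp; exact: is_derive_expR. Qed.

Lemma der_atan g x (dg : R) : has_der g x dg ->
  has_der (fun y => atan (g y)) x ((1 + g x ^+ 2)^-1 * dg).
Proof. by apply: der_comp; exact: is_derive1_atan. Qed.

Lemma der_ln g x (dg : R) : 0 < g x -> has_der g x dg ->
  has_der (fun y => ln (g y)) x ((g x)^-1 * dg).
Proof. by move=> g0; apply: der_comp; exact: is_derive1_ln. Qed.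
End PointwiseDerivatives.

(** Derivative of an expression built from elementary functions, leaving the
    positivity conditions of logarithms as goals. *)
Ltac der := repeat (cbv beta; lazymatch goal with
  | |- has_der (fun _ => ?a) _ _ => refine (der_cst a _)
  | |- has_der (fun y => y) _ _ => refine (der_id _)
  | |- has_der (fun y => sin (@?g y)) _ _ => refine (@der_sin _ g _ _ _)
  | |- has_der (fun y => cos (@?g y)) _ _ => refine (@der_cos _ g _ _ _)
  | |- has_der (fun y => expR (@?g y)) _ _ => refine (@der_expR _ g _ _ _)
  | |- has_der (fun y => atan (@?g y)) _ _ => refine (@der_atan _ g _ _ _)
  | |- has_der (fun y => ln (@?g y)) _ _ => refine (@der_ln _ g _ _ _ _)
  | |- has_der (fun y => (@?g y) ^+ ?n) _ _ => refine (@der_exp _ g n _ _ _)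
  | |- has_der (fun y => - (@?g y)) _ _ => refine (@der_opp _ g _ _ _)
  | |- has_der (fun y => (@?f y) * (@?g y)) _ _ => refine (@der_mul _ f g _ _ _ _ _)
  | |- has_der (fun y => (@?f y) + (@?g y)) _ _ => refine (@der_add _ f g _ _ _ _ _)
  end).

Section Calculus.
Variable R : realType.
Implicit Types (f g F : R -> R) (a b x : R).
Local Notation mu := (@lebesgue_measure R).

Lemma continuous_of_has_der F f : (forall x, has_der F x (f x)) -> continuous F.
Proof. by move=> dF x; apply/differentiable_continuous/derivable1_diffP; have [] := dF x. Qed.

(** The monotonicity arguments below go through this form of the mean value
    theorem. *)
Lemma le_has_der F f a b : (forall x, a <= x <= b -> has_der F x (f x)) ->
  (forall x, a < x < b -> 0 <= f x) -> a <= b -> F a <= F b.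
Proof.
move=> dF f0; rewrite le_eqVlt => /orP[/eqP->//|ab].
have cF : {within `[a, b], continuous F}.
  apply: derivable_within_continuous => x; rewrite in_itv /= => xab.
  by have [] := dF x xab.
have dF' x : x \in `]a, b[ -> is_derive x 1 F (f x).
  by rewrite in_itv /= => /andP[ax xb]; apply: dF; rewrite !ltW.
have [x xab E] := MVT ab dF' cF.
by rewrite -subr_ge0 E mulr_ge0 ?f0 ?subr_ge0 ?(ltW ab).
Qed.

Lemma integrable_cc f a b : continuous f -> mu.-integrable `[a, b] (EFin \o f).
Proof.
move=> cf; apply: continuous_compact_integrable; first exact: segment_compact.
exact: continuous_subspaceT.
Qed.

Lemma integral_FTC F f a b (v : R) : a < b -> (forall x, has_der F x (f x)) ->
  continuous f -> F b - F a = v -> \int[mu]_(x in `[a, b]) f x = v.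
Proof.
move=> ab dF cf <-; rewrite /Rintegral (@continuous_FTC2 R f F a b) //.
- exact: continuous_subspaceT.
- split => [x _||]; first by have [] := dF x.
  + by apply: cvg_at_right_filter; apply: continuous_of_has_der dF _.
  + by apply: cvg_at_left_filter; apply: continuous_of_has_der dF _.
- by move=> x _; rewrite derive1E; have [_ ->] := dF x.
Qed.
End Calculus.

Ltac continuity_by_derivative :=
  apply: continuous_of_has_der => ?; der.

Section WallisBasel.
Variable R : realType.
Implicit Types x : R.
Local Notation mu := (@lebesgue_measure R).
Local Notation D := `[0 : R, pi / 2]%classic.

Definition cosint n : R := \int[mu]_(x in D) (cos x ^+ n).
Definition sqcosint n : R := \int[mu]_(x in D) (x ^+ 2 * cos x ^+ n).

Let pih0 : (0 : R) < pi / 2. Proof. by rewrite divr_gt0 ?pi_gt0. Qed.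

Lemma integrable_cosX n : mu.-integrable D (EFin \o (fun x => cos x ^+ n)).
Proof. by apply: integrable_cc; continuity_by_derivative. Qed.

Lemma integrable_sqcosX n : mu.-integrable D (EFin \o (fun x => x ^+ 2 * cos x ^+ n)).
Proof. by apply: integrable_cc; continuity_by_derivative. Qed.

Lemma integrable_scale (c : R) f : continuous f -> mu.-integrable D (EFin \o (fun x => c * f x)).
Proof. by move=> cf; apply: integrable_cc => x; apply: cvgM; [exact: cvg_cst|exact: cf]. Qed.

Lemma cosint0 : cosint 0 = pi / 2.
Proof.
apply: (@integral_FTC R id) => //; last by rewrite subr0.
  by move=> x; rewrite expr0; exact: der_id.
by continuity_by_derivative.
Qed.

Lemma cosint1 : cosint 1 = 1.
Proof.
apply: (@integral_FTC R sin) => //; last by rewrite sin0 sin_pihalf subr0.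
  by move=> x; exact: is_derive_sin.
by continuity_by_derivative.
Qed.

(** Integration by parts; the boundary term is [sin x * cos x ^+ n.+1]. *)
Lemma cosint_rec n : n.+2%:R * cosint n.+2 = n.+1%:R * cosint n.
Proof.
apply/eqP; rewrite -subr_eq0; apply/eqP.
rewrite /cosint -RintegralZl //; last exact: integrable_cosX.
rewrite -RintegralZl //; last exact: integrable_cosX.
rewrite -RintegralB //.
- apply: (@integral_FTC R (fun x => sin x * cos x ^+ n.+1)) => //; first last.
  + by rewrite sin0 cos_pihalf expr0n /= mulr0 mul0r subrr.
  + by continuity_by_derivative.
  + move=> x; apply: has_der_eq; first by der.
    rewrite /= !exprS.
    have -> : n.+2%:R = n%:R + 2 :> R by rewrite -addn2 natrD.
    have -> : n.+1%:R = n%:R + 1 :> R by rewrite -addn1 natrD.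
    have s2 := sin2cos2 x.
    set c := cos x ^+ n; ring: s2.
- by apply: integrable_scale; continuity_by_derivative.
- by apply: integrable_scale; continuity_by_derivative.
Qed.

Lemma cos_itv x : D x -> 0 <= cos x <= 1.
Proof.
rewrite /= in_itv /= => /andP[x0 xp]; rewrite cos_le1 andbT.
by apply: cos_ge0_pihalf; rewrite xp andbT (le_trans _ x0)// oppr_le0 ltW.
Qed.

Lemma cosint_decr n : cosint n.+1 <= cosint n.
Proof.
apply: le_Rintegral => // [||x /cos_itv/andP[c0 c1]]; try exact: integrable_cosX.
by rewrite exprS ler_piMl ?exprn_ge0.
Qed.

(** The recursion makes this product independent of [n]. *)
Lemma cosint_mul n : n.+1%:R * (cosint n * cosint n.+1) = pi / 2.
Proof.
elim: n => [|n IH]; first by rewrite cosint0 cosint1 mul1r mulr1.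
by rewrite mulrCA cosint_rec -IH; ring.
Qed.

Lemma cosint_gt0 n : 0 < cosint n.
Proof.
have ge0 m : 0 <= cosint m.
  by apply: Rintegral_ge0 => x /cos_itv/andP[c0 c1]; rewrite exprn_ge0.
rewrite lt_neqAle ge0 andbT eq_sym; apply/eqP => c0.
by have := cosint_mul n; rewrite c0 mul0r mulr0 => /eqP; rewrite lt_eqF.
Qed.

Definition wallis n : R := \prod_(j < n) ((2 * j + 1)%:R / (2 * j + 2)%:R).

Lemma wallisE n : cosint (2 * n) = wallis n * (pi / 2).
Proof.
elim: n => [|n IH]; first by rewrite muln0 cosint0 /wallis big_ord0 mul1r.
rewrite /wallis big_ord_recr /= -/(wallis n).
have := cosint_rec (2 * n); rewrite IH mulnSr !addn2 addn1 => E.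
have n0 : (2 * n).+2%:R != 0 :> R by rewrite pnatr_eq0.
apply: (mulfI n0); rewrite E.
by move: n0; move: ((2 * n).+2%:R : R) => k k0; field.
Qed.

Lemma wallis_gt0 n : 0 < wallis n.
Proof. by apply: prodr_gt0 => i _; rewrite divr_gt0 // ltr0n ?addn1 ?addn2. Qed.

(** [cosint (2 * n) ^+ 2] lies between the neighbouring products of two
    consecutive integrals, which are known exactly; [wallis_le] uses the
    other neighbour. *)
Lemma wallis_ge n : 2 / (pi * (2 * n).+1%:R) <= wallis n ^+ 2.
Proof.
have h := cosint_mul (2 * n); have g := cosint_decr (2 * n); have p := cosint_gt0 (2 * n).
have P := pi_gt0 R.
have N : 0 < (2 * n).+1%:R :> R by rewrite ltr0n.
rewrite ler_pdivrMr ?mulr_gt0 //.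
have : pi / 2 <= (2 * n).+1%:R * cosint (2 * n) ^+ 2.
  by rewrite -h ler_pM2l // expr2 ler_pM2l.
rewrite wallisE; set w := wallis n; set k := _%:R => H.
rewrite -(@ler_pM2r _ (pi / 4)); last by rewrite divr_gt0.
by lra.
Qed.

Lemma wallis_le n : wallis n.+1 ^+ 2 <= 1 / (pi * n.+1%:R).
Proof.
have h := cosint_mul (2 * n).+1; have g := cosint_decr (2 * n).+1; have p := cosint_gt0 (2 * n).+2.
have P := pi_gt0 R.
have N : 0 < n.+1%:R :> R by rewrite ltr0n.
rewrite ler_pdivlMr ?mulr_gt0 //.
have : (2 * n).+2%:R * cosint (2 * n).+2 ^+ 2 <= pi / 2.
  by rewrite -h ler_pM2l ?ltr0n// expr2 ler_pM2r.
have -> : (2 * n).+2 = (2 * n.+1)%N by rewrite mulnSr addn2.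
rewrite wallisE natrM.
set w := wallis _; set k := _%:R => H.
rewrite -(@ler_pM2r _ (pi / 2)); last by rewrite divr_gt0.
by lra.
Qed.

(** Two integrations by parts relate [cosint] to two consecutive [sqcosint];
    divided by [cosint], the relation makes the inverse squares a
    telescoping sum. This is Matsuoka's proof of Euler's formula. *)
Lemma sqcosint_rec m : m.+1%:R ^- 2 =
  2 * (sqcosint (2 * m) / cosint (2 * m) - sqcosint (2 * m.+1) / cosint (2 * m.+1)).
Proof.
have E : cosint (2 * m.+1) - (m.+1%:R * (2 * m).+1%:R * sqcosint (2 * m)
    - 2 * m.+1%:R ^+ 2 * sqcosint (2 * m.+1)) = 0.
  rewrite /cosint /sqcosint -RintegralZl //; last exact: integrable_sqcosX.
  rewrite -RintegralZl //; last exact: integrable_sqcosX.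
  rewrite -RintegralB //; first last.
  - by apply: integrable_scale; continuity_by_derivative.
  - by apply: integrable_scale; continuity_by_derivative.
  rewrite -RintegralB //; first last.
  - by apply: integrable_cc; continuity_by_derivative.
  - exact: integrable_cosX.
  apply: (@integral_FTC R (fun x => x * cos x ^+ (2 * m.+1)
       + m.+1%:R * (x ^+ 2 * (cos x ^+ (2 * m).+1 * sin x)))) => //; first last.
  - by rewrite mulnSr addn2 sin0 cos_pihalf !expr0n /= !(mulr0, mul0r, addr0) subrr.
  - by continuity_by_derivative.
  - move=> x; apply: has_der_eq; first by der.
    have -> : (2 * m.+1 = (2 * m).+2)%N by rewrite mulnSr addn2.
    rewrite /=.
    rewrite ![_ ^+ _.+1]exprS ![_ ^+ 0]expr0.
    have -> : (2 * m).+2%:R = 2 * m%:R + 2 :> R by rewrite -addn2 natrD natrM.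
    have -> : (2 * m).+1%:R = 2 * m%:R + 1 :> R by rewrite -addn1 natrD natrM.
    have -> : m.+1%:R = m%:R + 1 :> R by rewrite -addn1 natrD.
    have s2 := sin2cos2 x.
    set c := cos x ^+ (2 * m); ring: s2.
have c1 := cosint_gt0 (2 * m); have c2 := cosint_gt0 (2 * m.+1).
have r : m.+1%:R * cosint (2 * m.+1) * 2 = (2 * m).+1%:R * cosint (2 * m).
  rewrite -cosint_rec mulrAC; congr (_ * cosint _); last by rewrite mulnSr addn2.
  by rewrite -natrM mulnC mulnSr addn2.
have m0 : m.+1%:R != 0 :> R by rewrite pnatr_eq0.
have n0 : (2 * m).+1%:R != 0 :> R by rewrite pnatr_eq0.
have {}E : cosint (2 * m.+1) = m.+1%:R * (2 * m).+1%:R * sqcosint (2 * m)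
    - 2 * m.+1%:R ^+ 2 * sqcosint (2 * m.+1) by apply/eqP; rewrite -subr_eq0 E.
have r' : cosint (2 * m) = m.+1%:R * cosint (2 * m.+1) * 2 / (2 * m).+1%:R.
  by rewrite r mulrC mulKf.
rewrite r'.
move: E c2 m0 n0; move: (cosint _) (sqcosint (2 * m)) (sqcosint _) (m.+1%:R) ((2 * m).+1%:R) => c a b u v E c2 u0 v0.
have c0 : c != 0 by rewrite gt_eqF.
have H : u ^+ 2 * c != 0 by rewrite mulf_neq0 ?expf_neq0.
apply: (mulfI H); rewrite mulrAC divff ?expf_neq0 // mul1r {1}E.
by field; rewrite u0 v0 c0.
Qed.

(** The function [sin y - 2 y / pi] vanishes at both ends and its derivative is
    decreasing, so it increases up to a point and decreases after it. *)
Lemma jordan_sin x : 0 <= x <= pi / 2 -> 2 * x / pi <= sin x.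
Proof.
move=> /andP[x0 xp]; have P := pi_gt0 R.
rewrite -subr_ge0.
pose g (y : R) : R := sin y - 2 * y / pi.
have dg y : has_der g y (cos y - 2 / pi).
  apply: has_der_eq; first by rewrite /g; der.
  by rewrite /=; ring.
have cd y z : 0 <= y -> y <= z -> z <= pi / 2 -> cos z <= cos y.
  move=> y0 yz zp; case: (eqVneq y z) => [->//|yz'].
  apply: ltW; rewrite ltr_cos ?in_itv /= ?y0 ?(le_trans y0) //=; [|lra|lra].
  by rewrite lt_neqAle yz'.
have [H|H] := lerP (2 / pi) (cos x).
- have -> : 0 = g 0 by rewrite /g sin0 mulr0 mul0r subr0.
  rewrite -/(g x); apply: (le_has_der (fun y _ => dg y)) => // y /andP[y0 yx].
  by rewrite subr_ge0 (le_trans H) // cd // ?ltW.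
- have E0 : g (pi / 2) = 0 by rewrite /g sin_pihalf mulrCA divff ?mulr1 ?divff ?subrr ?gt_eqF.
  rewrite -/(g x) -oppr_le0.
  rewrite (_ : 0 = - g (pi / 2)); last by rewrite E0 oppr0.
  apply: (@le_has_der R (fun y => - g y) (fun y => - (cos y - 2 / pi))) => //.
    by move=> y _; apply: der_opp.
  move=> y /andP[xy yp]; rewrite oppr_ge0 subr_le0 (le_trans _ (ltW H)) // cd // ?ltW //.
Qed.

Lemma sqcosint0 : sqcosint 0 = (pi / 2) ^+ 3 / 3.
Proof.
apply: (@integral_FTC R (fun x => x ^+ 3 / 3)) => //; first last.
- by rewrite expr0n /= mul0r subr0.
- by continuity_by_derivative.
- move=> x; apply: has_der_eq; first by der.
  by rewrite /=; field.
Qed.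

Lemma sqcosint_ge0 n : 0 <= sqcosint n.
Proof.
by apply: Rintegral_ge0 => x /cos_itv/andP[c0 c1]; rewrite mulr_ge0 ?sqr_ge0 ?exprn_ge0.
Qed.

(** Jordan's inequality bounds [x] by [sin x * pi / 2], and [sin x ^+ 2 * cos x
    ^+ n] is integrated by the recursion. *)
Lemma sqcosint_le n : sqcosint n <= pi ^+ 2 / 4 * (cosint n / n.+2%:R).
Proof.
have P := pi_gt0 R.
have -> : cosint n / n.+2%:R = cosint n - cosint n.+2.
  have n2 : n.+2%:R != 0 :> R by rewrite pnatr_eq0.
  apply: (mulfI n2); rewrite mulrBr cosint_rec mulrCA divff // mulr1 -mulrBl.
  by rewrite -[n.+2]addn1 natrD addrAC subrr add0r mul1r.
rewrite /cosint -RintegralB //; try exact: integrable_cosX.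
have H : mu.-integrable D (EFin \o (fun x => cos x ^+ n - cos x ^+ n.+2)).
  by apply: integrable_cc; continuity_by_derivative.
rewrite -RintegralZl //; apply: le_Rintegral => //.
- exact: integrable_sqcosX.
- by apply: integrable_scale; continuity_by_derivative.
move=> x Dx; have /andP[c0 c1] := cos_itv Dx.
move: Dx; rewrite /= in_itv /= => xp.
have := jordan_sin xp; case/andP: xp => x0 xp.
rewrite ler_pdivrMr // => J.
have -> : pi ^+ 2 / 4 * (cos x ^+ n - cos x ^+ n.+2) = (sin x * pi / 2) ^+ 2 * cos x ^+ n.
  by rewrite !exprS !expr0; have := sin2cos2 x; set c := cos x ^+ n => h; field: h.
rewrite ler_wpM2r ?exprn_ge0 // lerXn2r ?nnegrE //; last by lra.
by apply: (le_trans x0); lra.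
Qed.

Definition invsq_sum n : R := \sum_(m < n) m.+1%:R ^- 2.

Lemma invsq_sumE n : invsq_sum n = pi ^+ 2 / 6 - 2 * (sqcosint (2 * n) / cosint (2 * n)).
Proof.
elim: n => [|n IH].
  rewrite /invsq_sum big_ord0 muln0 sqcosint0 cosint0.
  by move: (pi_gt0 R); move: (pi : R) => p p0; field; rewrite gt_eqF.
by rewrite /invsq_sum big_ord_recr /= -/(invsq_sum n) IH sqcosint_rec; ring.
Qed.

Lemma basel_le n : invsq_sum n <= pi ^+ 2 / 6.
Proof.
by rewrite invsq_sumE gerBl mulr_ge0 // divr_ge0 ?sqcosint_ge0 // ltW ?cosint_gt0.
Qed.

(** The rate of convergence is what [logPoo_ge] needs. *)
Lemma basel_ge n : pi ^+ 2 / 6 - pi ^+ 2 / (4 * n.+1%:R) <= invsq_sum n.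
Proof.
rewrite invsq_sumE lerB //.
have -> : pi ^+ 2 / (4 * n.+1%:R) = 2 * (pi ^+ 2 / 4 / (2 * n.+1)%:R) :> R.
  have n0 : n.+1%:R != 0 :> R by rewrite pnatr_eq0.
  rewrite natrM; move: n0; move: (n.+1%:R : R) (pi : R) => a p a0.
  by field; rewrite a0.
rewrite ler_pM2l // ler_pdivrMr ?cosint_gt0 //.
by rewrite (le_trans (sqcosint_le _)) // mulnSr addn2 !mulrA mulrAC.
Qed.

End WallisBasel.

(** * The logarithm of the partition product: convexity *)

Section BoseSums.
Variable R : realType.
Implicit Types (s t x y d : R) (N M k m : nat).

(** The mean of the geometric law with ratio [e^-x] (the Bose-Einstein
    occupation number); it is also the derivative of [ell]. *)
Definition bose x : R := (expR x - 1)^-1.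
(** The variance of the same law, equal to minus the derivative of [bose]. *)
Definition bosevar x : R := bose x * (1 + bose x).
Definition ell x : R := ln (1 - expR (- x)).
(** The logarithm of [prod_(k <= N) (1 - e^(-k s))^-1]; [mean] and [variance]
    are minus its derivative and its second derivative. *)
Definition logP N s : R := - \sum_(k < N) ell (k.+1%:R * s).
Definition mean N s : R := \sum_(k < N) k.+1%:R * bose (k.+1%:R * s).
Definition variance N s : R := \sum_(k < N) k.+1%:R ^+ 2 * bosevar (k.+1%:R * s).
(** Bounds what the parts larger than [N] contribute to the logarithm, see
    [logPoo_le_tail]. *)
Definition tail N s : R := expR (- (N%:R * s)) * (s^-1 * (1 + s^-1)).

Lemma ln_le_sub1 x : 0 < x -> ln x <= x - 1.
Proof. by move=> x0; rewrite -[X in ln X](subrKC 1) le_ln1Dx //; lra. Qed.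

Lemma onem_expRN_gt0 x : 0 < x -> 0 < 1 - expR (- x).
Proof. by move=> x0; rewrite subr_gt0 expR_lt1 oppr_lt0. Qed.

Lemma onem_expRN_le x : 1 - expR (- x) <= x.
Proof. by have ? := expR_ge1Dx (- x); lra. Qed.

Lemma onem_expRN_ge x : x * expR (- x) <= 1 - expR (- x).
Proof.
have h := expR_ge1Dx x; have p := expR_gt0 (- x).
have : (1 + x) * expR (- x) <= 1 by rewrite -[leRHS](expRxMexpNx_1 x) ler_pM2r.
by rewrite mulrDl mul1r => ?; lra.
Qed.

Lemma expRB1_gt0 x : 0 < x -> 0 < expR x - 1.
Proof. by move=> x0; rewrite subr_gt0 expR_gt1. Qed.

Lemma boseE x : 0 < x -> bose x = expR (- x) / (1 - expR (- x)).
Proof.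
move=> x0; have a := expR_gt0 x; have b := expRB1_gt0 x0.
rewrite /bose expRN; move: a b; move: (expR x) => e a b.
by field; rewrite !gt_eqF.
Qed.

Lemma bose_gt0 x : 0 < x -> 0 < bose x.
Proof. by move=> x0; rewrite invr_gt0 expRB1_gt0. Qed.

Lemma bose_le x : 0 < x -> bose x <= x^-1.
Proof.
move=> x0; rewrite /bose lef_pV2 ?posrE ?expRB1_gt0 //.
by have ? := expR_ge1Dx x; lra.
Qed.

Lemma bose_ge x : 0 < x -> x^-1 - 1 <= bose x.
Proof.
move=> x0; rewrite boseE // ler_pdivlMr ?onem_expRN_gt0 //.
have a := onem_expRN_le x; have b := onem_expRN_gt0 x0.
have [x1|x1] := lerP x 1; last first.
  have : x^-1 <= 1 by rewrite invf_le1 // ltW.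
  by have := expR_gt0 (- x) => ? ?; nra.
have : (x^-1 - 1) * (1 - expR (- x)) <= (x^-1 - 1) * x.
  by rewrite ler_wpM2l // subr_ge0 invf_ge1.
by rewrite [leRHS]mulrBl mulVf ?gt_eqF // => ?; lra.
Qed.

Lemma ell_le0 x : 0 < x -> ell x <= 0.
Proof. by move=> x0; apply: ln_le0; have ? := expR_gt0 (- x); lra. Qed.

Lemma ell_ge x : 0 < x -> - bose x <= ell x.
Proof.
move=> x0; rewrite lerNl -lnV ?posrE ?onem_expRN_gt0 //.
rewrite (le_trans (ln_le_sub1 _)) ?invr_gt0 ?onem_expRN_gt0 //.
rewrite boseE // -[X in _ - X](divff (x := 1 - expR (- x))) ?gt_eqF ?onem_expRN_gt0 //.
by rewrite -[X in X - _]mul1r -mulrBl subKr.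
Qed.

(** [ell] is concave with derivative [bose]; the bound [ln z <= z - 1] proves it
    directly. *)
Lemma ell_tangent x y : 0 < x -> 0 < y -> ell y - ell x <= (y - x) * bose x.
Proof.
move=> x0 y0; have a := onem_expRN_gt0 x0; have b := onem_expRN_gt0 y0.
rewrite /ell -ln_div ?posrE // (le_trans (ln_le_sub1 _)) ?divr_gt0 //.
rewrite boseE // -[X in _ - X](divff (x := 1 - expR (- x))) ?gt_eqF //.
rewrite -mulrBl mulrA ler_pM2r ?invr_gt0 //.
have -> : expR (- y) = expR (- x) * expR (- (y - x)) by rewrite -expRD; congr expR; ring.
have ? := onem_expRN_le (y - x); have ? := expR_gt0 (- x); nra.
Qed.

(** [bose] is convex with derivative [- bosevar]. *)
Lemma bose_tangent x y : 0 < x -> 0 < y -> - (y - x) * bosevar x <= bose y - bose x.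
Proof.
move=> x0 y0; have a := expRB1_gt0 x0; have b := expRB1_gt0 y0.
have E : expR y = expR x * expR (y - x) by rewrite -expRD; congr expR; ring.
have F := expR_ge1Dx (y - x).
have G := onem_expRN_ge (y - x).
have H := expR_gt0 (y - x).
have I : expR (y - x) * expR (- (y - x)) = 1 by rewrite expRxMexpNx_1.
(* the claim, multiplied by a positive denominator and expanded *)
have K : 0 <= (expR x - 1) * ((y - x) * expR (y - x) - expR (y - x) + 1) + (y - x) * (expR (y - x) - 1).
  apply: addr_ge0.
    apply: mulr_ge0; first exact: ltW.
    have := onem_expRN_le (y - x).
    move: I H; move: (y - x) (expR (y - x)) (expR (- (y - x))) => d e f I H J.
    have ? : e * (1 - f) <= e * d by rewrite ler_pM2l.
    by lra.
  have [d0|d0] := lerP 0 (y - x); first by rewrite mulr_ge0 // subr_ge0 -[leLHS]expR0 ler_expR.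
  by rewrite mulr_le0 // ?ltW // subr_lt0 expR_lt1.
rewrite -subr_ge0 /bosevar /bose.
rewrite E in b *; set d := y - x in b E F G H I K *.
move: a b K; move: (expR x) (expR d) => u e a b K.
have -> : (u * e - 1)^-1 - (u - 1)^-1 - - d * ((u - 1)^-1 * (1 + (u - 1)^-1))
  = ((u - 1) * (d * e - e + 1) + d * (e - 1)) * u / ((u - 1) ^+ 2 * (u * e - 1)).
  by field; rewrite !gt_eqF.
apply: divr_ge0; first by apply: mulr_ge0 => //; lra.
by apply: mulr_ge0; [exact: sqr_ge0|exact: ltW].
Qed.

Lemma sum_geo_expR N t : 0 < t ->
  \sum_(k < N) expR (- (k.+1%:R * t)) = (1 - expR (- (N%:R * t))) * bose t.
Proof.
move=> t0; have b := expRB1_gt0 t0.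
elim: N => [|N IH]; first by rewrite big_ord0 mul0r oppr0 expR0 subrr mul0r.
rewrite big_ord_recr /= IH.
have -> : expR (- (N%:R * t)) = expR (- (N.+1%:R * t)) * expR t.
  by rewrite -expRD; congr expR; rewrite -natr1; ring.
rewrite /bose; move: b; move: (expR t) (expR (- (_ * t))) => u v b.
by field; rewrite gt_eqF.
Qed.

(** The graph of the convex function [logP N] is above its tangent at [x]. *)
Lemma logP_tangent N x y : 0 < x -> 0 < y ->
  logP N x - logP N y <= (y - x) * mean N x.
Proof.
move=> x0 y0; rewrite /logP opprK addrC -sumrB /mean mulr_sumr.
apply: ler_sum => k _; have k0 : 0 < k.+1%:R :> R by rewrite ltr0n.
rewrite (le_trans (ell_tangent _ _)) ?mulr_gt0 //.
by rewrite -mulrBr (mulrCA (y - x)) mulrA.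
Qed.

(** The graph of the convex function [mean N] is above its tangent at [x]. *)
Lemma mean_tangent N x y : 0 < x -> 0 < y ->
  mean N x - mean N y <= (y - x) * variance N x.
Proof.
move=> x0 y0; rewrite /mean -sumrB /variance mulr_sumr.
apply: ler_sum => k _; have k0 : 0 < k.+1%:R :> R by rewrite ltr0n.
have := @bose_tangent (k.+1%:R * x) (k.+1%:R * y); rewrite !mulr_gt0 // => /(_ isT isT).
move/(ler_wpM2l (ltW k0)).
set a := bose (_ * x); set b := bose (_ * y); set v := bosevar (_ * x).
by move: a b v (k.+1%:R : R) => a b v c H; lra.
Qed.

End BoseSums.

Section LogP.
Variable R : realType.
Implicit Types (a b c s t x y d : R) (N M J k m : nat).
Local Notation zeta2 := (pi ^+ 2 / 6 : R).

(** Passage to the limit in a bound with error [O(1/M)]. *)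
Lemma le_of_le_add_inv a b c : 0 <= c -> (forall M, a <= b + c / M.+1%:R) -> a <= b.
Proof.
move=> c0 H; apply/ler_addgt0Pr => e e0.
pose M := Num.truncn (c / e).
rewrite (le_trans (H M)) // lerD2l ler_pdivrMr ?ltr0n // mulrC -ler_pdivrMr //.
exact: (ltW (truncnS_gt _)).
Qed.

Lemma expRN_le_inv x : 0 < x -> expR (- x) <= x^-1.
Proof.
by move=> x0; rewrite expRN lef_pV2 ?posrE ?expR_gt0 //; have ? := expR_ge1Dx x; lra.
Qed.

(** The Taylor polynomial of [- ln (1 - t)], of degree [M]. *)
Definition logtaylor M t : R := \sum_(m < M) t ^+ m.+1 / m.+1%:R.

Lemma der_logtaylor M t : has_der (logtaylor M) t (\sum_(m < M) t ^+ m).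
Proof.
elim: M => [|M IH].
  rewrite big_ord0 (_ : logtaylor 0 = fun=> 0); first exact: der_cst.
  by apply/funext => y; rewrite /logtaylor big_ord0.
rewrite big_ord_recr /= (_ : logtaylor _ = fun y => logtaylor M y + y ^+ M.+1 / M.+1%:R).
  apply: der_add => //; apply: has_der_eq; first by der.
  rewrite /=; have h : M.+1%:R != 0 :> R by rewrite pnatr_eq0.
  by rewrite mulr0 add0r mulr1 mulrA mulVf // mul1r.
by apply/funext => y; rewrite /logtaylor big_ord_recr.
Qed.

Lemma der_log_remainder M t : t < 1 ->
  has_der (fun y => - ln (1 - y) - logtaylor M y) t (t ^+ M / (1 - t)).
Proof.
move=> t1; apply: has_der_eq.
  apply: der_add; last by apply: der_opp; exact: der_logtaylor.
  by der; rewrite subr_gt0.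
have h : 1 - t != 0 by rewrite subr_eq0 gt_eqF.
have := subrX1 t M; set S := \sum_(i < M) _ => E.
have -> : t ^+ M = 1 + (t - 1) * S by rewrite -E subrKC.
by move: S E => S _; field.
Qed.

Lemma log_remainder_ge0 M y : 0 <= y < 1 -> logtaylor M y <= - ln (1 - y).
Proof.
move=> /andP[y0 y1]; rewrite -subr_ge0.
pose F t := - ln (1 - t) - logtaylor M t.
have F0 : F 0 = 0.
  by rewrite /F subr0 ln1 oppr0 /logtaylor big1 ?subrr // => i _; rewrite expr0n /= mul0r.
suff : F 0 <= F y by rewrite F0.
apply: (@le_has_der R F (fun t => t ^+ M / (1 - t))); last exact: y0.
  by move=> x /andP[_ xy]; apply: der_log_remainder; rewrite (le_lt_trans xy).
move=> x /andP[x0 xy]; rewrite divr_ge0 ?exprn_ge0 ?subr_ge0 ?(ltW x0) //.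
by rewrite (le_trans (ltW xy)) // ltW.
Qed.

Lemma log_remainder_le M y : 0 <= y < 1 ->
  - ln (1 - y) <= logtaylor M y + y ^+ M * (y / (1 - y)).
Proof.
move=> /andP[y0 y1]; set c := y ^+ M / (1 - y).
have -> : y ^+ M * (y / (1 - y)) = y * c by rewrite /c mulrCA.
rewrite -lerBlDl -subr_ge0.
pose F t := t * c - (- ln (1 - t) - logtaylor M t).
have F0 : F 0 = 0.
  rewrite /F subr0 ln1 oppr0 mul0r /logtaylor big1 ?subrr ?oppr0 // => i _.
  by rewrite expr0n /= mul0r.
suff : F 0 <= F y by rewrite F0.
apply: (@le_has_der R F (fun t => c - t ^+ M / (1 - t))); last exact: y0.
  move=> x /andP[_ xy]; apply: has_der_eq.
    apply: der_add; last by apply: der_opp; apply: der_log_remainder; rewrite (le_lt_trans xy).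
    by der.
  by rewrite mulr0 mulr1 add0r.
move=> x /andP[x0 xy]; rewrite subr_ge0 /c ler_pM ?exprn_ge0 ?invr_ge0 ?subr_ge0 ?(ltW x0) //.
- by rewrite (le_trans (ltW xy)) // ltW.
- by rewrite lerXn2r ?nnegrE ?(ltW x0) // ltW.
- by rewrite lef_pV2 ?posrE ?subr_gt0 ?lerD2l ?lerN2 ?(lt_trans xy) // ltW.
Qed.

Lemma expRM_sum M x : 0 < x ->
  logtaylor M (expR (- x)) = \sum_(m < M) expR (- (m.+1%:R * x)) / m.+1%:R.
Proof. by move=> x0; apply: eq_bigr => m _; rewrite -expRM_natl mulrN. Qed.

Lemma expRN_itv x : 0 < x -> 0 <= expR (- x) < 1.
Proof. by move=> x0; rewrite expR_ge0 expR_lt1 oppr_lt0. Qed.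

(** Exchanging the sums over parts and over powers: the sum over the parts is
    geometric. *)
Lemma sum_logtaylor N M s : 0 < s ->
  \sum_(k < N) logtaylor M (expR (- (k.+1%:R * s))) =
  \sum_(m < M) (1 - expR (- (N%:R * (m.+1%:R * s)))) * bose (m.+1%:R * s) / m.+1%:R.
Proof.
move=> s0; under eq_bigr do rewrite expRM_sum ?mulr_gt0 ?ltr0n //.
rewrite exchange_big /=; apply: eq_bigr => m _.
rewrite -sum_geo_expR ?mulr_gt0 ?ltr0n // mulr_suml.
by apply: eq_bigr => k _; rewrite mulrCA.
Qed.

(** Expand each logarithm, exchange the sums and bound [bose x] by [1/x]: the
    sum of inverse squares appears. *)
Lemma logP_le N s : 0 < s -> logP N s <= zeta2 / s.
Proof.
move=> s0; apply: (@le_of_le_add_inv _ _ (N%:R * (s^-1 * s^-1))).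
  by rewrite !mulr_ge0 ?ler0n ?invr_ge0 // ltW.
move=> M.
have H k : - ell (k.+1%:R * s) <= logtaylor M.+1 (expR (- (k.+1%:R * s))) + s^-1 * s^-1 / M.+1%:R.
  have k0 : 0 < k.+1%:R * s by rewrite mulr_gt0 // ltr0n.
  have ks : s <= k.+1%:R * s by rewrite ler_peMl ?(ltW s0) // ler1n.
  rewrite (le_trans (log_remainder_le M.+1 (expRN_itv k0))) // lerD2l -boseE //.
  rewrite mulrC -mulrA ler_pM ?exprn_ge0 ?expR_ge0 //.
  - by rewrite ltW ?bose_gt0.
  - by rewrite (le_trans (bose_le k0)) // lef_pV2 ?posrE.
  - rewrite -expRM_natl mulrN (le_trans (expRN_le_inv _)) ?mulr_gt0 ?ltr0n // -invfM.
    by rewrite lef_pV2 ?posrE ?mulr_gt0 ?ltr0n // [leLHS]mulrC ler_pM2l ?ltr0n.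
rewrite /logP -sumrN; apply: le_trans; first by apply: ler_sum => k _; exact: H.
rewrite big_split /= sum_logtaylor // sumr_const card_ord.
have -> : s^-1 / s / M.+1%:R *+ N = N%:R * (s^-1 / s) / M.+1%:R by rewrite -mulr_natl mulrA.
rewrite lerD2r.
apply: (@le_trans _ _ (invsq_sum R M.+1 / s)); last first.
  by rewrite ler_pM2r ?invr_gt0 // basel_le.
rewrite /invsq_sum mulr_suml; apply: ler_sum => m _.
have m0 : 0 < m.+1%:R :> R by rewrite ltr0n.
have -> : m.+1%:R ^- 2 / s = (m.+1%:R * s)^-1 / m.+1%:R.
  by move: m0; move: (m.+1%:R : R) => v v0; field; rewrite !gt_eqF.
rewrite ler_pM2r ?invr_gt0 // (le_trans _ (bose_le _)) ?mulr_gt0 //.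
by rewrite ler_piMl ?(ltW (bose_gt0 (mulr_gt0 m0 s0))) // lerBlDr lerDl expR_ge0.
Qed.

Lemma logP_nondecr N M s : 0 < s -> (N <= M)%N -> logP N s <= logP M s.
Proof.
move=> s0 /subnKC <-; elim: (M - N)%N => [|j IH]; first by rewrite addn0.
rewrite addnS (le_trans IH) // /logP big_ord_recr /= opprD lerDl oppr_ge0.
by rewrite ell_le0 // mulr_gt0 // ltr0n.
Qed.

(** The logarithm of the infinite product. The partial sums increase and are
    bounded by [logP_le], so the supremum is their limit. *)
Definition logPoo s : R := sup (range (fun N => logP N s)).

Lemma logP_le_logPoo N s : 0 < s -> logP N s <= logPoo s.
Proof.
move=> s0; apply: ub_le_sup; last by exists N.
by exists (zeta2 / s) => _ [M _ <-]; exact: logP_le.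
Qed.

Lemma logPoo_le s b : (forall N, logP N s <= b) -> logPoo s <= b.
Proof.
move=> H; apply: sup_le_ub; first by exists (logP 0 s); exists 0%N.
by move=> _ [M _ <-].
Qed.

(** The same expansion, cut at degree [M] and with [bose x >= 1/x - 1]. *)
Lemma logPoo_ge M s : 0 < s ->
  (zeta2 - pi ^+ 2 / (4 * M.+1%:R)) / s - M%:R <= logPoo s.
Proof.
move=> s0.
set S := \sum_(m < M) bose (m.+1%:R * s) / m.+1%:R.
have S0 : 0 <= S.
  by apply: sumr_ge0 => m _; rewrite divr_ge0 // ltW // bose_gt0 // mulr_gt0 // ltr0n.
have H : S <= logPoo s.
  apply: (@le_of_le_add_inv _ _ (s^-1 * S)); first by rewrite mulr_ge0 // invr_ge0 ltW.
  move=> N; rewrite -lerBlDr; apply: le_trans (logP_le_logPoo N.+1 s0).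
  have -> : S - s^-1 * S / N.+1%:R = (1 - s^-1 / N.+1%:R) * S.
    by rewrite mulrBl mul1r; congr (_ - _); rewrite mulrAC.
  apply: (@le_trans _ _ (\sum_(k < N.+1) logtaylor M (expR (- (k.+1%:R * s))))).
    rewrite sum_logtaylor // mulr_sumr; apply: ler_sum => m _.
    have m0 : 0 < m.+1%:R * s by rewrite mulr_gt0 // ltr0n.
    rewrite [leLHS]mulrA ler_pM2r ?invr_gt0 ?ltr0n // ler_pM2r ?bose_gt0 // lerD2l lerN2.
    rewrite (le_trans (expRN_le_inv _)) ?mulr_gt0 ?ltr0n // invfM mulrC ler_pM2r ?invr_gt0 ?ltr0n //.
    by rewrite lef_pV2 ?posrE // ler_peMl ?(ltW s0) // ler1n.
  rewrite /logP -sumrN; apply: ler_sum => k _.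
  by apply: log_remainder_ge0; apply: expRN_itv; rewrite mulr_gt0 // ltr0n.
apply: le_trans H.
apply: (@le_trans _ _ (invsq_sum R M / s - M%:R)).
  by rewrite lerD2r ler_pM2r ?invr_gt0 // basel_ge.
have -> : M%:R = \sum_(m < M) (1 : R) by rewrite sumr_const card_ord.
rewrite /invsq_sum mulr_suml -sumrB; apply: ler_sum => m _.
have m0 : 0 < m.+1%:R :> R by rewrite ltr0n.
have m1 : 1 <= m.+1%:R :> R by rewrite ler1n.
rewrite ler_pdivlMr // mulrBl mul1r.
apply: le_trans (bose_ge _); last by rewrite mulr_gt0.
apply: (@le_trans _ _ ((m.+1%:R * s)^-1 - m.+1%:R)); last by rewrite lerD2l lerN2.
rewrite lerD2r; move: m0; move: (m.+1%:R : R) => v v0.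
have -> : v ^- 2 / s * v = (v * s)^-1 by field; rewrite !gt_eqF.
by [].
Qed.

Lemma tail_ge0 N s : 0 < s -> 0 <= tail N s.
Proof. by move=> s0; rewrite /tail !mulr_ge0 ?expR_ge0 ?addr_ge0 ?invr_ge0 ?(ltW s0). Qed.

(** The omitted logarithms are dominated by a geometric series. *)
Lemma logPoo_le_tail N s : 0 < s -> logPoo s <= logP N s + tail N s.
Proof.
move=> s0; apply: logPoo_le => M.
have [MN|NM] := leqP M N.
  by rewrite (le_trans (logP_nondecr s0 MN)) // lerDl tail_ge0.
rewrite -(subnKC (ltnW NM)); set j := (M - N)%N.
rewrite /logP big_split_ord /= opprD lerD2l -sumrN.
apply: (@le_trans _ _ (\sum_(k < j) expR (- (N%:R * s)) * (1 + s^-1) * expR (- (k.+1%:R * s)))).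
  apply: ler_sum => k _; rewrite -addnS natrD mulrDl.
  have k0 : 0 < k.+1%:R * s by rewrite mulr_gt0 // ltr0n.
  have n0 : 0 <= N%:R * s by rewrite mulr_ge0 // ltW.
  have nk : 0 < N%:R * s + k.+1%:R * s by rewrite ltr_wpDl.
  rewrite lerNl; apply: le_trans (ell_ge nk); rewrite lerN2 boseE // opprD expRD.
  rewrite [leRHS]mulrAC ler_pM2l ?mulr_gt0 ?expR_gt0 //.
  have sk : s <= N%:R * s + k.+1%:R * s by rewrite ler_wpDl // ler_peMl ?(ltW s0) // ler1n.
  apply: (@le_trans _ _ (1 - expR (- s))^-1).
    by rewrite -expRD -opprD lef_pV2 ?posrE ?onem_expRN_gt0 // lerD2l lerN2 ler_expR lerN2.
  have := bose_le s0; rewrite boseE //; have := onem_expRN_gt0 s0.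
  move: (expR (- s)) => e e1 H.
  have -> : (1 - e)^-1 = 1 + e / (1 - e) by field; rewrite gt_eqF.
  by rewrite lerD2l.
rewrite -mulr_sumr sum_geo_expR // /tail -mulrA ler_pM2l ?expR_gt0 // mulrC.
rewrite ler_pM2r ?addr_gt0 ?invr_gt0 // (le_trans _ (bose_le s0)) //.
by rewrite ler_piMl ?(ltW (bose_gt0 s0)) // gerBl expR_ge0.
Qed.

End LogP.

(** * The partition product near the singularity *)

Section LogPAsymptotics.
Variable R : realType.
Implicit Types (a b c s t x y d : R) (N M J k m : nat).

Definition sinh2 y : R := expR y - expR (- y).

(** The hyperbolic sine is convex and vanishes at 0. *)
Lemma sinh2_le c t : 0 <= c <= 1 -> 0 <= t -> sinh2 (c * t) <= c * sinh2 t.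
Proof.
move=> /andP[c0 c1] t0; rewrite -subr_ge0.
pose F y := c * (expR y - expR (- y)) - (expR (c * y) - expR (- (c * y))).
have F0 : F 0 = 0 by rewrite /F mulr0 oppr0 expR0 !subrr mulr0 subrr.
suff : F 0 <= F t by rewrite F0.
pose G y := c * ((expR y + expR (- y)) - (expR (c * y) + expR (- (c * y)))).
apply: (@le_has_der R F G); last exact: t0.
  by move=> x _; apply: has_der_eq; [by rewrite /F; der|rewrite /G; ring].
move=> x /andP[x0 _]; rewrite /G mulr_ge0 //.
have cx : c * x <= x by rewrite ler_piMl // ltW.
have cx0 : 0 <= c * x by rewrite mulr_ge0 // ltW.
have e1 := expRxMexpNx_1 x; have e2 := expRxMexpNx_1 (c * x).
have h1 : expR (c * x) <= expR x by rewrite ler_expR.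
have h2 : 1 <= expR (c * x) by rewrite -[leLHS]expR0 ler_expR.
have h3 : 0 < expR (- x) by exact: expR_gt0.
have h4 : 0 < expR (- (c * x)) by exact: expR_gt0.
move: e1 e2 h1 h2 h3 h4; move: (expR x) (expR (- x)) (expR (c * x)) (expR (- (c * x))).
move=> p q u v e1 e2 h1 h2 h3 h4.
(* cosh x - cosh (c x) factors, because e^x e^-x = 1 *)
have -> : p + q - (u + v) = (p - u) * (1 - q * v).
  rewrite mulrBr mulr1 mulrBl; ring: e1 e2.
apply: mulr_ge0; first by rewrite subr_ge0.
have v1 : v <= 1 by nra.
have q1 : q <= 1 by nra.
nra.
Qed.

(** Midpoint form of the convexity of [ln ((1 - e^-x) / x)]: writing [1 - e^-x =
    2 e^(-x/2) sinh (x/2)] turns it into [sinh2_le]. *)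
Lemma onem_expRN_mid b d : 0 < d -> d < b ->
  (1 - expR (- b)) ^+ 2 * ((b - d) * (b + d)) <=
  b ^+ 2 * ((1 - expR (- (b - d))) * (1 - expR (- (b + d)))).
Proof.
move=> d0 db; have b0 : 0 < b by exact: lt_trans db.
have c01 : 0 <= d / b <= 1 by rewrite (divr_ge0 (ltW d0) (ltW b0)) /= ler_pdivrMr // mul1r ltW.
have b2 : 0 <= b / 2 by rewrite divr_ge0 // ltW.
have := sinh2_le c01 b2.
have -> : d / b * (b / 2) = d / 2 by move: b0 => /gt_eqF b0; field; rewrite b0.
rewrite -(ler_pM2l b0) [b * (d / b * _)]mulrA [b * (d / b)]mulrCA mulfV ?gt_eqF // mulr1 /sinh2.
have e1 := expRxMexpNx_1 (b / 2); have e2 := expRxMexpNx_1 (d / 2).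
have -> : expR (- b) = expR (- (b / 2)) ^+ 2 by rewrite -expRM_natl; congr expR; field.
have -> : expR (- (b - d)) = expR (- (b / 2)) ^+ 2 * expR (d / 2) ^+ 2.
  by rewrite -!expRM_natl -expRD; congr expR; field.
have -> : expR (- (b + d)) = expR (- (b / 2)) ^+ 2 * expR (- (d / 2)) ^+ 2.
  by rewrite -!expRM_natl -expRD; congr expR; field.
have h : 0 <= expR (d / 2) - expR (- (d / 2)) by rewrite subr_ge0 ler_expR; lra.
have p0 := expR_gt0 (- (b / 2)).
move: e1 e2 h p0; move: (expR (b / 2)) (expR (- (b / 2))) (expR (d / 2)) (expR (- (d / 2))).
move=> P p Q q e1 e2 h p0 H.
have {}H : p ^+ 2 * (b * (Q - q)) ^+ 2 <= p ^+ 2 * (d * (P - p)) ^+ 2.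
  have H0 : 0 <= b * (Q - q) by rewrite mulr_ge0 // ltW.
  by rewrite ler_pM2l ?exprn_gt0 // lerXn2r ?nnegrE // (le_trans H0).
(* both sides of the goal differ from b^2 (1 - p^2)^2 by a side of H *)
have E : (1 - p ^+ 2) ^+ 2 * ((b - d) * (b + d)) + p ^+ 2 * (d * (P - p)) ^+ 2 = b ^+ 2 * (1 - p ^+ 2) ^+ 2.
  have -> : p ^+ 2 * (d * (P - p)) ^+ 2 = d ^+ 2 * (P * p - p ^+ 2) ^+ 2 by ring.
  by rewrite e1; ring.
have F : b ^+ 2 * ((1 - p ^+ 2 * Q ^+ 2) * (1 - p ^+ 2 * q ^+ 2)) + p ^+ 2 * (b * (Q - q)) ^+ 2 = b ^+ 2 * (1 - p ^+ 2) ^+ 2.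
  have -> : (1 - p ^+ 2 * Q ^+ 2) * (1 - p ^+ 2 * q ^+ 2) = 1 - p ^+ 2 * (Q ^+ 2 + q ^+ 2) + p ^+ 4 * (Q * q) ^+ 2 by ring.
  have -> : p ^+ 2 * (b * (Q - q)) ^+ 2 = b ^+ 2 * p ^+ 2 * (Q ^+ 2 + q ^+ 2 - 2 * (Q * q)) by ring.
  by rewrite e2; ring.
by lra.
Qed.

(** [ln ((1 - e^-x) / x)], extended continuously by 0 at 0. Removing the
    logarithmic singularity of [ell] leaves a convex function that tends to
    0 at 0. *)
Definition logratio x : R := if x == 0 then 0 else ell x - ln x.

(** Convexity of [logratio] on equally spaced points, the first of which may be
    the singular point 0. *)
Lemma logratio_mid x s : 0 <= x -> 0 < s ->
  2 * logratio (x + s) <= logratio x + logratio (x + s + s).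
Proof.
move=> x0 s0.
have b0 : 0 < x + s by rewrite ltr_wpDl.
have c0 : 0 < x + s + s by rewrite addr_gt0.
rewrite /logratio !(gt_eqF c0) !(gt_eqF b0).
move: x0; rewrite le_eqVlt => /orP[/eqP <-|x0]; last first.
  rewrite gt_eqF //.
  have H : s < x + s by rewrite ltrDr.
  have {}H := onem_expRN_mid s0 H; rewrite addrK in H.
  have a1 := onem_expRN_gt0 x0; have a2 := onem_expRN_gt0 b0; have a3 := onem_expRN_gt0 c0.
  rewrite -ler_ln ?posrE ?mulr_gt0 ?exprn_gt0 // in H.
  rewrite !lnM ?posrE ?mulr_gt0 ?exprn_gt0 // ?lnXn // in H.
  by rewrite /ell; lra.
rewrite eqxx !add0r.
have e0 := onem_expRN_gt0 s0; have e2 : 0 < 1 - expR (- (s + s)) by rewrite onem_expRN_gt0 // addr_gt0.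
(* at the singular point the claim amounts to tanh (s/2) <= s/2 *)
have H : (1 - expR (- s)) ^+ 2 * (s + s) <= s ^+ 2 * (1 - expR (- (s + s))).
  have : 2 * (1 - expR (- s)) <= s * (1 + expR (- s)).
    rewrite -subr_ge0.
    pose F y := y * (1 + expR (- y)) - 2 * (1 - expR (- y)).
    have F0 : F 0 = 0 by rewrite /F oppr0 expR0 mul0r subrr mulr0 subrr.
    suff : F 0 <= F s by rewrite F0.
    pose G y := 1 - expR (- y) - y * expR (- y).
    apply: (@le_has_der R F G); last exact: ltW.
      by move=> z _; apply: has_der_eq; [by rewrite /F; der|rewrite /G; ring].
    by move=> z _; rewrite /G subr_ge0 onem_expRN_ge.
  rewrite -(ler_pM2l (mulr_gt0 s0 e0)) opprD expRD.
  by move: (expR (- s)) => e; lra.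
have s2 : 0 < s + s by rewrite addr_gt0.
rewrite -ler_ln ?posrE ?mulr_gt0 ?exprn_gt0 // in H.
rewrite !lnM ?posrE ?mulr_gt0 ?exprn_gt0 // ?lnXn // in H.
by rewrite /ell; lra.
Qed.

(** The factors of the product at [2 s] are the even-numbered factors of the
    product at [s]; so [2 logP (2 s) - logP s] becomes this alternating sum,
    see [logP_alternating]. *)
Definition alternating J s : R :=
  \sum_(j < J) (ell ((2 * j + 1)%:R * s) - ell ((2 * j + 2)%:R * s)).

Lemma logP_alternating J s : 2 * logP J (2 * s) - logP (2 * J) s = alternating J s.
Proof.
rewrite /logP /alternating; elim: J => [|J IH].
  by rewrite muln0 !big_ord0 oppr0 mulr0 subrr.
rewrite mulnSr addn2 !big_ord_recr /= -IH.
have -> : J.+1%:R * (2 * s) = (2 * J + 2)%:R * s.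
  have -> : (2 * J + 2 = 2 * J.+1)%N by rewrite mulnS addnC.
  by rewrite natrM; ring.
rewrite -[(2 * J).+1]addn1 -[(2 * J + 1).+1]addnS.
by ring.
Qed.

Lemma ellE x : 0 < x -> ell x = logratio x + ln x.
Proof. by move=> x0; rewrite /logratio gt_eqF // subrK. Qed.

(** The logarithms of the arguments build up the Wallis product, the scale [s]
    cancels, and differences of the convex function [logratio] remain. *)
Lemma alternating_step J s : 0 < s ->
  ell ((2 * J + 1)%:R * s) - ell ((2 * J + 2)%:R * s) + ln (wallis R J) =
  ln (wallis R J.+1) + (logratio ((2 * J + 1)%:R * s) - logratio ((2 * J + 2)%:R * s)).
Proof.
move=> s0.
have p1 : 0 < (2 * J + 1)%:R :> R by rewrite addn1 ltr0n.
have p2 : 0 < (2 * J + 2)%:R :> R by rewrite addn2 ltr0n.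
rewrite !ellE ?mulr_gt0 // !lnM ?posrE //.
rewrite /wallis big_ord_recr /= -/(wallis R J) lnM ?posrE ?wallis_gt0 ?divr_gt0 //.
rewrite ln_div ?posrE //.
by ring.
Qed.

(** By convexity [f(2j+1) - f(2j+2) <= (f(2j) - f(2j+2)) / 2] for [f =
    logratio], and the right-hand side telescopes. *)
Lemma alternating_le J s : 0 < s ->
  alternating J s <= ln (wallis R J) - logratio ((2 * J)%:R * s) / 2.
Proof.
move=> s0; rewrite /alternating; elim: J => [|J IH].
  by rewrite big_ord0 muln0 mul0r /logratio eqxx mul0r subr0 /wallis big_ord0 ln1.
rewrite big_ord_recr /=.
have E := alternating_step J s0.
have x0 : 0 <= (2 * J)%:R * s by rewrite mulr_ge0 // ltW.
have := logratio_mid x0 s0.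
have -> : (2 * J)%:R * s + s = (2 * J + 1)%:R * s by rewrite natrD mulrDl mul1r.
have -> : (2 * J + 1)%:R * s + s = (2 * J + 2)%:R * s.
  by rewrite [in RHS]addn2 -natr1 addn1 mulrDl mul1r.
rewrite mulnSr => H; lra.
Qed.

(** As in [alternating_le], with [f(2j+1) - f(2j+2) >= (f(2j+1) - f(2j+3)) / 2]. *)
Lemma alternating_ge J s : 0 < s ->
  ln (wallis R J) + logratio s / 2 - logratio ((2 * J + 1)%:R * s) / 2 <= alternating J s.
Proof.
move=> s0; rewrite /alternating; elim: J => [|J IH].
  by rewrite big_ord0 muln0 add0n mul1r /wallis big_ord0 ln1 add0r subrr.
rewrite big_ord_recr /=.
have E := alternating_step J s0.
have x0 : 0 <= (2 * J + 1)%:R * s by rewrite mulr_ge0 // ltW.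
have := logratio_mid x0 s0.
have -> : (2 * J + 1)%:R * s + s = (2 * J + 2)%:R * s.
  by rewrite [in RHS]addn2 -natr1 addn1 mulrDl mul1r.
have -> : (2 * J + 2)%:R * s + s = (2 * J.+1 + 1)%:R * s by rewrite mulnSr (natrD _ (2 * J + 2)%N 1) mulrDl mul1r.
move=> H; lra.
Qed.

End LogPAsymptotics.

Section LogPoo.
Variable R : realType.
Implicit Types (a b c s t x y d : R) (N M J k m : nat).
Local Notation zeta2 := (pi ^+ 2 / 6 : R).

Lemma pi_lt4 : pi < 4 :> R.
Proof. by have := pihalf_lt2 R; rewrite ltr_pdivrMr // -natrM. Qed.

Lemma ln_2s_pi s : 0 < s -> ln (2 * s / pi) = ln 2 + ln s - ln pi.
Proof. by move=> s0; rewrite ln_div ?lnM ?posrE ?mulr_gt0 ?pi_gt0. Qed.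

(** At the end point [ell] is negligible, so [logratio] there is minus a
    logarithm, which combines with the Wallis product to [ln (2 s / pi) /
    2]. *)
Lemma alternating_upper J s : 0 < s ->
  alternating J.+1 s <= ln (2 * s / pi) / 2 + (4 * s)^-1 / J.+1%:R.
Proof.
move=> s0; apply: le_trans (alternating_le J.+1 s0) _.
have J0 : 0 < J.+1%:R :> R by rewrite ltr0n.
have P := pi_gt0 R.
have x0 : 0 < (2 * J.+1)%:R * s by rewrite mulr_gt0 // ltr0n.
have -> : logratio ((2 * J.+1)%:R * s) = ell ((2 * J.+1)%:R * s) - ln ((2 * J.+1)%:R * s).
  by rewrite /logratio gt_eqF.
have h1 := ell_ge x0.
have h2 : bose ((2 * J.+1)%:R * s) <= 2 * ((4 * s)^-1 / J.+1%:R).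
  apply: le_trans (bose_le x0) _; rewrite natrM.
  rewrite le_eqVlt; apply/orP; left; apply/eqP.
  by move: J0; move: (J.+1%:R : R) => v v0; field; rewrite !gt_eqF.
have h3 : 2 * ln (wallis R J.+1) <= - ln pi - ln J.+1%:R.
  have -> : - ln pi - ln J.+1%:R = ln (1 / (pi * J.+1%:R)) :> R.
    by rewrite div1r lnV ?posrE ?mulr_gt0 // lnM ?posrE // opprD.
  rewrite mulr_natl -lnXn ?wallis_gt0 // ler_ln ?posrE ?exprn_gt0 ?wallis_gt0 ?wallis_le //.
  by rewrite divr_gt0 ?mulr_gt0.
rewrite ln_2s_pi // natrM !lnM ?posrE ?mulr_gt0 //.
rewrite natrM in h1 h2; move: h1 h2 h3.
move: (ell _) (bose _) (ln (wallis _ _)) (ln 2) (ln J.+1%:R) (ln s) (ln pi) (_^-1 / _) => A B C D E F G H *.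
lra.
Qed.

Lemma logratio_ge s : 0 < s -> - s <= logratio s.
Proof.
move=> s0; rewrite /logratio gt_eqF // -ln_div ?posrE ?onem_expRN_gt0 //.
rewrite -[leLHS]expRK ler_ln ?posrE ?divr_gt0 ?onem_expRN_gt0 ?expR_gt0 //.
by rewrite ler_pdivlMr // mulrC onem_expRN_ge.
Qed.

Lemma alternating_lower J s : 0 < s -> ln (2 * s / pi) / 2 - s / 2 <= alternating J s.
Proof.
move=> s0; apply: le_trans (alternating_ge J s0).
have J0 : 0 < (2 * J + 1)%:R :> R by rewrite addn1 ltr0n.
have P := pi_gt0 R.
have x0 : 0 < (2 * J + 1)%:R * s by rewrite mulr_gt0.
have -> : logratio ((2 * J + 1)%:R * s) = ell ((2 * J + 1)%:R * s) - ln ((2 * J + 1)%:R * s).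
  by rewrite /logratio gt_eqF.
have h1 := ell_le0 x0.
have h2 := logratio_ge s0.
have h3 : ln 2 - ln pi - ln (2 * J + 1)%:R <= 2 * ln (wallis R J).
  have -> : ln 2 - ln pi - ln (2 * J + 1)%:R = ln (2 / (pi * (2 * J).+1%:R)) :> R.
    by rewrite ln_div ?posrE ?mulr_gt0 ?ltr0n // lnM ?posrE ?ltr0n // opprD addrA addn1.
  rewrite [leRHS]mulr_natl -lnXn ?wallis_gt0 // ler_ln ?posrE ?exprn_gt0 ?wallis_gt0 ?wallis_ge //.
  by rewrite divr_gt0 ?mulr_gt0 ?ltr0n.
rewrite ln_2s_pi // [ln (_ * s)]lnM ?posrE //.
by lra.
Qed.

(** This replaces the functional equation of the eta function. The expansion
    [zeta2 / s + ln (s / (2 * pi)) / 2] satisfies the relation with error 0.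
    The alternating sum is squeezed by [alternating_lower] and
    [alternating_upper], and the suprema are compared along the cut-offs [J]
    and [2 J]. *)
Lemma logPoo_doubling s : 0 < s ->
  `|2 * logPoo (2 * s) - logPoo s - ln (2 * s / pi) / 2| <= s / 2.
Proof.
move=> s0; have s20 : 0 < 2 * s by rewrite mulr_gt0.
rewrite ler_norml; apply/andP; split.
  suff : logPoo s <= 2 * logPoo (2 * s) - (ln (2 * s / pi) / 2 - s / 2) by move=> ?; lra.
  apply: logPoo_le => N.
  have h : (N <= 2 * N)%N by rewrite leq_pmull.
  apply: le_trans (logP_nondecr s0 h) _.
  have h1 := logP_alternating N s; have h2 := alternating_lower N s0.
  have h3 := logP_le_logPoo N s20.
  by lra.
suff : logPoo (2 * s) <= (logPoo s + ln (2 * s / pi) / 2) / 2 by move=> ?; lra.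
apply: logPoo_le => N.
apply: (@le_of_le_add_inv _ _ _ (4 * s)^-1); first by rewrite invr_ge0 mulr_ge0 // ltW.
move=> M; pose J := maxn N M.
have h0 : logP N (2 * s) <= logP J.+1 (2 * s) by apply: logP_nondecr => //; rewrite leqW // leq_maxl.
have h1 := logP_alternating J.+1 s; have h2 := alternating_upper J s0.
have h3 := logP_le_logPoo (2 * J.+1) s0.
have h4 : (4 * s)^-1 / J.+1%:R <= (4 * s)^-1 / M.+1%:R.
  rewrite ler_pM2l ?invr_gt0 ?mulr_gt0 // lef_pV2 ?posrE ?ltr0n // ler_nat ltnS leq_maxr //.
have h5 : 0 < (4 * s)^-1 / M.+1%:R by rewrite divr_gt0 ?invr_gt0 ?mulr_gt0 ?ltr0n.
move: h0 h1 h2 h3 h4 h5; move: (ln _) (_^-1 / J.+1%:R) (_^-1 / M.+1%:R) (logPoo s) (alternating _ _) (logP N _) (logP J.+1 _) (logP (2 * J.+1) s) => *; lra.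
Qed.

Definition logPerr s : R := logPoo s - zeta2 / s - ln (s / (2 * pi)) / 2.

Lemma ln_s_2pi s : 0 < s -> ln (s / (2 * pi)) = ln s - (ln 2 + ln pi).
Proof. by move=> s0; rewrite ln_div ?lnM ?posrE ?mulr_gt0 ?pi_gt0. Qed.

Lemma logPerr_doubling s : 0 < s -> `|2 * logPerr (2 * s) - logPerr s| <= s / 2.
Proof.
move=> s0; have := logPoo_doubling s0; rewrite /logPerr ln_2s_pi // !ln_s_2pi ?mulr_gt0 //.
rewrite [ln (2 * s)]lnM ?posrE //.
have -> : zeta2 / (2 * s) = zeta2 / s / 2 by move: (pi : R) => p; field; rewrite gt_eqF.
move: (logPoo _) (logPoo _) (zeta2 / s) (ln s) (ln 2) (ln pi) => A B C D E F.
by rewrite !ler_norml => /andP[? ?]; apply/andP; split; lra.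
Qed.

(** Iterating the relation towards 0 multiplies the error by [2^-1] at each
    step, and the defects sum to a geometric series of sum [s / 6]. *)
Lemma logPerr_halving j s : 0 < s ->
  `|logPerr s| <= 2^-1 ^+ j * `|logPerr (2^-1 ^+ j * s)| + s / 6.
Proof.
elim: j s => [|j IH] s s0; first by rewrite expr0 !mul1r lerDl divr_ge0 // ltW.
have s20 : 0 < 2^-1 * s by rewrite mulr_gt0.
have := logPerr_doubling s20; rewrite mulrA divff // mul1r => h.
have h1 := IH _ s20.
rewrite !exprSr -[_ * _ * s]mulrA.
have h2 : `|2 * logPerr s| <= `|logPerr (2^-1 * s)| + 2^-1 * s / 2.
  rewrite -lerBlDl; apply: le_trans h; exact: lerB_dist.
rewrite normrM ger0_norm // in h2.
move: h1 h2; set A : R := `|logPerr s|; set B : R := `|logPerr (2^-1 * s)|; set C : R := `|logPerr _|.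
move: A B C (_ ^+ j) => A B C D h1 h2.
by lra.
Qed.

(** The crude information [t * logPerr t -> 0] with a rate: [M] is chosen large
    first, then [t] small compared to [1/M]. *)
Lemma logPerr_small M t : 0 < t <= 1 ->
  t * `|logPerr t| <= 8 / M.+1%:R + 2 * M.+1%:R * t.
Proof.
move=> /andP[t0 t1].
have M0 : 0 < M.+1%:R :> R by rewrite ltr0n.
have P := pi_gt0 R; have P4 := pi_lt4; have P2 := pi_ge2 R.
have h1 : t * logPoo t <= zeta2.
  by rewrite -ler_pdivlMl // mulrC; apply: logPoo_le => N; exact: logP_le.
have h2 : zeta2 - pi ^+ 2 / (4 * M.+1%:R) - M%:R * t <= t * logPoo t.
  have := logPoo_ge M t0; rewrite -(ler_pM2l t0) mulrBr [t * (_ / t)]mulrCA divff ?gt_eqF //.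
  by rewrite mulr1 [t * M%:R]mulrC.
have h3 : pi ^+ 2 / (4 * M.+1%:R) <= 4 / M.+1%:R :> R.
  rewrite invfM mulrA ler_pM2r ?invr_gt0 // ler_pdivrMr // expr2.
  by apply: ler_pM; rewrite ?pi_ge0 // ltW.
have h4 : M%:R * t <= M.+1%:R * t by rewrite ler_pM2r // ler_nat.
have x0 : 0 < t / (2 * pi) by rewrite divr_gt0 ?mulr_gt0.
have x1 : t / (2 * pi) <= 1 by rewrite ler_pdivrMr ?mulr_gt0 // mul1r; lra.
have h5 : ln (t / (2 * pi)) <= 0 by exact: ln_le0.
(* the logarithm is bounded by ln z <= z - 1 at z = 2 pi / (m t) and at
   z = m, where m = M + 1 *)
have h6 : - (t * ln (t / (2 * pi))) <= 8 / M.+1%:R + M.+1%:R * t.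
  have : ln (M.+1%:R^-1 / (t / (2 * pi))) <= M.+1%:R^-1 / (t / (2 * pi)) - 1.
    by apply: ln_le_sub1; rewrite divr_gt0 ?invr_gt0.
  have -> : ln (M.+1%:R^-1 / (t / (2 * pi))) = - ln M.+1%:R - ln (t / (2 * pi)).
    by rewrite -lnV ?posrE // -ln_div ?posrE ?invr_gt0.
  have g1 : ln M.+1%:R <= M.+1%:R - 1 :> R by exact: ln_le_sub1.
  move: h5; move: (ln (t / _)) => l h5 g2.
  have g3 : t * (- l) <= t * (M.+1%:R^-1 / (t / (2 * pi)) + M.+1%:R).
    rewrite ler_pM2l //; move: (ln M.+1%:R) g1 g2 => Y g1.
    by set X := _ / (t / _); clearbody X => g2; lra.
  have g4 : t * (M.+1%:R^-1 / (t / (2 * pi)) + M.+1%:R) = 2 * pi / M.+1%:R + M.+1%:R * t.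
    move: M0 P; move: (M.+1%:R : R) (pi : R) => m p M0 P; field.
    by rewrite !gt_eqF.
  rewrite -mulrN (le_trans g3) // g4 lerD2r ler_pM2r ?invr_gt0 //; lra.
rewrite -[X in X * `|_|](ger0_norm (ltW t0)) -normrM /logPerr.
have -> : t * (logPoo t - zeta2 / t - ln (t / (2 * pi)) / 2) = t * logPoo t - zeta2 - t * ln (t / (2 * pi)) / 2.
  by rewrite !mulrBr [t * (zeta2 / t)]mulrCA divff ?gt_eqF // mulr1 mulrA.
have h7 : t * ln (t / (2 * pi)) <= 0 by rewrite pmulr_rle0.
have h8 : 8 / M.+1%:R = 2 * (4 / M.+1%:R) :> R by move: M0; move: (M.+1%:R : R) => m M0; field; rewrite gt_eqF.
have h9 : 0 < 4 / M.+1%:R :> R by rewrite divr_gt0.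
have h10 : 0 < M.+1%:R * t by rewrite mulr_gt0.
rewrite -[2 * _ * t]mulrA.
move: h1 h2 h3 h4 h6 h7 h8 h9 h10.
move: (t * ln _) (t * logPoo t) (pi ^+ 2 / _) (_ * t) (_ * t) (8 / _) (4 / _) (pi ^+ 2 / 6) => A B C D E F G H.
move=> *; rewrite ler_norml; apply/andP; split; lra.
Qed.

(** Stop the iteration at [t = s / 2^j]: by [logPerr_halving] and
    [logPerr_small] only the geometric series remains as [j] grows. *)
Lemma logPerr_le s : 0 < s -> `|logPerr s| <= s / 6.
Proof.
move=> s0; apply: (@le_of_le_add_inv _ _ _ (10 / s)).
  by rewrite divr_ge0 // ltW.
move=> M.
have M0 : 0 < M.+1%:R :> R by rewrite ltr0n.
pose j := Num.truncn (s * M.+1%:R ^+ 2).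
have jM : s * M.+1%:R ^+ 2 <= 2 ^+ j.
  apply: (le_trans (ltW (truncnS_gt _))); rewrite -/j -natrX ler_nat; exact: ltn_expl.
apply: le_trans (logPerr_halving j s0) _; rewrite addrC lerD2l.
set t := 2^-1 ^+ j * s.
have t0 : 0 < t by rewrite mulr_gt0 // exprn_gt0.
have tM : t * M.+1%:R ^+ 2 <= 1.
  rewrite /t exprVn -mulrA mulrC ler_pdivrMr ?exprn_gt0 // mul1r //.
have M1 : 1 <= M.+1%:R :> R by rewrite ler1n.
have t1 : t <= 1 by apply: le_trans tM; rewrite ler_peMr ?(ltW t0) // exprn_ege1.
have := @logPerr_small M t; rewrite t0 t1 => /(_ isT) h.
have -> : 2^-1 ^+ j = t / s by rewrite /t mulfK ?gt_eqF.
rewrite mulrAC ler_pdivrMr //.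
have -> : 10 / s / M.+1%:R * s = 10 / M.+1%:R.
  by move: M0; move: (M.+1%:R : R) => m M0; field; rewrite !gt_eqF.
apply: le_trans h _.
rewrite -lerBrDl -mulrBl -mulrA ler_pdivlMr //.
by rewrite -2!mulrA [_ * (t * _)]mulrCA -expr2; lra.
Qed.

Lemma logPoo_asymp s : 0 < s ->
  zeta2 / s + ln (s / (2 * pi)) / 2 - s / 6 <= logPoo s <=
  zeta2 / s + ln (s / (2 * pi)) / 2 + s / 6.
Proof.
move=> s0; have := logPerr_le s0; rewrite /logPerr ler_norml => /andP[h1 h2].
by apply/andP; split; lra.
Qed.

End LogPoo.

(** * Mean and variance of the Boltzmann weights *)

Section Moments.
Variable R : realType.
Implicit Types (a b c s t x y d : R) (N M J k m : nat).
Local Notation zeta2 := (pi ^+ 2 / 6 : R).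

Lemma zeta2_itv : 0 < zeta2 < 3.
Proof.
have P := pi_gt0 R; have P4 := pi_lt4 R; rewrite divr_gt0 ?exprn_gt0 //=.
rewrite ltr_pdivrMr // (@lt_trans _ _ (4 ^+ 2)) //; last by rewrite expr2; lra.
by rewrite ltrXn2r ?nnegrE ?ltW.
Qed.

Lemma logP_asymp N s : 0 < s ->
  zeta2 / s + ln (s / (2 * pi)) / 2 - s / 6 - tail N s <= logP N s <=
  zeta2 / s + ln (s / (2 * pi)) / 2 + s / 6.
Proof.
move=> s0; have /andP[h1 h2] := logPoo_asymp s0.
have h3 := logP_le_logPoo N s0; have h4 := logPoo_le_tail N s0.
by apply/andP; split; lra.
Qed.

(** The tangent at [s] evaluated at [s + s^2] and [s - s^2]. The step [s^2]
    balances the error [s] of the expansion against the curvature, which is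
    of order [s^-3]. *)
Lemma mean_asymp N s : 0 < s <= 2^-1 ->
  `|s ^+ 2 * mean N s - zeta2| <= 7 * s + tail N s.
Proof.
move=> /andP[s0 s2]; have /andP[z0 z3] := zeta2_itv.
have sp : 0 < s + s ^+ 2 by rewrite addr_gt0 ?exprn_gt0.
have sm : 0 < s - s ^+ 2 by rewrite expr2; nra.
have H1 := logP_tangent N s0 sp; have H2 := logP_tangent N s0 sm.
have /andP[_ ap] := logP_asymp N sp; have /andP[_ am] := logP_asymp N sm.
have /andP[a0 _] := logP_asymp N s0.
(* 1/(s + s^2) and 1/(s - s^2), expanded to second order *)
have E1 : zeta2 / (s + s ^+ 2) <= zeta2 / s - zeta2 + zeta2 * s.
  rewrite ler_pdivrMr //.
  have -> : (zeta2 / s - zeta2 + zeta2 * s) * (s + s ^+ 2) = zeta2 + zeta2 * s ^+ 3.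
    by move: s0; move: zeta2 => z s0; field; rewrite gt_eqF.
  by rewrite lerDl mulr_ge0 ?exprn_ge0 ?ltW.
have E2 : zeta2 / (s - s ^+ 2) <= zeta2 / s + zeta2 + 2 * (zeta2 * s).
  rewrite ler_pdivrMr //.
  have -> : (zeta2 / s + zeta2 + 2 * (zeta2 * s)) * (s - s ^+ 2) = zeta2 + zeta2 * (s ^+ 2 * (1 - 2 * s)).
    by move: s0; move: zeta2 => z s0; field; rewrite gt_eqF.
  by rewrite lerDl mulr_ge0 ?(ltW z0) // mulr_ge0 ?sqr_ge0 //; lra.
have E3 : zeta2 * s <= 3 * s by rewrite ler_pM2r // ltW.
have L1 : ln ((s + s ^+ 2) / (2 * pi)) <= ln (s / (2 * pi)) + s.
  rewrite !ln_s_2pi //.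
  have -> : s + s ^+ 2 = s * (1 + s) by ring.
  have h : ln (1 + s) <= s by apply: le_ln1Dx; lra.
  by rewrite lnM ?posrE ?addr_gt0 //; lra.
have L2 : ln ((s - s ^+ 2) / (2 * pi)) <= ln (s / (2 * pi)).
  by rewrite !ln_s_2pi // lerD2r ler_ln ?posrE // gerBl sqr_ge0.
have s22 : s ^+ 2 <= s by rewrite expr2; nra.
have s20 : 0 <= s ^+ 2 by exact: sqr_ge0.
have F1 : s + s ^+ 2 - s = s ^+ 2 by ring.
have F2 : (s - s ^+ 2 - s) * mean N s = - (s ^+ 2 * mean N s) by ring.
rewrite F1 in H1; rewrite F2 in H2.
move: H1 H2 ap am a0 E1 E2 E3 L1 L2 s22 s20 {F1 F2 z0 z3 sp sm}.
move: (logP _ _) (logP _ _) (logP _ _) (ln _) (ln _) (ln _) (tail _ _) (s ^+ 2 * _) => A B C D E F G H.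
move: (s ^+ 2) zeta2 (zeta2 * s) (zeta2 / s) (zeta2 / (s - _)) (zeta2 / (s + _)) => I J K L M O.
by move=> *; rewrite ler_norml; apply/andP; split; lra.
Qed.

(** A bound valid for every [s]: the tangent at [s] evaluated at [s / 2], where
    [logP_le] applies. *)
Lemma mean_le N s : 0 < s -> mean N s <= 12 / s ^+ 2.
Proof.
move=> s0; have s20 : 0 < s / 2 by rewrite divr_gt0.
have H := logP_tangent N s0 s20; have h := logP_le N s20.
have h0 : 0 <= logP N s by rewrite (le_trans _ (logP_nondecr s0 (leq0n N))) // /logP big_ord0 oppr0.
have /andP[z0 z3] := zeta2_itv.
have h1 : zeta2 / (s / 2) <= 6 / s.
  have -> : zeta2 / (s / 2) = 2 * zeta2 / s by move: zeta2 => z; field; rewrite gt_eqF.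
  by rewrite ler_pM2r ?invr_gt0 //; move: zeta2 z0 z3 => z z0 z3; lra.
have {}H : s / 2 * mean N s <= 6 / s.
  have -> : s / 2 * mean N s = - ((s / 2 - s) * mean N s) by field.
  by move: h h1 H h0; move: (logP _ _) (logP _ _) (zeta2 / _) (6 / s) (_ * mean _ _) => A B C D E *; lra.
rewrite ler_pdivlMr ?exprn_gt0 //.
move: H; rewrite ler_pdivlMr // => H.
by rewrite expr2; lra.
Qed.

Lemma tail_decr N s t : 0 < s <= t -> tail N t <= tail N s.
Proof.
move=> /andP[s0 st]; have t0 : 0 < t by exact: lt_le_trans st.
have h : t^-1 <= s^-1 by rewrite lef_pV2.
have ti : 0 < t^-1 by rewrite invr_gt0.
rewrite /tail; apply: ler_pM; rewrite ?expR_ge0 ?mulr_ge0 ?addr_ge0 ?(ltW ti) //.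
  by rewrite ler_expR lerN2 ler_wpM2l.
by apply: ler_pM => //; rewrite ?lerD2l ?addr_ge0 ?(ltW ti).
Qed.

Lemma mean_asymp_near N s t : 0 < s -> s / 2 <= t <= 2^-1 -> tail N (s / 2) <= s ->
  `|t ^+ 2 * mean N t - zeta2| <= 9 * t.
Proof.
move=> s0 /andP[st t2] H; have t0 : 0 < t by apply: lt_le_trans st; rewrite divr_gt0.
have h1 : 0 < t <= 2^-1 by rewrite t0.
apply: le_trans (mean_asymp N h1) _.
have h : 0 < s / 2 <= t by rewrite divr_gt0.
by have h2 := tail_decr N h; lra.
Qed.

(** Tangents of [mean] at [s = d^2], evaluated at [s (1 + d)] and [s (1 - d)].
    The relative error of [mean] is [O(s)], so a relative step [d = sqrt s]
    leaves the error [O(d)]. *)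
Lemma variance_asymp N d : 0 < d <= 2^-1 -> tail N (d ^+ 2 / 2) <= d ^+ 2 ->
  `|(d ^+ 2) ^+ 3 * variance N (d ^+ 2) - 2 * zeta2| <= 100 * d.
Proof.
move=> /andP[d0 d2] H; have /andP[z0 z3] := zeta2_itv.
set s := d ^+ 2; rewrite -/s in H.
have s0 : 0 < s by rewrite exprn_gt0.
have s4 : s <= 4^-1.
  have -> : 4^-1 = 2^-1 ^+ 2 :> R by field.
  by rewrite /s lerXn2r ?nnegrE ?(ltW d0).
have y10 : 0 < s * (1 - d) by rewrite mulr_gt0 //; lra.
have y20 : 0 < s * (1 + d) by rewrite mulr_gt0 //; lra.
have b1 : s / 2 <= s * (1 - d) by rewrite ler_pM2l //; lra.
have b2 : s * (1 - d) <= s by rewrite ler_piMr ?ltW //; lra.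
have b3 : s * (1 + d) <= 3 / 2 * s by rewrite mulrC ler_pM2r //; lra.
have b4 : s <= s * (1 + d) by rewrite ler_peMr ?ltW //; lra.
have A0 := @mean_asymp_near N s s s0; have A1 := @mean_asymp_near N s (s * (1 - d)) s0.
have A2 := @mean_asymp_near N s (s * (1 + d)) s0.
have {}A0 : `|s ^+ 2 * mean N s - zeta2| <= 9 * s by apply: A0 => //; apply/andP; split; lra.
have {}A1 : `|(s * (1 - d)) ^+ 2 * mean N (s * (1 - d)) - zeta2| <= 9 * (s * (1 - d)).
  by apply: A1 => //; apply/andP; split; lra.
have {}A2 : `|(s * (1 + d)) ^+ 2 * mean N (s * (1 + d)) - zeta2| <= 9 * (s * (1 + d)).
  by apply: A2 => //; apply/andP; split; lra.
have T1 := mean_tangent N s0 y10; have T2 := mean_tangent N s0 y20.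
set V := variance N s in T1 T2 *.
have {}T1 : d * (s ^+ 3 * V) <= s ^+ 2 * mean N (s * (1 - d)) - s ^+ 2 * mean N s.
  have := ler_wpM2l (sqr_ge0 s) T1.
  by move: (mean _ _) (mean _ _) => P Q h; lra.
have {}T2 : s ^+ 2 * mean N s - s ^+ 2 * mean N (s * (1 + d)) <= d * (s ^+ 3 * V).
  have := ler_wpM2l (sqr_ge0 s) T2.
  by move: (mean _ _) (mean _ _) => P Q h; lra.
move: A0; rewrite ler_norml => /andP[A0l A0u].
(* 1/(1 - d)^2 <= 1 + 2 d + 12 d^2 on [0, 1/2] *)
have B1 : s ^+ 2 * mean N (s * (1 - d)) <= (zeta2 + 9 * s) * (1 + 2 * d + 12 * d ^+ 2).
  have u0 : 0 < (1 - d) ^+ 2 by rewrite exprn_gt0 //; lra.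
  rewrite -(ler_pM2r u0).
  move: A1; rewrite ler_norml => /andP[_]; rewrite exprMn mulrAC => A1.
  apply: (@le_trans _ _ (zeta2 + 9 * s)); first by lra.
  rewrite -[leRHS]mulrA ler_peMr //; first by apply: (addr_ge0 (ltW z0)); rewrite mulr_ge0 // ltW.
  have ? : 0 <= d ^+ 2 * (9 - 22 * d + 12 * d ^+ 2).
    by apply: mulr_ge0; [exact: sqr_ge0|rewrite expr2; nra].
  by lra.
(* 1/(1 + d)^2 <= 1 - 2 d + 3 d^2 *)
have B2 : s ^+ 2 * mean N (s * (1 + d)) <= (zeta2 + 18 * s) * (1 - 2 * d + 3 * d ^+ 2).
  have u0 : 0 < (1 + d) ^+ 2 by rewrite exprn_gt0 //; lra.
  rewrite -(ler_pM2r u0).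
  move: A2; rewrite ler_norml => /andP[_]; rewrite exprMn mulrAC => A2.
  apply: (@le_trans _ _ (zeta2 + 18 * s)); first by lra.
  rewrite -[leRHS]mulrA ler_peMr //; first by apply: (addr_ge0 (ltW z0)); rewrite mulr_ge0 // ltW.
  have ? : 0 <= d ^+ 3 * (4 + 3 * d) by rewrite mulr_ge0 ?exprn_ge0 //; lra.
  by lra.
have dz : zeta2 * d <= 3 * d by rewrite ler_pM2r // ltW.
rewrite -(ler_pM2l d0) -{1}(ger0_norm (ltW d0)) -normrM.
rewrite mulrBr ler_norml.
have D1 : zeta2 * d ^+ 2 <= 3 * d ^+ 2 by rewrite ler_pM2r ?exprn_gt0 // ltW.
have D2 : d ^+ 3 <= d ^+ 2 / 2 by rewrite exprSr ler_pM2l ?exprn_gt0.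
have D3 : d ^+ 4 <= d ^+ 2 / 4.
  have -> : d ^+ 4 = d ^+ 2 * d ^+ 2 by ring.
  by rewrite ler_pM2l.
have D4 : 0 < d ^+ 3 by rewrite exprn_gt0.
have D5 : 0 < d ^+ 4 by rewrite exprn_gt0.
have S : s = d ^+ 2 by [].
move: T1 T2 A0l A0u B1 B2 D1 D2 D3 D4 D5 S z0.
move: (s ^+ 2 * mean _ _) (s ^+ 2 * mean _ _) (s ^+ 2 * mean _ _) (s ^+ 3 * V) zeta2 => P Q U W z.
move=> T1 T2 A0l A0u B1 B2 D1 D2 D3 D4 D5 S z0.
rewrite S in T1 T2 A0l A0u B1 B2.
by apply/andP; split; lra.
Qed.

End Moments.

(** * Geometric generating functions on the unit circle *)

Section Cis.
Import complex Normc.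
Variable R : realType.
Implicit Types (x y t a b s : R) (n J : nat).

(** The complex number [e^(it)]. *)
Definition cis t : R[i] := Complex (cos t) (sin t).

Lemma cisD a b : cis (a + b) = cis a * cis b.
Proof.
apply/eqP; rewrite eq_complex /= cosD sinD; apply/andP; split; apply/eqP => //.
by rewrite addrC.
Qed.

Lemma cis0 : cis 0 = 1.
Proof. by rewrite /cis cos0 sin0. Qed.

Lemma cisX a n : cis a ^+ n = cis (n%:R * a).
Proof.
elim: n => [|n IH]; first by rewrite expr0 mul0r cis0.
by rewrite exprS IH -cisD -natr1 mulrDl mul1r addrC.
Qed.

Lemma cis_sum (I : finType) (F : I -> R) : \prod_i cis (F i) = cis (\sum_i F i).
Proof. by rewrite (big_morph cis cisD cis0). Qed.

Lemma normc_cis a : normc (cis a) = 1.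
Proof. by rewrite /= cos2Dsin2 sqrtr1. Qed.

Lemma normc_real a : normc (Complex a 0) = `|a|.
Proof. by rewrite /= expr0n /= addr0 sqrtr_sqr. Qed.

Lemma normc_ge0 (z : R[i]) : 0 <= normc z.
Proof. by case: z => a b /=; exact: sqrtr_ge0. Qed.

Lemma Re_le_normc (z : R[i]) : `|complex.Re z| <= normc z.
Proof.
by case: z => a b /=; rewrite -sqrtr_sqr ler_wsqrtr // lerDl sqr_ge0.
Qed.

Lemma normcX (z : R[i]) n : normc (z ^+ n) = normc z ^+ n.
Proof. by elim: n => [|n IH]; rewrite ?expr0 ?normc1 // !exprS normcM IH. Qed.

(** A product of factors close to 1 is close to 1: expand, and compare with the
    same expansion for the bounds. *)
Lemma normc_prod_sub1 (I : finType) (y : I -> R[i]) (a : I -> R) :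
  (forall i, normc (y i) <= a i) ->
  normc (\prod_i (1 - y i) - 1) <= \prod_i (1 + a i) - 1.
Proof.
move=> H; have a0 i : 0 <= a i.
  by apply: le_trans (H i); exact: normc_ge0.
suff [] : normc (\prod_i (1 - y i) - 1) <= \prod_i (1 + a i) - 1 /\ normc (\prod_i (1 - y i)) <= \prod_i (1 + a i) by [].
elim/big_ind2: _ => [|p P q Q [h1 h2] [h3 h4]|i _]; first by rewrite !subrr normc0 normc1.
- have -> : P * Q - 1 = (P - 1) * Q + (Q - 1) by ring.
  split; last by rewrite normcM ler_pM // normc_ge0.
  rewrite (le_trans (le_normcD _ _)) // normcM.
  have -> : p * q - 1 = (p - 1) * q + (q - 1) by ring.
  by apply: lerD => //; apply: ler_pM => //; exact: normc_ge0.
- split; last by rewrite (le_trans (le_normcD _ _)) // normc1 normcN lerD2l.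
  by rewrite addrC addKr normcN (le_trans (H i)) // addrC addKr.
Qed.

(** Modulus of [(1 - e^-x) / (1 - e^(-x + it))], the characteristic function of
    the geometric law. *)
Definition rho x t : R := (Num.sqrt (1 + 2 * bosevar x * (1 - cos t)))^-1.
(** Argument of the same characteristic function. *)
Definition alpha x t : R := atan (bose x * sin t / (1 + bose x * (1 - cos t))).

Lemma bosevar_gt0 x : 0 < x -> 0 < bosevar x.
Proof. by move=> x0; rewrite /bosevar mulr_gt0 ?addr_gt0 ?bose_gt0. Qed.

Lemma onem_cos_ge0 t : 0 <= 1 - cos t.
Proof. by rewrite subr_ge0 cos_le1. Qed.

Lemma rho_radicand x t : 0 < x -> 1 <= 1 + 2 * bosevar x * (1 - cos t).
Proof.
by move=> x0; rewrite lerDl mulr_ge0 ?onem_cos_ge0 // mulr_ge0 // ltW // bosevar_gt0.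
Qed.

Lemma rho_gt0 x t : 0 < x -> 0 < rho x t.
Proof.
by move=> x0; rewrite invr_gt0 sqrtr_gt0 (lt_le_trans ltr01) // rho_radicand.
Qed.

Lemma sin_atan y : sin (atan y) = y * cos (atan y).
Proof.
have c0 : cos (atan y) != 0.
  by rewrite cos_atan invr_eq0 gt_eqF // sqrtr_gt0 ltr_pwDl ?sqr_ge0.
by rewrite -{2}(atanK y) /tan divfK.
Qed.

(** Polar form of [1 / (1 - e^(-x + it))]. *)
Lemma geometric_factor x t : 0 < x ->
  (Complex ((1 - expR (- x))^-1) 0) * (Complex (rho x t) 0) * cis (alpha x t)
    * (1 - Complex (expR (- x)) 0 * cis t) = 1.
Proof.
move=> x0; have e0 := onem_expRN_gt0 x0; have q0 := bose_gt0 x0.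
have c0 := onem_cos_ge0 t.
(* 1 - e^-x e^(it) = (1 - e^-x) (A - i B) *)
set A := 1 + bose x * (1 - cos t); set B := bose x * sin t.
have A0 : 0 < A by rewrite ltr_pwDl // mulr_ge0 // ltW.
set S := 1 + 2 * bosevar x * (1 - cos t).
have S0 : 0 < S by rewrite (lt_le_trans ltr01) // rho_radicand.
have ES : A ^+ 2 + B ^+ 2 = S.
  rewrite /A /B /S /bosevar exprMn.
  have := sin2cos2 t; move: (sin t) (cos t) (bose x) => s c q h; ring: h.
have q : bose x * (1 - expR (- x)) = expR (- x) by rewrite boseE // divfK // gt_eqF.
have Ec : cos (alpha x t) = A / Num.sqrt S.
  rewrite /alpha -/A -/B cos_atan.
  have -> : 1 + (B / A) ^+ 2 = S / A ^+ 2.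
    by rewrite -ES; field; rewrite gt_eqF.
  rewrite sqrtrM ?(ltW S0) // sqrtrV ?sqr_ge0 // sqrtr_sqr ger0_norm ?(ltW A0) //.
  by rewrite invfM invrK mulrC.
have Es : sin (alpha x t) = B / Num.sqrt S.
  rewrite sin_atan -/A -/B -/(alpha x t) Ec mulrA divfK // gt_eqF //.
have R1 : rho x t = (Num.sqrt S)^-1 by [].
have sS : Num.sqrt S ^+ 2 = S by rewrite sqr_sqrtr // ltW.
have r0 : 0 < Num.sqrt S by rewrite sqrtr_gt0.
have Z : 1 - Complex (expR (- x)) 0 * cis t = Complex (1 - expR (- x)) 0 * Complex A (- B).
  apply/eqP; rewrite eq_complex /=; apply/andP; split; apply/eqP.
    rewrite /A; move: (bose x) (expR (- x)) (cos t) q => u v c q.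
    have {}q : u * v = u - v by rewrite -{2}q; ring.
    ring: q.
  rewrite /B; move: (bose x) (expR (- x)) (sin t) q => u v c q.
  have {}q : u * v = u - v by rewrite -{2}q; ring.
  ring: q.
rewrite Z /cis Ec Es R1.
apply/eqP; rewrite eq_complex /=; apply/andP; split; apply/eqP; last first.
  by rewrite !(mul0r, mulr0, addr0, subr0, sub0r, oppr0, add0r); ring.
rewrite !(mul0r, mulr0, addr0, subr0, sub0r, oppr0, add0r).
clear Z Ec Es R1 q A0 S0; clearbody S A B.
move: ES sS r0 e0; move: S A B (1 - expR (- x)) (Num.sqrt S) => T a b e r ES sS r0 e0.
have -> : e^-1 * r^-1 * (a / r) * (e * a) - e^-1 * r^-1 * (b / r) * (e * - b) = (a ^+ 2 + b ^+ 2) / r ^+ 2.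
  by field; rewrite !gt_eqF.
by rewrite ES sS divff // -sS expf_neq0 // gt_eqF.
Qed.

End Cis.

Section GeneratingFunction.
Import complex Normc.
Variables (R : realType) (I : finType) (w : I -> nat).
Implicit Types (s t : R) (n J : nat) (i : I).

Local Notation weight := (@weight I w _).

(** The real part of [e^(-int)] times the generating function at [e^(-s + it)],
    multiplicities being at most [J]. *)
Definition trig_sum J n s t : R :=
  \sum_(f : {ffun I -> 'I_J.+1})
     expR (- ((weight f)%:R * s)) * cos (((weight f)%:R - n%:R) * t).

(** The generating function at [e^-s]: the normalization of the Boltzmann
    weights. *)
Definition boltzmann s : R := \prod_i (1 - expR (- ((w i)%:R * s)))^-1.
Definition modulus s t : R := \prod_i rho ((w i)%:R * s) ((w i)%:R * t).
Definition phase s t : R := \sum_i alpha ((w i)%:R * s) ((w i)%:R * t).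

Lemma real_complex_prod (F : I -> R) :
  \prod_i (Complex (F i) 0 : R[i]) = Complex (\prod_i F i) 0.
Proof.
rewrite (big_morph (fun x : R => Complex x 0 : R[i]) (id1 := 1) (op1 := *%R)) //.
by move=> x y; apply/eqP; rewrite eq_complex /= !mulr0 !mul0r subr0 addr0 !eqxx.
Qed.

Lemma Re_sum (T : finType) (F : T -> R[i]) :
  complex.Re (\sum_i F i) = \sum_i complex.Re (F i).
Proof. by apply: (big_morph (@complex.Re R)) => // [[a b] [c d]]. Qed.

Lemma Re_scale (a : R) (z : R[i]) : complex.Re (Complex a 0 * z) = a * complex.Re z.
Proof. by case: z => b c /=; rewrite mul0r subr0. Qed.

(** Distributivity: a sum over families of multiplicities of products is a
    product of sums over one multiplicity. *)
Lemma trig_sumE J n s t : trig_sum J n s t = complex.Re (cis (- (n%:R * t)) *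
  \prod_i \sum_(j < J.+1) (Complex (expR (- ((w i)%:R * s))) 0 * cis ((w i)%:R * t)) ^+ j).
Proof.
rewrite bigA_distr_bigA mulr_sumr Re_sum; apply: eq_bigr => f _.
have -> : \prod_i (Complex (expR (- ((w i)%:R * s))) 0 * cis ((w i)%:R * t)) ^+ f i =
  Complex (expR (- ((weight f)%:R * s))) 0 * cis ((weight f)%:R * t).
  rewrite (eq_bigr (fun i => Complex (expR (- ((w i * f i)%:R * s))) 0 * cis ((w i * f i)%:R * t))).
    rewrite big_split /= real_complex_prod cis_sum; congr (_ * cis _).
      congr Complex; rewrite -expR_sum; congr expR.
      by rewrite sumrN -mulr_suml natr_sum.
    by rewrite -mulr_suml natr_sum.
  move=> i _; rewrite exprMn cisX; congr (_ * cis _); last by rewrite natrM; ring.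
  have -> : expR (- ((w i * f i)%:R * s)) = expR (- ((w i)%:R * s)) ^+ f i.
    by rewrite -expRM_natl natrM; congr expR; ring.
  elim: (nat_of_ord (f i)) => [|k IH]; first by rewrite !expr0.
  by rewrite !exprS IH; apply/eqP; rewrite eq_complex /= !mulr0 !mul0r subr0 addr0 !eqxx.
rewrite mulrCA Re_scale -cisD; congr (_ * _) => /=; congr cos.
by ring.
Qed.

Hypothesis w_gt0 : forall i, (0 < w i)%N.

Lemma scaled_gt0 i s : 0 < s -> 0 < (w i)%:R * s.
Proof. by move=> s0; rewrite mulr_gt0 // ltr0n. Qed.

Lemma boltzmann_gt0 s : 0 < s -> 0 < boltzmann s.
Proof.
by move=> s0; apply: prodr_gt0 => i _; rewrite invr_gt0 onem_expRN_gt0 // scaled_gt0.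
Qed.

Lemma modulus_gt0 s t : 0 < s -> 0 < modulus s t.
Proof. by move=> s0; apply: prodr_gt0 => i _; rewrite rho_gt0 // scaled_gt0. Qed.

(** Each factor is a truncated geometric series, that is [(1 - z^(J+1)) / (1 -
    z)]; the denominators give modulus and phase, the numerators are close
    to 1. *)
Lemma trig_sum_approx J n s t : 0 < s ->
  `|trig_sum J n s t / boltzmann s - modulus s t * cos (phase s t - n%:R * t)| <=
  modulus s t * (\prod_i (1 + expR (- ((w i)%:R * s)) ^+ J.+1) - 1).
Proof.
move=> s0; have B0 := boltzmann_gt0 s0; have M0 := modulus_gt0 t s0.
rewrite trig_sumE.
pose z i : R[i] := Complex (expR (- ((w i)%:R * s))) 0 * cis ((w i)%:R * t).
rewrite (eq_bigr (fun i => Complex ((1 - expR (- ((w i)%:R * s)))^-1) 0 *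
   Complex (rho ((w i)%:R * s) ((w i)%:R * t)) 0 * cis (alpha ((w i)%:R * s) ((w i)%:R * t))
   * (1 - z i ^+ J.+1))); last first.
  move=> i _; rewrite -/(z i).
  have := geometric_factor ((w i)%:R * t) (scaled_gt0 i s0); rewrite -/(z i).
  set G := _ * cis _ => E.
  have -> : 1 - z i ^+ J.+1 = (1 - z i) * \sum_(j < J.+1) z i ^+ j.
    by rewrite -opprB subrX1 -mulNr opprB.
  by rewrite mulrA E mul1r.
rewrite !big_split /= !real_complex_prod cis_sum -/(boltzmann s) -/(modulus s t) -/(phase s t).
set P := \prod_i (1 - z i ^+ J.+1).
have -> : cis (- (n%:R * t)) * (Complex (boltzmann s) 0 * Complex (modulus s t) 0 * cis (phase s t) * P) =
   Complex (boltzmann s) 0 * (Complex (modulus s t) 0 * (cis (phase s t - n%:R * t) * P)).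
  by rewrite cisD; ring.
rewrite !Re_scale mulrAC divff ?gt_eqF // mul1r -mulrBr normrM gtr0_norm // ler_pM2l //.
have -> : complex.Re (cis (phase s t - n%:R * t) * P) - cos (phase s t - n%:R * t) =
  complex.Re (cis (phase s t - n%:R * t) * (P - 1)).
  by rewrite mulrBr mulr1; case: (_ * P) => a b.
rewrite (le_trans (Re_le_normc _)) // normcM normc_cis mul1r.
apply: normc_prod_sub1 => i.
by rewrite normcX normcM normc_cis mulr1 normc_real ger0_norm // expR_ge0.
Qed.

End GeneratingFunction.

(** * Second-order expansion of one factor *)

Section TaylorBounds.
Variable R : realType.
Implicit Types (x y z t : R).

(** The form of [le_has_der] used to integrate an inequality from 0. *)
Let grow (F G : R -> R) x : (forall y, has_der F y (G y)) ->
  (forall y, 0 < y -> 0 <= G y) -> 0 <= x -> F 0 <= F x.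
Proof.
by move=> dF G0 x0; apply: (@le_has_der R F G) => // y /andP[y0 _]; exact: G0.
Qed.

Lemma sin_le x : 0 <= x -> sin x <= x.
Proof.
move=> x0; rewrite -subr_ge0.
pose F y := y - sin y; pose G y : R := 1 - cos y.
have F0 : F 0 = 0 by rewrite /F sin0 subrr.
suff : F 0 <= F x by rewrite F0.
apply: (@grow F G) => // [y|y _]; last by rewrite /G subr_ge0 cos_le1.
by apply: has_der_eq; [rewrite /F; der|rewrite /G mulr1].
Qed.

Lemma cos_ge_taylor2 x : 0 <= x -> 1 - x ^+ 2 / 2 <= cos x.
Proof.
move=> x0; rewrite -subr_ge0.
pose F y := cos y - (1 - y ^+ 2 / 2); pose G y : R := y - sin y.
have F0 : F 0 = 0 by rewrite /F cos0 expr0n /= mul0r subr0 subrr.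
suff : F 0 <= F x by rewrite F0.
apply: (@grow F G) => // [y|y y0]; last by rewrite /G subr_ge0 sin_le // ltW.
by apply: has_der_eq; [rewrite /F; der|rewrite /G /=; field].
Qed.

Lemma sin_ge_taylor3 x : 0 <= x -> x - x ^+ 3 / 6 <= sin x.
Proof.
move=> x0; rewrite -subr_ge0.
pose F y := sin y - (y - y ^+ 3 / 6); pose G y : R := cos y - (1 - y ^+ 2 / 2).
have F0 : F 0 = 0 by rewrite /F sin0 expr0n /= mul0r !subr0.
suff : F 0 <= F x by rewrite F0.
apply: (@grow F G) => // [y|y y0]; last by rewrite /G subr_ge0 cos_ge_taylor2 // ltW.
by apply: has_der_eq; [rewrite /F; der|rewrite /G /=; field].
Qed.

Lemma cos_le_taylor4 x : 0 <= x -> cos x <= 1 - x ^+ 2 / 2 + x ^+ 4 / 24.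
Proof.
move=> x0; rewrite -subr_ge0.
pose F y := 1 - y ^+ 2 / 2 + y ^+ 4 / 24 - cos y; pose G y : R := sin y - (y - y ^+ 3 / 6).
have F0 : F 0 = 0 by rewrite /F cos0 !expr0n /= !mul0r subr0 addr0 subrr.
suff : F 0 <= F x by rewrite F0.
apply: (@grow F G) => // [y|y y0]; last by rewrite /G subr_ge0 sin_ge_taylor3 // ltW.
by apply: has_der_eq; [rewrite /F; der|rewrite /G /=; field].
Qed.

Lemma onem_cos_bounds x :
  x ^+ 2 - x ^+ 4 / 12 <= 2 * (1 - cos x) <= x ^+ 2.
Proof.
rewrite -cos_norm.
have -> : x ^+ 2 = `|x| ^+ 2 by rewrite real_normK ?num_real.
have -> : x ^+ 4 = `|x| ^+ 4 by rewrite -[4%N]/(2 * 2)%N !exprM real_normK ?num_real.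
have a := normr_ge0 x; have h1 := cos_ge_taylor2 a; have h2 := cos_le_taylor4 a.
by apply/andP; split; lra.
Qed.

Lemma norm_sin_le x : `|sin x| <= `|x|.
Proof.
wlog x0 : x / 0 <= x => [H|].
  have [/H//|x0] := lerP 0 x.
  by have := H (- x); rewrite oppr_ge0 (ltW x0) sinN !normrN => /(_ isT).
rewrite [leRHS]ger0_norm // ler_norml sin_le // andbT.
have [xp|xp] := lerP x pi.
  by rewrite (@le_trans _ _ 0) ?oppr_le0 // sin_ge0_pi // x0.
have ? := sin_geN1 x; have ? := pi_ge2 R; lra.
Qed.

Lemma sin_sub_le x : `|sin x - x| <= `|x| ^+ 3 / 6.
Proof.
wlog x0 : x / 0 <= x => [H|].
  have [/H//|x0] := lerP 0 x.
  have := H (- x); rewrite oppr_ge0 (ltW x0) sinN normrN opprK => /(_ isT).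
  have -> : - sin x + x = - (sin x - x) by ring.
  by rewrite normrN.
rewrite [X in _ <= X ^+ 3 / 6]ger0_norm //.
have h1 := sin_le x0; have h2 := sin_ge_taylor3 x0.
have h3 : 0 <= x ^+ 3 by rewrite exprn_ge0.
by rewrite ler_norml; apply/andP; split; lra.
Qed.

Lemma atan_sub_le x : `|atan x - x| <= `|x| ^+ 3.
Proof.
wlog x0 : x / 0 <= x => [H|].
  have [/H//|x0] := lerP 0 x.
  have := H (- x); rewrite oppr_ge0 (ltW x0) atanN normrN opprK => /(_ isT).
  have -> : - atan x + x = - (atan x - x) by ring.
  by rewrite normrN.
rewrite [X in _ <= X ^+ 3]ger0_norm //.
have h1 : atan x <= x.
  rewrite -subr_ge0; pose F y := y - atan y; pose G y : R := 1 - (1 + y ^+ 2)^-1.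
  have F0 : F 0 = 0 by rewrite /F atan0 subrr.
  suff : F 0 <= F x by rewrite F0.
  apply: (@grow F G) => // [y|y y0]; first by apply: has_der_eq; [rewrite /F; der|rewrite /G mulr1].
  by rewrite /G subr_ge0 invf_le1 ?lerDl ?sqr_ge0 // ltr_pwDl ?sqr_ge0.
have h2 : x - x ^+ 3 <= atan x.
  rewrite -subr_ge0; pose F y := atan y - (y - y ^+ 3); pose G y : R := (1 + y ^+ 2)^-1 - (1 - 3 * y ^+ 2).
  have F0 : F 0 = 0 by rewrite /F atan0 expr0n /= !subr0.
  suff : F 0 <= F x by rewrite F0.
  apply: (@grow F G) => // [y|y y0].
    by apply: has_der_eq; [rewrite /F; der|rewrite /G /= !mulr1; ring].
  have p : 0 < 1 + y ^+ 2 by rewrite ltr_pwDl ?sqr_ge0.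
  rewrite /G subr_ge0 -[leRHS]mul1r ler_pdivlMr //.
  have := sqr_ge0 y; have := sqr_ge0 (y ^+ 2); move: (y ^+ 2) => v ? ?; rewrite -subr_ge0.
  have -> : 1 - (1 - 3 * v) * (1 + v) = 2 * v + 3 * v ^+ 2 by ring.
  by lra.
have h3 : 0 <= x ^+ 3 by rewrite exprn_ge0.
by rewrite ler_norml; apply/andP; split; lra.
Qed.

(** The lower bound is [ln_le_sub1] at the inverse. *)
Lemma ln1D_bounds z : 0 <= z -> z - z ^+ 2 <= ln (1 + z) <= z.
Proof.
move=> z0; have z1 : 0 < 1 + z by lra.
rewrite le_ln1Dx ?andbT; last by lra.
have := ln_le_sub1 (x := (1 + z)^-1); rewrite invr_gt0 lnV ?posrE // => /(_ z1).
rewrite lerNl; apply: le_trans.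
have -> : - ((1 + z)^-1 - 1) = z / (1 + z) by field; rewrite gt_eqF.
rewrite ler_pdivlMr // -subr_ge0.
have -> : z - (z - z ^+ 2) * (1 + z) = z ^+ 3 by ring.
exact: exprn_ge0.
Qed.

(** Second cumulant: [2 ln rho = - ln (1 + 2 v (1 - cos t))] with [v = bosevar
    x]. *)
Lemma rho_approx x t : 0 < x ->
  0 <= bosevar x * t ^+ 2 + 2 * ln (rho x t) <=
  (bosevar x + bosevar x ^+ 2) * t ^+ 4.
Proof.
move=> x0; have v0 := bosevar_gt0 x0.
have /andP[c1 c2] := onem_cos_bounds t.
set z := 2 * bosevar x * (1 - cos t).
have z0 : 0 <= z by rewrite mulr_ge0 ?onem_cos_ge0 // mulr_ge0 // ltW.
have z1 : 0 < 1 + z by lra.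
have E : 2 * ln (rho x t) = - ln (1 + z).
  rewrite /rho -/z lnV ?posrE ?sqrtr_gt0 // mulrN mulr_natl -lnXn ?sqrtr_gt0 //.
  by rewrite sqr_sqrtr // ltW.
rewrite E; have /andP[l1 l2] := ln1D_bounds z0.
have g1 : z <= bosevar x * t ^+ 2 by rewrite /z mulrAC mulrC ler_pM2l // mulrC.
have g2 : bosevar x * t ^+ 2 - bosevar x * t ^+ 4 / 12 <= z.
  have -> : z = bosevar x * (2 * (1 - cos t)) by rewrite /z; ring.
  by rewrite -mulrA -mulrBr ler_pM2l.
have g3 : z ^+ 2 <= bosevar x ^+ 2 * t ^+ 4.
  have -> : bosevar x ^+ 2 * t ^+ 4 = (bosevar x * t ^+ 2) ^+ 2 by ring.
  by rewrite lerXn2r ?nnegrE // (le_trans z0).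
have g4 : 0 <= bosevar x * t ^+ 4.
  by rewrite mulr_ge0 ?(ltW v0) // -[4%N]/(2 * 2)%N exprM sqr_ge0.
by apply/andP; split; lra.
Qed.

(** First cumulant: the argument is [bose x * t] up to third order, uniformly in
    [x] when the error is measured in powers of [bose x]. *)
Lemma alpha_approx x t : 0 < x ->
  `|alpha x t - bose x * t| <= (bose x + bose x ^+ 2 + bose x ^+ 3) * `|t| ^+ 3.
Proof.
move=> x0; have q0 := bose_gt0 x0; set q := bose x in q0 *.
have c0 := onem_cos_ge0 t; have /andP[_ c2] := onem_cos_bounds t.
rewrite /alpha -/q; set A := 1 + q * (1 - cos t); set y := q * sin t / A.
have A1 : 1 <= A by rewrite lerDl mulr_ge0 // ltW.
have A0 : 0 < A by lra.
have a0 := normr_ge0 t.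
have h1 : `|y| <= q * `|t|.
  rewrite /y !normrM (gtr0_norm q0) normfV (gtr0_norm A0) ler_pdivrMr //.
  rewrite -[q * `|t| * A]mulrA ler_pM2l // (le_trans (norm_sin_le t)) //.
  by rewrite ler_peMr.
have h2 : `|y - q * t| <= q * `|t| ^+ 3 / 6 + q ^+ 2 * `|t| ^+ 3 / 2.
  have -> : y - q * t = (q * (sin t - t) - q ^+ 2 * (t * (1 - cos t))) / A.
    have -> : y - q * t = (q * sin t - q * t * A) / A.
      by rewrite mulrBl mulfK // gt_eqF.
    by congr (_ / A); rewrite /A; ring.
  rewrite normrM normfV (gtr0_norm A0) ler_pdivrMr //.
  apply: (@le_trans _ _ (q * `|t| ^+ 3 / 6 + q ^+ 2 * `|t| ^+ 3 / 2)); last first.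
    by rewrite ler_peMr // addr_ge0 // divr_ge0 // mulr_ge0 ?exprn_ge0 // ltW.
  rewrite (le_trans (ler_normB _ _)) //; apply: lerD.
    by rewrite normrM (gtr0_norm q0) -mulrA ler_pM2l // sin_sub_le.
  rewrite normrM ger0_norm ?sqr_ge0 // -mulrA ler_pM2l ?exprn_gt0 //.
  rewrite normrM (ger0_norm c0) exprS -mulrA ler_wpM2l //.
  by rewrite real_normK ?num_real //; lra.
have -> : atan y - q * t = (atan y - y) + (y - q * t) by rewrite addrA subrK.
rewrite (le_trans (ler_normD _ _)) //.
have h3 : `|atan y - y| <= q ^+ 3 * `|t| ^+ 3.
  by rewrite (le_trans (atan_sub_le y)) // -exprMn lerXn2r ?nnegrE ?normr_ge0 // mulr_ge0 // ltW.
have h4 : 0 <= q * `|t| ^+ 3 by rewrite mulr_ge0 ?exprn_ge0 // ltW.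
have h5 : 0 <= q ^+ 2 * `|t| ^+ 3 by rewrite mulr_ge0 ?exprn_ge0 // ltW.
by rewrite !mulrDl; lra.
Qed.

End TaylorBounds.

(** * Gaussian limit of the characteristic function *)

Section PartSums.
Variable R : realType.
Implicit Types (s t u d x y : R) (N n k : nat).
Local Notation zeta2 := (pi ^+ 2 / 6 : R).

(** Both colours take every size up to [N + 1], except for one missing part 2. *)
Lemma sum_part_size N (g : nat -> R) : (0 < N)%N ->
  \sum_(i : part_index N) g (part_size i) = 2 * (\sum_(k < N.+1) g k.+1) - g 2%N.
Proof.
move=> N0; rewrite big_sumType /=.
have H : (1 < N.+1)%N by [].
rewrite [in RHS]mulr2n [in RHS](_ : 1 + 1 = 2) //.
have E : \sum_(k < N.+1) g k.+1 = g 2%N + \sum_(k < N) g (bump 1 k).+1.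
  by rewrite (bigD1_ord (Ordinal H)).
have -> : 2 * (\sum_(k < N.+1) g k.+1) = \sum_(k < N.+1) g k.+1 + \sum_(k < N.+1) g k.+1 by ring.
by rewrite {3}E; ring.
Qed.

Lemma sum_part_size_le N (g : nat -> R) : (0 < N)%N -> (forall k, 0 <= g k) ->
  \sum_(i : part_index N) g (part_size i) <= 2 * (\sum_(k < N.+1) g k.+1).
Proof. by move=> N0 g0; rewrite sum_part_size // gerBl. Qed.

(** Powers of [x] are absorbed by half of the exponential decay. *)
Lemma bose_half_le m x : 0 < x ->
  bose x <= m.+1`!%:R * (2 / x) ^+ m.+1 * bose (x / 2).
Proof.
move=> x0; have y0 : 0 < x / 2 by rewrite divr_gt0.
have e1 := expRB1_gt0 y0; have e2 := expRB1_gt0 x0.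
have h : (x / 2) ^+ m.+1 / m.+1`!%:R <= expR (x / 2).
  by have ? := expR_ge1Dxn m (ltW y0); lra.
have f0 : 0 < m.+1`!%:R :> R by rewrite ltr0n fact_gt0.
have p0 : 0 < (x / 2) ^+ m.+1 by rewrite exprn_gt0.
have -> : m.+1`!%:R * (2 / x) ^+ m.+1 = ((x / 2) ^+ m.+1 / m.+1`!%:R)^-1.
  by rewrite invf_div -exprVn invf_div.
rewrite /bose -invfM lef_pV2 ?posrE ?mulr_gt0 ?invr_gt0 //.
have -> : expR x = expR (x / 2) * expR (x / 2) by rewrite -expRD; congr expR; field.
rewrite (@le_trans _ _ (expR (x / 2) * (expR (x / 2) - 1))) ?ler_pM2r //.
by lra.
Qed.

Lemma part_mul_bose_half m s k : 0 < s -> (0 < k)%N ->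
  k%:R ^+ m.+2 * bose (k%:R * s) <=
  m.+1`!%:R * 2 ^+ m.+1 / s ^+ m.+1 * (k%:R * bose (k%:R * (s / 2))).
Proof.
move=> s0 k0; have K0 : 0 < k%:R :> R by rewrite ltr0n.
have h := bose_half_le m (mulr_gt0 K0 s0).
rewrite exprS -mulrA [leRHS]mulrCA ler_pM2l //.
apply: (le_trans (ler_wpM2l (exprn_ge0 m.+1 (ltW K0)) h)).
rewrite [k%:R * (s / 2)]mulrA mulrA ler_pM2r ?bose_gt0 ?divr_gt0 ?mulr_gt0 //.
rewrite exprMn exprVn exprMn.
have k1 : k%:R ^+ m.+1 != 0 :> R by rewrite expf_neq0 // gt_eqF.
have s1 : s ^+ m.+1 != 0 :> R by rewrite expf_neq0 // gt_eqF.
move: k1 s1; move: (k%:R ^+ m.+1) (s ^+ m.+1) (2 ^+ m.+1) (m.+1`!%:R) => a b c e a0 b0.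
by rewrite le_eqVlt; apply/orP; left; apply/eqP; field; rewrite a0 b0.
Qed.

(** The general term of [mean] at [s / 2]. It serves as a majorant for all error
    terms below, whose sums are then controlled by [mean_le]. *)
Let halfmean s k : R := k%:R * bose (k%:R * (s / 2)).

Lemma part_mul_bose_le s k : 0 < s -> (0 < k)%N -> k%:R * bose (k%:R * s) <= s^-1.
Proof.
move=> s0 k0; have K0 : 0 < k%:R :> R by rewrite ltr0n.
rewrite (le_trans (ler_wpM2l (ltW K0) (bose_le (mulr_gt0 K0 s0)))) //.
by rewrite invfM mulrA divff ?mul1r // gt_eqF.
Qed.

(** The third and fourth order error terms of one part. The sums over all parts
    are thus [O(s^-4)] and [O(s^-5)], to be multiplied by the third and
    fourth powers of a frequency of order [s^(3/2)]. *)
Lemma bose_powers_le s k : 0 < s -> (0 < k)%N ->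
  let q := bose (k%:R * s) in
  k%:R ^+ 3 * (q + q ^+ 2 + q ^+ 3) <= 11 / s ^+ 2 * halfmean s k /\
  k%:R ^+ 4 * (bosevar (k%:R * s) + bosevar (k%:R * s) ^+ 2) <= 69 / s ^+ 3 * halfmean s k.
Proof.
move=> s0 k0 q; have K0 : 0 < k%:R :> R by rewrite ltr0n.
have q0 : 0 < q by rewrite bose_gt0 // mulr_gt0.
have h0 : 0 < halfmean s k by rewrite mulr_gt0 // bose_gt0 // mulr_gt0 // divr_gt0.
have a1 : k%:R * q <= s^-1 by exact: part_mul_bose_le.
have a2 := part_mul_bose_half 0 s0 k0.
have a3 := part_mul_bose_half 1 s0 k0.
have a4 := part_mul_bose_half 2 s0 k0.
rewrite -/q -/(halfmean s k) in a2 a3 a4.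
have i0 : 0 < s^-1 by rewrite invr_gt0.
have -> : 11 / s ^+ 2 = 11 * s^-1 ^+ 2 by rewrite exprVn.
have -> : 69 / s ^+ 3 = 69 * s^-1 ^+ 3 by rewrite exprVn.
have {}a2 : k%:R ^+ 2 * q <= 2 * s^-1 * halfmean s k.
  by apply: le_trans a2 _; rewrite (_ : (0.+1)`! = 1)%N // !expr1; lra.
have {}a3 : k%:R ^+ 3 * q <= 8 * s^-1 ^+ 2 * halfmean s k.
  by apply: le_trans a3 _; rewrite (_ : (1.+1)`! = 2)%N // -exprVn; lra.
have {}a4 : k%:R ^+ 4 * q <= 48 * s^-1 ^+ 3 * halfmean s k.
  by apply: le_trans a4 _; rewrite (_ : (2.+1)`! = 6)%N // -exprVn; lra.
have a0 : k%:R * q <= halfmean s k.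
  rewrite /halfmean /q ler_pM2l // /bose lef_pV2 ?posrE ?expRB1_gt0 ?mulr_gt0 ?divr_gt0 //.
  by rewrite lerB // ler_expR ler_pM2l //; lra.
move: a0 a1 a2 a3 a4 h0 i0; rewrite /bosevar -/q.
move: (halfmean s k) (s^-1) => h v a0 a1 a2 a3 a4 h0 i0.
have b1 : 0 < k%:R * q by rewrite mulr_gt0.
have c2 : k%:R ^+ 3 * q ^+ 2 <= 2 * v ^+ 2 * h.
  have -> : k%:R ^+ 3 * q ^+ 2 = (k%:R * q) * (k%:R ^+ 2 * q) by ring.
  have -> : 2 * v ^+ 2 * h = v * (2 * v * h) by ring.
  by apply: ler_pM; rewrite ?(ltW b1) ?mulr_ge0 ?exprn_ge0 // ltW.
have c3 : k%:R ^+ 3 * q ^+ 3 <= v ^+ 2 * h.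
  have -> : k%:R ^+ 3 * q ^+ 3 = (k%:R * q) ^+ 2 * (k%:R * q) by ring.
  by apply: ler_pM; rewrite ?sqr_ge0 ?(ltW b1) ?lerXn2r ?nnegrE ?(ltW b1) ?(ltW i0).
split; first by rewrite !mulrDr; lra.
have d2 : k%:R ^+ 4 * q ^+ 2 <= 8 * v ^+ 3 * h.
  have -> : k%:R ^+ 4 * q ^+ 2 = (k%:R * q) * (k%:R ^+ 3 * q) by ring.
  have -> : 8 * v ^+ 3 * h = v * (8 * v ^+ 2 * h) by ring.
  by apply: ler_pM; rewrite ?(ltW b1) ?mulr_ge0 ?exprn_ge0 // ltW.
have d3 : k%:R ^+ 4 * q ^+ 3 <= 2 * v ^+ 3 * h.
  have -> : k%:R ^+ 4 * q ^+ 3 = (k%:R * q) ^+ 2 * (k%:R ^+ 2 * q) by ring.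
  have -> : 2 * v ^+ 3 * h = v ^+ 2 * (2 * v * h) by ring.
  apply: ler_pM; rewrite ?sqr_ge0 ?mulr_ge0 ?exprn_ge0 ?(ltW K0) ?(ltW q0) //.
  by rewrite lerXn2r ?nnegrE ?(ltW b1) ?(ltW i0).
have d4 : k%:R ^+ 4 * q ^+ 4 <= v ^+ 3 * h.
  have -> : k%:R ^+ 4 * q ^+ 4 = (k%:R * q) ^+ 3 * (k%:R * q) by ring.
  by apply: ler_pM; rewrite ?exprn_ge0 ?(ltW b1) ?lerXn2r ?nnegrE ?(ltW b1) ?(ltW i0).
have -> : k%:R ^+ 4 * (q * (1 + q) + (q * (1 + q)) ^+ 2) = k%:R ^+ 4 * q +
  2 * (k%:R ^+ 4 * q ^+ 2) + 2 * (k%:R ^+ 4 * q ^+ 3) + k%:R ^+ 4 * q ^+ 4 by ring.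
by lra.
Qed.

Lemma sum_halfmean_le s N : 0 < s -> \sum_(k < N) halfmean s k.+1 <= 48 / s ^+ 2.
Proof.
move=> s0; have s20 : 0 < s / 2 by rewrite divr_gt0.
apply: le_trans (mean_le N s20) _.
by rewrite le_eqVlt; apply/orP; left; apply/eqP; field; rewrite gt_eqF.
Qed.

Lemma modulusE N s t : 0 < s ->
  modulus (@part_size N) s t = expR (\sum_(i : part_index N) ln (rho ((part_size i)%:R * s) ((part_size i)%:R * t))).
Proof.
move=> s0; rewrite expR_sum; apply: eq_bigr => i _.
by rewrite lnK // posrE rho_gt0 // scaled_gt0 //; exact: part_size_gt0.
Qed.

Section Saddle.
Variables (N : nat) (d u nu : R).
Hypothesis N0 : (0 < N)%N.
Hypothesis d_itv : 0 < d <= 2^-1.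
Local Notation s := (d ^+ 2).
Local Notation t := (u * d ^+ 3).
Hypothesis tail_le : tail N.+1 (s / 2) <= s.

Let d0 : 0 < d. Proof. by case/andP: d_itv. Qed.
Let s0 : 0 < s. Proof. by rewrite exprn_gt0. Qed.
Let s4 : s <= 4^-1.
Proof.
have -> : 4^-1 = 2^-1 ^+ 2 :> R by field.
by case/andP: d_itv => _ h; rewrite lerXn2r ?nnegrE ?(ltW d0).
Qed.

(** With [s = d^2] and the frequency [t = u d^3], the first cumulants add up to
    the expected weight times [t]; it matches [nu * t] up to [O(d)], and the
    cubic errors are [t^3 O(s^-4) = O(d)]. *)
Lemma phase_approx : nu = 2 * zeta2 / s ^+ 2 ->
  `|phase (@part_size N) s t - nu * t| <= (19 * `|u| + 1056 * `|u| ^+ 3) * d.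
Proof.
move=> nuE.
set q := fun k : nat => bose (k%:R * s).
have S1 : `|phase (@part_size N) s t - \sum_(i : part_index N) q (part_size i) * ((part_size i)%:R * t)|
    <= 1056 * `|u| ^+ 3 * d.
  rewrite /phase -sumrB (le_trans (ler_norm_sum _ _ _)) //.
  apply: (@le_trans _ _ (\sum_(i : part_index N) `|t| ^+ 3 * (11 / s ^+ 2 * halfmean s (part_size i)))).
    apply: ler_sum => i _; have w0 := part_size_gt0 i.
    have K0 : 0 < (part_size i)%:R :> R by rewrite ltr0n.
    rewrite (le_trans (alpha_approx _ (mulr_gt0 K0 s0))) //.
    have [h _] := bose_powers_le s0 w0.
    rewrite normrM exprMn (gtr0_norm K0) mulrA [leLHS]mulrC ler_wpM2l ?exprn_ge0 //.
    by rewrite mulrC.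
  rewrite -!mulr_sumr.
  have h1 : \sum_(i : part_index N) halfmean s (part_size i) <= 96 / s ^+ 2.
    rewrite (le_trans (sum_part_size_le N0 _)) //.
      by move=> k; rewrite mulr_ge0 // /halfmean /bose invr_ge0 subr_ge0 -[leLHS]expR0 ler_expR mulr_ge0 // divr_ge0 // ltW.
    have h := sum_halfmean_le N.+1 s0.
    by move: h; move: (\sum_(k < _) _) (s ^+ 2) => A B h; lra.
  have -> : 1056 * `|u| ^+ 3 * d = `|t| ^+ 3 * (11 / s ^+ 2 * (96 / s ^+ 2)).
    rewrite normrM (gtr0_norm (exprn_gt0 3 d0)).
    by have e0 := d0; move: `|u| => v; field; rewrite gt_eqF.
  by rewrite ler_wpM2l ?exprn_ge0 // ler_wpM2l // divr_ge0 // ltW // exprn_gt0.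
(* 18/s is the error of the mean, 1/s the contribution of the missing part 2 *)
have S2 : `|\sum_(i : part_index N) q (part_size i) * ((part_size i)%:R * t) - nu * t|
    <= 19 * `|u| * d.
  have -> : \sum_(i : part_index N) q (part_size i) * ((part_size i)%:R * t) =
     (2 * mean N.+1 s - 2 * q 2%N) * t.
    rewrite (@sum_part_size N (fun k => q k * (k%:R * t))) // mulrBl; congr (_ - _); last by rewrite mulrCA mulrA.
    by rewrite -mulrA; congr (2 * _); rewrite /mean mulr_suml; apply: eq_bigr => k _; rewrite mulrCA mulrA.
  rewrite -mulrBl normrM.
  have e : `|2 * mean N.+1 s - 2 * q 2%N - nu| <= 19 / s.
    have ms : s / 2 <= s <= 2^-1 by apply/andP; split; move: s0 s4; move: (d ^+ 2) => a *; lra.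
    have := mean_asymp_near s0 ms tail_le.
    rewrite -(ler_pM2l (_ : 0 < 2 / s ^+ 2)); last by rewrite divr_gt0 // exprn_gt0.
    rewrite -[X in X * `|_|](ger0_norm (_ : 0 <= 2 / s ^+ 2)); last by rewrite divr_ge0 // ltW // exprn_gt0.
    rewrite -normrM mulrBr.
    have -> : 2 / s ^+ 2 * (s ^+ 2 * mean N.+1 s) = 2 * mean N.+1 s.
      by rewrite mulrA divfK // gt_eqF // exprn_gt0.
    have -> : 2 / s ^+ 2 * zeta2 = nu by rewrite nuE mulrAC.
    have -> : 2 / s ^+ 2 * (9 * s) = 18 / s by move: s0; move: (d ^+ 2) => a a0; field; rewrite gt_eqF.
    have -> : 2 * mean N.+1 s - 2 * q 2%N - nu = (2 * mean N.+1 s - nu) - 2 * q 2%N by rewrite addrAC.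
    have q2 : `|2 * q 2%N| <= s^-1.
      have s20 : 0 < 2 * s by rewrite mulr_gt0.
      rewrite ger0_norm; last by rewrite mulr_ge0 // ltW // bose_gt0.
      rewrite mulrC -ler_pdivlMr // -invfM mulrC; exact: bose_le.
    move=> h; rewrite (le_trans (ler_normB _ _)) // (le_trans (lerD h q2)) //.
    have -> : 18 / s + s^-1 = 19 / s by ring.
    by [].
  apply: (le_trans (ler_wpM2r (normr_ge0 _) e)).
  rewrite normrM (gtr0_norm (exprn_gt0 3 d0)) le_eqVlt; apply/orP; left; apply/eqP.
  by have e0 := d0; move: `|u| => v; field; rewrite gt_eqF.
set P := phase _ _ _ in S1 *; set Q := \sum_(i : part_index N) _ in S1 S2.
have -> : P - nu * t = (P - Q) + (Q - nu * t) by rewrite addrA subrK.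
by rewrite (le_trans (ler_normD _ _)) // addrC mulrDl; exact: lerD.
Qed.

(** The second cumulants add up to the variance times [t^2], which tends to [4
    zeta2 u^2] by [variance_asymp], the factor 2 being due to the two
    colours. *)
Lemma log_modulus_approx :
  `|2 * (\sum_(i : part_index N) ln (rho ((part_size i)%:R * s) ((part_size i)%:R * t)))
    + 4 * zeta2 * u ^+ 2| <= (202 * u ^+ 2 + 6624 * u ^+ 4) * d.
Proof.
set v := fun k : nat => bosevar (k%:R * s).
set L := \sum_(i : part_index N) _.
set Q := \sum_(i : part_index N) v (part_size i) * ((part_size i)%:R * t) ^+ 2.
have S1 : 0 <= Q + 2 * L <= 6624 * u ^+ 4 * d ^+ 2.
  rewrite /Q /L mulr_sumr -big_split /=; apply/andP; split.
    apply: sumr_ge0 => i _; have w0 := part_size_gt0 i.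
    have K0 : 0 < (part_size i)%:R * s :> R by rewrite mulr_gt0 // ltr0n.
    by have /andP[] := rho_approx ((part_size i)%:R * t) K0.
  apply: (@le_trans _ _ (\sum_(i : part_index N) t ^+ 4 * (69 / s ^+ 3 * halfmean s (part_size i)))).
    apply: ler_sum => i _; have w0 := part_size_gt0 i.
    have K0 : 0 < (part_size i)%:R * s :> R by rewrite mulr_gt0 // ltr0n.
    have /andP[_ h] := rho_approx ((part_size i)%:R * t) K0.
    apply: (le_trans h); have [_ h'] := bose_powers_le s0 w0.
    have -> (V k : R) : (V + V ^+ 2) * (k * t) ^+ 4 = t ^+ 4 * (k ^+ 4 * (V + V ^+ 2)) by ring.
    by rewrite ler_wpM2l // -[4%N]/(2 * 2)%N exprM sqr_ge0.
  rewrite -!mulr_sumr.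
  have h1 : \sum_(i : part_index N) halfmean s (part_size i) <= 96 / s ^+ 2.
    rewrite (le_trans (sum_part_size_le N0 _)) //.
      by move=> k; rewrite mulr_ge0 // /halfmean /bose invr_ge0 subr_ge0 -[leLHS]expR0 ler_expR mulr_ge0 // divr_ge0 // ltW.
    have h := sum_halfmean_le N.+1 s0.
    by move: h; move: (\sum_(k < _) _) (s ^+ 2) => A B h; lra.
  have -> : 6624 * u ^+ 4 * d ^+ 2 = t ^+ 4 * (69 / s ^+ 3 * (96 / s ^+ 2)).
    by have e0 := d0; field; rewrite gt_eqF.
  rewrite ler_wpM2l ?ler_wpM2l // ?divr_ge0 // ?(ltW (exprn_gt0 _ s0)) //.
  by rewrite -[4%N]/(2 * 2)%N exprM sqr_ge0.
have S2 : `|Q - 4 * zeta2 * u ^+ 2| <= 202 * u ^+ 2 * d - u ^+ 2 * d / 2.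
  have -> : Q = u ^+ 2 * (2 * (s ^+ 3 * variance N.+1 s) - 4 * (s ^+ 3 * v 2%N)).
    rewrite /Q (@sum_part_size N (fun k => v k * (k%:R * t) ^+ 2)) // mulrBr; congr (_ - _); last by ring.
    rewrite /variance !mulr_sumr; apply: eq_bigr => k _; rewrite /v; ring.
  have -> : u ^+ 2 * (2 * (s ^+ 3 * variance N.+1 s) - 4 * (s ^+ 3 * v 2%N)) - 4 * zeta2 * u ^+ 2 =
    u ^+ 2 * (2 * (s ^+ 3 * variance N.+1 s - 2 * zeta2) - 4 * (s ^+ 3 * v 2%N)).
    by move: zeta2 => z; ring.
  have -> : 202 * u ^+ 2 * d - u ^+ 2 * d / 2 = u ^+ 2 * (202 * d - d / 2) by ring.
  rewrite normrM (ger0_norm (sqr_ge0 u)) ler_wpM2l ?sqr_ge0 //.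
  have h1 := variance_asymp d_itv tail_le.
  have s20 : 0 < 2 * s by rewrite mulr_gt0.
  have v0 : 0 <= s ^+ 3 * v 2%N by rewrite mulr_ge0 ?exprn_ge0 ?(ltW s0) // ltW // bosevar_gt0.
  have v1 : 4 * (s ^+ 3 * v 2%N) <= d.
    have : v 2%N <= (2 * s)^-1 * (1 + (2 * s)^-1).
      rewrite /v /bosevar; have b0 := bose_gt0 s20; have b1 := bose_le s20.
      by apply: ler_pM; rewrite ?(ltW b0) ?addr_ge0 ?(ltW b0) ?lerD2l.
    rewrite -(ler_pM2l (exprn_gt0 3 s0)) => h.
    have E : s ^+ 3 * ((2 * s)^-1 * (1 + (2 * s)^-1)) = s ^+ 2 / 2 + s / 4.
      by move: s0; move: (d ^+ 2) => a a0; field; rewrite gt_eqF.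
    rewrite E in h.
    have ss : s ^+ 2 <= s / 4 by rewrite expr2 ler_pM2l.
    have sd : s <= d / 2 by rewrite expr2 ler_pM2l //; case/andP: d_itv.
    by lra.
  by move: h1; rewrite !ler_norml => /andP[? ?]; apply/andP; split; lra.
have -> : 2 * L + 4 * zeta2 * u ^+ 2 = (Q + 2 * L) - (Q - 4 * zeta2 * u ^+ 2) by move: zeta2 => z; ring.
rewrite (le_trans (ler_normB _ _)) // [in leLHS]ger0_norm; last by case/andP: S1.
have dd : d ^+ 2 <= d by rewrite expr2 ler_piMl ?(ltW d0) //; case/andP: d_itv => _ ?; lra.
have u4 : 0 <= u ^+ 4 by rewrite -[4%N]/(2 * 2)%N exprM sqr_ge0.
have h := ler_wpM2l u4 dd.
case/andP: S1 => _ S1; rewrite (le_trans (lerD S1 S2)) //.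
have : 0 <= u ^+ 2 * d by rewrite mulr_ge0 ?sqr_ge0 // ltW.
by move=> ?; lra.
Qed.

End Saddle.

End PartSums.

(** * Domination of the characteristic function *)

Section Domination.
Variable R : realType.
Implicit Types (s t u d x y : R) (N n k K : nat).

(** For [x <= 1/2] the variance [bosevar x] is at least 2, so the decay is
    uniform. *)
Lemma ln_rho_le x t : 0 < x <= 2^-1 -> ln (rho x t) <= - (2 / 9 * (1 - cos t)).
Proof.
move=> /andP[x0 x2].
have q1 : 1 <= bose x.
  apply: le_trans (bose_ge x0); rewrite lerBrDr -[1 + 1]/(2%:R) -[2%:R]invrK.
  by rewrite lef_pV2 ?posrE ?invr_gt0.
have y0 := onem_cos_ge0 t; have y2 : 1 - cos t <= 2 by have ? := cos_geN1 t; lra.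
set y := 1 - cos t in y0 y2 *.
have v2 : 2 <= bosevar x by rewrite /bosevar; nra.
have z4 : 4 * y <= 2 * bosevar x * y by rewrite ler_wpM2r //; lra.
rewrite /rho -/y; set z := 2 * bosevar x * y in z4 *.
have z1 : 0 < 1 + z by lra.
have E : 2 * ln ((Num.sqrt (1 + z))^-1) = ln ((1 + z)^-1).
  rewrite !lnV ?posrE ?sqrtr_gt0 // mulrN mulr_natl -lnXn ?sqrtr_gt0 //.
  by rewrite sqr_sqrtr // ltW.
have h1 : ln ((1 + z)^-1) <= (1 + z)^-1 - 1 by rewrite ln_le_sub1 // invr_gt0.
have h2 : (1 + z)^-1 <= (1 + 4 * y)^-1 by rewrite lef_pV2 ?posrE //; lra.
(* this is where y <= 2 is used *)
have h3 : (1 + 4 * y)^-1 <= 1 - 4 / 9 * y.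
  rewrite -[leLHS]mul1r ler_pdivrMr; last by lra.
  by nra.
by lra.
Qed.

Lemma ln_rho_le0 x t : 0 < x -> ln (rho x t) <= 0.
Proof.
move=> x0; apply: ln_le0; rewrite /rho invf_le1 ?sqrtr_gt0 ?(lt_le_trans ltr01) ?rho_radicand //.
by rewrite -[leLHS]sqrtr1 ler_wsqrtr // rho_radicand.
Qed.

Definition onem_cos_sum K t : R := \sum_(k < K) (1 - cos (k.+1%:R * t)).

(** All factors are at most 1; only the parts up to [K] of the first colour are
    kept. *)
Lemma modulus_le K N s t : 0 < s -> K%:R * s <= 2^-1 -> (K <= N.+1)%N ->
  modulus (@part_size N) s t <= expR (- (2 / 9 * onem_cos_sum K t)).
Proof.
move=> s0 Ks KN; rewrite modulusE // ler_expR big_sumType /=.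
have h1 : \sum_(k < N) ln (rho ((bump 1 k).+1%:R * s) ((bump 1 k).+1%:R * t)) <= 0.
  by apply: sumr_le0 => k _; rewrite ln_rho_le0 // mulr_gt0 // ltr0n.
apply: (@le_trans _ _ (\sum_(k < N.+1) ln (rho (k.+1%:R * s) (k.+1%:R * t)))); first by rewrite gerDl.
rewrite /onem_cos_sum mulr_sumr -sumrN.
rewrite (big_ord_widen N.+1 (fun k : nat => - (2 / 9 * (1 - cos (k.+1%:R * t)))) KN).
rewrite [leRHS]big_mkcond /=; apply: ler_sum => k _.
have k0 : 0 < k.+1%:R * s by rewrite mulr_gt0 // ltr0n.
case: ifP => kK; last by rewrite ln_rho_le0.
apply: ln_rho_le; rewrite k0 /= (le_trans _ Ks) // ler_pM2r // ler_nat //.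
Qed.

Lemma dirichlet_kernel K t :
  2 * sin (t / 2) * (\sum_(k < K) cos (k.+1%:R * t)) = sin (K%:R * t + t / 2) - sin (t / 2).
Proof.
elim: K => [|K IH]; first by rewrite big_ord0 mulr0 mul0r add0r subrr.
rewrite big_ord_recr /= mulrDr IH.
have -> : K%:R * t + t / 2 = K.+1%:R * t - t / 2 by rewrite -natr1; field.
rewrite sinB sinD; ring.
Qed.

(** Comparison with the integral of [x^2]. *)
Lemma sum_squares_ge K : K%:R ^+ 3 / 3 <= \sum_(k < K) k.+1%:R ^+ 2 :> R.
Proof.
elim: K => [|K IH]; first by rewrite big_ord0 expr0n /= mul0r.
rewrite big_ord_recr /= -natr1.
have k0 : 0 <= K%:R :> R by [].
move: IH k0; move: (\sum_(_ < _) _) (K%:R : R) => S k IH k0.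
have -> : (k + 1) ^+ 3 / 3 = k ^+ 3 / 3 + k ^+ 2 + k + 3^-1 by field.
by have -> : (k + 1) ^+ 2 = k ^+ 2 + 2 * k + 1 by [ring]; lra.
Qed.

Lemma onem_cos_ge t : 0 <= t <= pi -> 2 * (t / pi) ^+ 2 <= 1 - cos t.
Proof.
move=> /andP[t0 tp]; have P := pi_gt0 R.
have E : 1 - cos t = 2 * sin (t / 2) ^+ 2.
  have {1}-> : t = (t / 2) *+ 2 by rewrite -mulr_natr divfK.
  by rewrite cos_mulr2n cos2sin2 -mulr_natl; ring.
rewrite E ler_pM2l // lerXn2r ?nnegrE ?divr_ge0 ?(ltW P) //.
  by apply: sin_ge0_pi; apply/andP; split; lra.
have h : 0 <= t / 2 <= pi / 2 by apply/andP; split; lra.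
have := jordan_sin h; rewrite [2 * (t / 2)]mulrC divfK //.
Qed.

Lemma onem_cos_sum_norm K t : onem_cos_sum K t = onem_cos_sum K `|t|.
Proof.
apply: eq_bigr => k _; congr (1 - _).
by rewrite -[in LHS]cos_norm normrM ger0_norm.
Qed.

(** The largest [K] with [K s <= 1/2], so that [ln_rho_le] applies to all parts
    up to [K]. *)
Definition cutoff s : nat := Num.truncn ((2 * s)^-1).

Lemma cutoff_bounds s : 0 < s <= 4^-1 ->
  (cutoff s)%:R * s <= 2^-1 /\ (4 * s)^-1 <= (cutoff s)%:R /\ (2 * s)^-1 - 1 <= (cutoff s)%:R.
Proof.
move=> /andP[s0 s4].
have i0 : 0 <= (2 * s)^-1 by rewrite invr_ge0 mulr_ge0 // ltW.
have /andP[h1 h2] := truncn_itv i0.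
rewrite -/(cutoff s) in h1 h2.
have h3 : (2 * s)^-1 - 1 <= (cutoff s)%:R by rewrite lerBlDr natr1 ltW.
split; first by rewrite -ler_pdivlMr // -invfM.
split=> //; apply: le_trans h3.
have -> : (2 * s)^-1 = (4 * s)^-1 + (4 * s)^-1 by field; rewrite gt_eqF.
suff : 1 <= (4 * s)^-1 by move=> ?; lra.
by rewrite invf_ge1 ?mulr_gt0 //; lra.
Qed.

(** Here [k |t|] stays between 0 and [pi], where [1 - cos] is bounded below by a
    square. *)
Lemma onem_cos_sum_near s t : 0 < s <= 4^-1 -> `|t| <= 2 * pi * s ->
  t ^+ 2 / s ^+ 3 / (96 * pi ^+ 2) <= onem_cos_sum (cutoff s) t.
Proof.
move=> hs ht; have [k1 [k2 _]] := cutoff_bounds hs; case/andP: hs => s0 s4.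
have P := pi_gt0 R.
rewrite onem_cos_sum_norm -[t ^+ 2]real_normK ?num_real //.
move: (normr_ge0 t) ht; move: `|t| => T T0 ht.
apply: (@le_trans _ _ (\sum_(k < cutoff s) 2 * (T / pi) ^+ 2 * k.+1%:R ^+ 2)); last first.
  apply: ler_sum => k _; have -> : 2 * (T / pi) ^+ 2 * k.+1%:R ^+ 2 = 2 * (k.+1%:R * T / pi) ^+ 2 by ring.
  apply: onem_cos_ge; rewrite mulr_ge0 //=.
  apply: (@le_trans _ _ ((cutoff s)%:R * (2 * pi * s))).
    by apply: ler_pM => //; rewrite ler_nat.
  have -> : (cutoff s)%:R * (2 * pi * s) = (cutoff s)%:R * s * (2 * pi) by ring.
  rewrite -[leRHS](mulKf (x := 2)) //.
  by rewrite ler_pM2r // mulr_gt0.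
rewrite -mulr_sumr.
apply: (@le_trans _ _ (2 * (T / pi) ^+ 2 * ((4 * s)^-1 ^+ 3 / 3))); last first.
  rewrite ler_wpM2l //; first by apply: mulr_ge0 => //; exact: sqr_ge0.
  apply: le_trans (sum_squares_ge _).
  by rewrite ler_pM2r // lerXn2r ?nnegrE // invr_ge0 mulr_ge0 // ltW.
rewrite le_eqVlt; apply/orP; left; apply/eqP.
by move: P; move: (pi : R) => p P; field; rewrite !gt_eqF.
Qed.

(** Here the Dirichlet kernel shows that the cosines cancel, up to half of the
    number of terms. *)
Lemma onem_cos_sum_far s t : 0 < s <= 4^-1 -> 2 * pi * s <= `|t| <= pi ->
  (8 * s)^-1 <= onem_cos_sum (cutoff s) t.
Proof.
move=> hs; have [_ [k2 k3]] := cutoff_bounds hs; case/andP: hs => s0 s4.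
have P := pi_gt0 R.
rewrite onem_cos_sum_norm; move: `|t| => T /andP[T1 T2].
have T0 : 0 < T by apply: lt_le_trans T1; rewrite !mulr_gt0.
rewrite /onem_cos_sum sumrB sumr_const card_ord.
have h : 0 <= T / 2 <= pi / 2 by apply/andP; split; lra.
have := jordan_sin h; rewrite [2 * (T / 2)]mulrC divfK // => J.
have J0 : 0 < sin (T / 2) by apply: lt_le_trans J; rewrite divr_gt0.
have := dirichlet_kernel (cutoff s) T; set C := \sum_(_ < _) _ => D.
have C1 : C <= (2 * sin (T / 2))^-1 - 2^-1.
  have -> : (2 * sin (T / 2))^-1 - 2^-1 = (1 - sin (T / 2)) / (2 * sin (T / 2)).
    by move: J0; move: (sin _) => z J0; field; rewrite gt_eqF.
  rewrite ler_pdivlMr ?mulr_gt0 // mulrC D lerD2r; exact: sin_le1.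
have J1 : (2 * sin (T / 2))^-1 <= (4 * s)^-1.
  rewrite lef_pV2 ?posrE ?mulr_gt0 //.
  have : 2 * s <= T / pi by rewrite ler_pdivlMr // mulrAC.
  by move=> ?; lra.
have E1 : (2 * s)^-1 = (8 * s)^-1 * 4 by field; rewrite gt_eqF.
have E2 : (4 * s)^-1 = (8 * s)^-1 * 2 by field; rewrite gt_eqF.
have E3 : 2^-1 <= (8 * s)^-1 by rewrite lef_pV2 ?posrE ?mulr_gt0 //; lra.
rewrite E1 in k3; rewrite E2 in J1.
by lra.
Qed.

(** The factor [6 * 36 ^+ 3] comes from bounding [e^y] below by [y ^+ 3 / 6] at
    [y = 1 / (36 s)], and 16 bounds [pi ^+ 2]. *)
Definition dom_const : R := 6 * 36 ^+ 3 * 16.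

Lemma dom_const_facts : [/\ 1 <= dom_const, 432 * 16 <= dom_const &
  dom_const = 6 * 36 ^+ 3 * 16].
Proof. by split=> //; rewrite /dom_const; lra. Qed.

(** The bound must be integrable in [u] over the whole range of frequencies,
    which grows with [1/d]. For small frequencies the exponent is of order
    [u^2]; for the others it is of order [1/s], while [u^2] is at most of
    order [s^-3]. *)
Lemma modulus_dominated N d u : 0 < d <= 2^-1 -> (cutoff (d ^+ 2) <= N.+1)%N ->
  `|u * d ^+ 3| <= pi ->
  modulus (@part_size N) (d ^+ 2) (u * d ^+ 3) <= dom_const / (1 + u ^+ 2).
Proof.
move=> /andP[d0 d2] KN ht; have P := pi_gt0 R.
have P2 : pi ^+ 2 <= 16 :> R.
  have -> : 16 = 4 ^+ 2 :> R by ring.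
  by rewrite lerXn2r ?nnegrE ?(ltW P) // ltW // pi_lt4.
have [C1 C2 C3] := dom_const_facts; move: (dom_const) C1 C2 C3 => C C1 C2 C3.
have C0 : 0 < C by rewrite (lt_le_trans ltr01).
set s := d ^+ 2; set t := u * d ^+ 3.
have s0 : 0 < s by rewrite exprn_gt0.
have hs : 0 < s <= 4^-1.
  rewrite s0 /=; have -> : 4^-1 = 2^-1 ^+ 2 :> R by field.
  by rewrite lerXn2r ?nnegrE ?(ltW d0).
have [k1 _] := cutoff_bounds hs.
have tu : t ^+ 2 / s ^+ 3 = u ^+ 2 by rewrite /t /s; field; rewrite gt_eqF.
have u0 : 0 <= u ^+ 2 by exact: sqr_ge0.
apply: (le_trans (modulus_le t s0 k1 KN)).
rewrite expRN -[leLHS]mul1r ler_pdivrMr ?expR_gt0 // mulrAC ler_pdivlMr ?ltr_pwDl // mul1r.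
have [near|far] := lerP `|t| (2 * pi * s).
  have h := onem_cos_sum_near hs near; rewrite tu in h.
  have a0 : 0 < 432 * pi ^+ 2 :> R by apply: mulr_gt0; [rewrite ltr0n|exact: exprn_gt0].
  have aC : 432 * pi ^+ 2 <= C by apply: le_trans C2; apply: ler_wpM2l; [rewrite ler0n|exact: P2].
  apply: (@le_trans _ _ (C * (1 + u ^+ 2 / (432 * pi ^+ 2)))).
    rewrite mulrDr mulr1; apply: lerD; first exact: C1.
    by rewrite mulrCA ler_peMr // ler_pdivlMr // mul1r.
  rewrite ler_pM2l //.
  apply: le_trans (expR_ge1Dx _); rewrite lerD2l.
  apply: (@le_trans _ _ (2 / 9 * (u ^+ 2 / (96 * pi ^+ 2)))).
    rewrite le_eqVlt; apply/orP; left; apply/eqP.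
    by move: P; move: (pi : R) => p P; field; rewrite gt_eqF.
  by rewrite ler_pM2l //; lra.
have h := @onem_cos_sum_far s t hs; rewrite (ltW far) ht in h; have {}h := h isT.
have u1 : u ^+ 2 <= 16 / s ^+ 3.
  rewrite -tu ler_pM2r ?invr_gt0 ?exprn_gt0 // (le_trans _ P2) //.
  by rewrite -[t ^+ 2]real_normK ?num_real // lerXn2r ?nnegrE // ltW.
apply: (@le_trans _ _ (C * (1 + (36 * s)^-1 ^+ 3 / 6))).
  have -> : C * (1 + (36 * s)^-1 ^+ 3 / 6) = C + 16 / s ^+ 3.
    by rewrite mulrDr mulr1; congr (_ + _); rewrite C3; field; rewrite gt_eqF.
  exact: lerD.
rewrite ler_pM2l //.
apply: (@le_trans _ _ (expR ((36 * s)^-1))).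
  have i0 : 0 <= (36 * s)^-1 by rewrite invr_ge0 mulr_ge0 // ltW.
  by have := expR_ge1Dxn 2 i0.
rewrite ler_expR.
have -> : (36 * s)^-1 = 2 / 9 * (8 * s)^-1 by field; rewrite gt_eqF.
by rewrite ler_pM2l //; lra.
Qed.

End Domination.

(** * Fourier inversion and the Gaussian integral *)

Section Integrals.
Variable R : realType.
Implicit Types (x y u c s : R).
Local Notation mu := (@lebesgue_measure R).

Lemma integrable_inv_oneDsqr (C : R) :
  mu.-integrable [set: R] (EFin \o (fun x => C / (1 + x ^+ 2))).
Proof.
have mf : measurable_fun [set: R] (fun x : R => (oneDsqr x)^-1).
  apply: continuous_measurable_fun; exact: continuous_oneDsqrV.
have I : mu.-integrable [set: R] (EFin \o (fun x : R => (oneDsqr x)^-1)).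
  apply/integrableP; split; first exact/measurable_EFinP.
  under eq_integral do rewrite /= ger0_norm ?invr_ge0 ?(le_trans ler01) ?oneDsqr_ge1 //.
  rewrite ge0_symfun_integralT.
  - rewrite (_ : [set x | _] = `[0, +oo[%classic); last first.
      by apply/seteqP; split => x/=; rewrite in_itv/= andbT.
    by rewrite integral0y_oneDsqr -EFinM ltry.
  - by move=> x; rewrite invr_ge0 (le_trans ler01) ?oneDsqr_ge1.
  - exact: continuous_oneDsqrV.
  - by move=> x /=; rewrite /oneDsqr sqrrN.
apply: eq_integrable (integrableZl measurableT C I) => //.
Qed.

(** The density of the normal law with variance [3 / (2 pi^2)] integrates to 1. *)
Lemma integral_gaussian : (\int[mu]_x (expR (- (pi ^+ 2 / 3 * x ^+ 2)))%:E)%E =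
  (Num.sqrt (3 / pi))%:E.
Proof.
have P := pi_gt0 R.
pose sigma : R := Num.sqrt (3 / (2 * pi ^+ 2)).
have s0 : sigma != 0 by rewrite gt_eqF // sqrtr_gt0 divr_gt0 // mulr_gt0 // exprn_gt0.
have s2 : sigma ^+ 2 = 3 / (2 * pi ^+ 2).
  by rewrite sqr_sqrtr // divr_ge0 // mulr_ge0 // sqr_ge0.
have E x : expR (- (pi ^+ 2 / 3 * x ^+ 2)) = Num.sqrt (3 / pi) * normal_pdf 0 sigma x.
  rewrite normal_pdfE // /normal_peak /normal_fun s2 subr0.
  have -> : 3 / (2 * pi ^+ 2) * pi *+ 2 = 3 / pi :> R.
    by rewrite -mulr_natr; move: P; move: (pi : R) => p P; field; rewrite gt_eqF.
  rewrite [RHS]mulrA divff ?mul1r ?gt_eqF ?sqrtr_gt0 ?divr_gt0 //; congr expR.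
  rewrite mulNr; congr (- _); rewrite -mulr_natr.
  by move: P; move: (pi : R) => p P; field; rewrite gt_eqF.
under eq_integral do rewrite E EFinM.
rewrite integralZl //=; last exact: integrable_normal_pdf.
by rewrite integral_normal_pdf mule1.
Qed.

Lemma has_der_sum (T : Type) (r : seq T) (F : T -> R -> R) (D : T -> R) x :
  (forall i, has_der (F i) x (D i)) ->
  has_der (fun y => \sum_(i <- r) F i y) x (\sum_(i <- r) D i).
Proof.
move=> H; elim: r => [|i r IH].
  rewrite big_nil (_ : (fun _ => _) = fun=> 0); first exact: der_cst.
  by apply/funext => y; rewrite big_nil.
rewrite big_cons (_ : (fun _ => _) = fun y => F i y + \sum_(j <- r) F j y).
  exact: der_add.
by apply/funext => y; rewrite big_cons.
Qed.

Lemma sin_natmul_pi n : sin (n%:R * pi) = 0 :> R.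
Proof.
elim: n => [|n IH]; first by rewrite mul0r sin0.
by rewrite -natr1 mulrDl mul1r sinDpi IH oppr0.
Qed.

Lemma sin_intdiff_pi m n : sin ((m%:R - n%:R) * pi) = 0 :> R.
Proof. by rewrite mulrBl sinB !sin_natmul_pi mul0r mulr0 subrr. Qed.

Variables (I : finType) (w : I -> nat).

Lemma continuous_trig_sum J n s c : continuous (fun u => trig_sum w J n s (u * c)).
Proof.
apply: continuous_of_has_der => x; rewrite /trig_sum; apply: has_der_sum => f; der.
Qed.

(** Orthogonality of the exponentials: over one period, only the configurations
    of weight [n] contribute. *)
Lemma fourier_inversion J n s c : 0 < c ->
  \int[mu]_(u in `[- (pi / c), pi / c]) trig_sum w J n s (u * c) =
  2 * pi / c * expR (- (n%:R * s)) *
  #|[pred f : {ffun I -> 'I_J.+1} | weight w f == n]|%:R.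
Proof.
move=> c0; have P := pi_gt0 R.
(* a primitive of each term of the sum, constant frequency 0 apart *)
pose A (f : {ffun I -> 'I_J.+1}) u : R := expR (- ((weight w f)%:R * s)) *
  (if weight w f == n then u else sin (((weight w f)%:R - n%:R) * (u * c)) / (((weight w f)%:R - n%:R) * c)).
apply: (@integral_FTC R (fun u => \sum_(f : {ffun I -> 'I_J.+1}) A f u)).
- by rewrite -subr_gt0 opprK -mulr2n mulrn_wgt0 // divr_gt0.
- move=> u; apply: has_der_sum => f; rewrite /A; case: eqP => [->|/eqP ne].
    by apply: has_der_eq; [der|rewrite subrr mul0r cos0 mulr0 addr0].
  have k0 : (weight w f)%:R - n%:R != 0 :> R by rewrite subr_eq0 eqr_nat.
  apply: has_der_eq; first by der.
  move: k0; move: (_ - _) => k k0.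
  by field; rewrite k0 gt_eqF.
- exact: continuous_trig_sum.
rewrite -sumrB (bigID (fun f => weight w f == n)) /= [X in _ + X]big1 ?addr0; last first.
  move=> f /negbTE ne; rewrite /A ne !divfK ?gt_eqF // mulNr divfK ?gt_eqF // mulrN sinN sin_intdiff_pi.
  by rewrite oppr0 mul0r mulr0 subrr.
rewrite (eq_bigr (fun=> 2 * pi / c * expR (- (n%:R * s)))); last first.
  move=> f /eqP E; rewrite /A E eqxx; move: c0; move: (expR _) (pi : R) => e p c0.
  by field; rewrite gt_eqF.
by rewrite sumr_const mulr_natr.
Qed.

End Integrals.

(** * The saddle point *)

Section SaddlePoint.
Variable R : realType.
Implicit Types (x y u d s : R) (n : nat).
Local Notation zeta2 := (pi ^+ 2 / 6 : R).

(** The parameter [s] is the saddle point and [d] its square root; here the side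
    conditions of the estimates above, and the smallness of what truncation
    discards, are checked for explicit small [s]. All of this holds because
    [n s] is of order [1/s], so that [e^(-n s)] is smaller than any power of
    [s]. *)
Section SmallParameter.
Variables (d : R) (n : nat).
Hypothesis d0 : 0 < d.
Local Notation s := (d ^+ 2).
Hypothesis s200 : s <= 200^-1.
Hypothesis nE : n%:R = 2 * zeta2 / s ^+ 2.

Let s0 : 0 < s. Proof. by rewrite exprn_gt0. Qed.

Lemma small_itv : 0 < d <= 2^-1.
Proof.
rewrite d0 /=; rewrite -(@ler_pXn2r _ 2) ?nnegrE ?(ltW d0) //.
by apply: le_trans s200 _; rewrite exprVn lef_pV2 ?posrE ?exprn_gt0 // expr2; lra.
Qed.

Lemma n_itv : s^-1 / s <= n%:R <= 6 / s ^+ 2.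
Proof.
have P := pi_ge2 R; have Z : 4 <= pi ^+ 2 :> R by rewrite expr2; nra.
have /andP[z0 z3] := zeta2_itv R.
have -> : s^-1 / s = 1 / s ^+ 2 by field; rewrite gt_eqF.
rewrite nE !ler_pM2r ?invr_gt0 ?exprn_gt0 //.
by apply/andP; split; move: (pi ^+ 2) Z z3 => p *; lra.
Qed.

Lemma inv_ge200 : 200 <= s^-1.
Proof. by rewrite -[leLHS]invrK lef_pV2 ?posrE ?invr_gt0. Qed.

Lemma expRN_inv_le m x : 0 < x -> expR (- x) <= m.+1`!%:R / x ^+ m.+1.
Proof.
move=> x0; have f0 : 0 < m.+1`!%:R :> R by rewrite ltr0n fact_gt0.
have p0 : 0 < x ^+ m.+1 by rewrite exprn_gt0.
have -> : m.+1`!%:R / x ^+ m.+1 = (x ^+ m.+1 / m.+1`!%:R)^-1 by rewrite invf_div.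
rewrite expRN lef_pV2 ?posrE ?expR_gt0 ?divr_gt0 //.
by have ? := expR_ge1Dxn m (ltW x0); lra.
Qed.

Lemma tail_small : tail n.+2 (s / 2) <= s.
Proof.
have /andP[n1 n2] := n_itv; have v200 := inv_ge200.
have i0 : 0 < s^-1 by rewrite invr_gt0.
have h : s^-1 / 2 <= n.+2%:R * (s / 2).
  rewrite mulrA ler_pM2r ?invr_gt0 // -ler_pdivrMr // (le_trans n1) // ler_nat -addn2 leq_addr //.
(* e^-y <= 5! / y^5 at y = 1/(2s) *)
have e : expR (- (n.+2%:R * (s / 2))) <= 3840 * s ^+ 5.
  apply: (@le_trans _ _ (expR (- (s^-1 / 2)))); first by rewrite ler_expR lerN2.
  have h0 : 0 < s^-1 / 2 by rewrite divr_gt0.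
  apply: le_trans (expRN_inv_le 4 h0) _; rewrite (_ : (4.+1)`! = 120)%N //.
  by rewrite le_eqVlt; apply/orP; left; apply/eqP; field; rewrite gt_eqF.
rewrite /tail.
have q : (s / 2)^-1 * (1 + (s / 2)^-1) <= 5 * (s^-1) ^+ 2.
  have -> : (s / 2)^-1 = 2 * s^-1 by field; rewrite gt_eqF.
  by rewrite expr2; nra.
have q0 : 0 <= (s / 2)^-1 * (1 + (s / 2)^-1).
  by rewrite mulr_ge0 ?addr_ge0 ?invr_ge0 ?divr_ge0 // ltW.
apply: (le_trans (ler_pM (expR_ge0 _) q0 e q)).
have -> : 3840 * s ^+ 5 * (5 * (s^-1) ^+ 2) = 19200 * s ^+ 2 * s by field; rewrite gt_eqF.
apply: ler_piMl; first exact: ltW.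
have ss : s ^+ 2 <= 200^-1 * 200^-1.
  by rewrite expr2; apply: ler_pM; [exact: ltW|exact: ltW|exact: s200|exact: s200].
by move: (s ^+ 2) ss => a ss; lra.
Qed.

Lemma cutoff_small : (cutoff s <= n.+2)%N.
Proof.
have /andP[n1 n2] := n_itv; have v200 := inv_ge200.
have hs : 0 < s <= 4^-1.
  by rewrite s0 /= (le_trans s200) // lef_pV2 ?posrE //; lra.
have i0 : 0 <= (2 * s)^-1 by rewrite invr_ge0 mulr_ge0 // ltW.
have /andP[h1 _] := truncn_itv i0; rewrite -/(cutoff s) in h1.
rewrite -(@ler_nat R) (le_trans h1) // (@le_trans _ _ n%:R) ?ler_nat ?leqW //.
apply: le_trans n1; rewrite invfM ler_pM2r ?invr_gt0 //.
by rewrite (@le_trans _ _ 1) ?invf_le1 //; lra.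
Qed.

Lemma expRN_big_small : (2 * n + 3)%:R * expR (- (n.+1%:R * s)) <= 336 * s ^+ 2.
Proof.
have /andP[n1 n2] := n_itv; have v200 := inv_ge200.
have i0 : 0 < s^-1 by rewrite invr_gt0.
have h : s^-1 <= n.+1%:R * s.
  by rewrite -ler_pdivrMr // (le_trans n1) // ler_nat.
have e : expR (- (n.+1%:R * s)) <= 24 * s ^+ 4.
  apply: (@le_trans _ _ (expR (- s^-1))); first by rewrite ler_expR lerN2.
  apply: le_trans (expRN_inv_le 3 i0) _; rewrite (_ : (3.+1)`! = 24)%N //.
  by rewrite exprVn invrK.
have m : (2 * n + 3)%:R <= 14 * s^-1 ^+ 2 :> R.
  rewrite natrD natrM; have h2 : n%:R <= 6 * s^-1 ^+ 2 by rewrite exprVn.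
  by rewrite expr2 in h2 *; nra.
apply: (le_trans (ler_pM (ler0n _ _) (expR_ge0 _) m e)).
rewrite le_eqVlt; apply/orP; left; apply/eqP; field; rewrite gt_eqF //.
Qed.

(** The bound [n] on the multiplicities changes the generating function by a
    factor exponentially close to 1, even for the part of size 1. *)
Lemma truncation_small :
  \prod_(i : part_index n.+1) (1 + expR (- ((part_size i)%:R * s)) ^+ n.+1) - 1 <= 2 * (336 * s ^+ 2).
Proof.
have v200 := inv_ge200; have big := expRN_big_small.
set e := expR (- (n.+1%:R * s)) in big.
have h : \prod_(i : part_index n.+1) (1 + expR (- ((part_size i)%:R * s)) ^+ n.+1) <=
   expR ((2 * n + 3)%:R * e).
  apply: (@le_trans _ _ (\prod_(i : part_index n.+1) expR e)).
    apply: ler_prod => i _; rewrite addr_ge0 ?exprn_ge0 ?expR_ge0 //=.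
    apply: le_trans (expR_ge1Dx _); rewrite lerD2l -expRM_natl mulrN ler_expR lerN2.
    by rewrite ler_pM2l ?ltr0n // ler_peMl ?(ltW s0) // ler1n part_size_gt0.
  rewrite prodr_const card_sum !card_ord -expRM_natl.
  by rewrite (_ : n.+2 + n.+1 = 2 * n + 3)%N // mul2n -addnn -addnA addn3 !addnS !addSn.
set x := (2 * n + 3)%:R * e in h big.
have x2 : x <= 2^-1.
  apply: (le_trans big).
  have ss : s ^+ 2 <= 200^-1 * 200^-1.
    by rewrite expr2; apply: ler_pM; [exact: ltW|exact: ltW|exact: s200|exact: s200].
  by move: (s ^+ 2) ss => a ss; lra.
have x0 : 0 <= x by rewrite mulr_ge0 // expR_ge0.
have ex : expR x <= 1 + 2 * x.
  have h1 := expR_ge1Dx (- x); have h2 := expRxMexpNx_1 x; have h3 := expR_gt0 x.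
  have h4 : expR x * (1 - x) <= 1 by rewrite -[leRHS]h2 ler_pM2l.
  by nra.
by move: h ex big; move: (\prod_(i : _) _) (expR x) (336 * _) => *; lra.
Qed.

End SmallParameter.
End SaddlePoint.

Section SaddlePointLimit.
Variable R : realType.
Implicit Types (x y u d s : R) (n : nat).
Local Notation mu := (@lebesgue_measure R).
Local Notation zeta2 := (pi ^+ 2 / 6 : R).

Lemma cvg_of_dist_le (f g : nat -> R) (l : R) :
  (\forall n \near \oo, `|f n - l| <= g n) -> g @ \oo --> (0 : R) -> f @ \oo --> l.
Proof.
move=> H g0; apply/cvgrPdist_lt => e e0.
move/cvgr0Pnorm_lt: (g0) => /(_ e e0); apply: filterS2 H => n h1 h2.
by rewrite distrC (le_lt_trans h1) // (le_lt_trans (ler_norm _)).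
Qed.

(** The saddle point: the value at which the expected weight is [n] to first
    order, see [sigmaE]. *)
Definition sigma n : R := Num.sqrt (pi ^+ 2 / (3 * n%:R)).
(** The frequencies that matter are of order [sigma^(3/2) = delta^3]. *)
Definition delta n : R := Num.sqrt (sigma n).

Lemma delta_sqr n : delta n ^+ 2 = sigma n.
Proof. by rewrite sqr_sqrtr // sqrtr_ge0. Qed.

Lemma sigma_gt0 n : (0 < n)%N -> 0 < sigma n.
Proof.
by move=> n0; rewrite sqrtr_gt0 divr_gt0 ?exprn_gt0 ?pi_gt0 // mulr_gt0 // ltr0n.
Qed.

Lemma delta_gt0 n : (0 < n)%N -> 0 < delta n.
Proof. by move=> n0; rewrite sqrtr_gt0 sigma_gt0. Qed.

Lemma sigmaE n : (0 < n)%N -> n%:R = 2 * zeta2 / sigma n ^+ 2.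
Proof.
move=> n0; rewrite sqr_sqrtr; last by rewrite divr_ge0 ?sqr_ge0 // mulr_ge0.
have N0 : n%:R != 0 :> R by rewrite pnatr_eq0 -lt0n.
have P := pi_gt0 R.
by move: P N0; move: (pi : R) (n%:R : R) => p m P N0; field; rewrite N0 gt_eqF.
Qed.

Lemma cvg_sigma : sigma @ \oo --> (0 : R).
Proof.
rewrite /sigma -[X in _ --> X]sqrtr0.
apply: continuous_cvg; first exact: sqrt_continuous.
have -> : 0 = pi ^+ 2 / 3 * 0 :> R by rewrite mulr0.
under eq_fun do rewrite invfM mulrA.
apply: cvgMr; apply/gtr0_cvgV0; last exact: cvgr_idn.
by near=> n; rewrite ltr0n; near: n; exact: nbhs_infty_gt.
Unshelve. all: by end_near. Qed.

Lemma cvg_delta : delta @ \oo --> (0 : R).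
Proof.
rewrite /delta -[X in _ --> X]sqrtr0.
by apply: continuous_cvg; [exact: sqrt_continuous|exact: cvg_sigma].
Qed.

Definition large n : bool := (0 < n)%N && (sigma n <= 200^-1).

Lemma near_large : \forall n \near \oo, large n.
Proof.
have h : (0 : R) < 200^-1 by rewrite invr_gt0.
near=> n; apply/andP; split; first by near: n; exact: nbhs_infty_gt.
rewrite (le_trans (ler_norm _)) //; near: n; exact: cvgr0_norm_le cvg_sigma _ h.
Unshelve. all: by end_near. Qed.

(** The characteristic function of the weight, recentred at [n], at the rescaled
    frequency [u]; its real part suffices since the integral over a period
    is real. *)
Definition char_fun n u : R :=
  trig_sum (@part_size n.+1) n n (sigma n) (u * delta n ^+ 3) / boltzmann (@part_size n.+1) (sigma n).

(** Extended by 0 outside of one period, to have the domain of integration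
    fixed. *)
Definition integrand n : R -> R :=
  char_fun n \_ `[- (pi / delta n ^+ 3), pi / delta n ^+ 3].

Let half_turn n : set R := `[- (pi / delta n ^+ 3), pi / delta n ^+ 3].

Lemma half_turnP n u : (0 < n)%N -> half_turn n u <-> `|u * delta n ^+ 3| <= pi.
Proof.
move=> n0; have d0 := exprn_gt0 3 (delta_gt0 n0).
rewrite /half_turn /= in_itv /= normrM (gtr0_norm d0) -ler_pdivlMr // ler_norml.
by split.
Qed.

Lemma modulus_le1 N s t : 0 < s -> modulus (@part_size N) s t <= 1.
Proof.
move=> s0; rewrite modulusE // -[leRHS]expR0 ler_expR; apply: sumr_le0 => i _.
by rewrite ln_rho_le0 // scaled_gt0 //; exact: part_size_gt0.
Qed.

Section Large.
Variables (n : nat) (u : R).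
Hypothesis gn : large n.
Local Notation d := (delta n).
Local Notation M := (modulus (@part_size n.+1) (sigma n) (u * d ^+ 3)).
Local Notation Phi := (phase (@part_size n.+1) (sigma n) (u * d ^+ 3) - n%:R * (u * d ^+ 3)).

Let n0 : (0 < n)%N. Proof. by case/andP: gn. Qed.
Let s200 : d ^+ 2 <= 200^-1. Proof. by rewrite delta_sqr; case/andP: gn. Qed.
Let nE : n%:R = 2 * zeta2 / (d ^+ 2) ^+ 2. Proof. by rewrite delta_sqr; exact: sigmaE. Qed.
Let d0 : 0 < d. Proof. exact: delta_gt0. Qed.

(** The truncation of the multiplicities is a relative error on the modulus. *)
Lemma char_fun_approx : `|char_fun n u - M * cos Phi| <= M * (2 * (336 * sigma n ^+ 2)).
Proof.
apply: le_trans (trig_sum_approx (@part_size_gt0 n.+1) _ _ _ (sigma_gt0 n0)) _.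
rewrite ler_pM2l; last by apply: modulus_gt0; [exact: part_size_gt0|exact: sigma_gt0].
by have := truncation_small d0 s200 nE; rewrite delta_sqr.
Qed.

Lemma trunc_le1 : 2 * (336 * sigma n ^+ 2) <= 1.
Proof.
have s0 := sigma_gt0 n0; have h := s200; rewrite delta_sqr in h.
have ss : sigma n ^+ 2 <= 200^-1 * 200^-1.
  by rewrite expr2; apply: ler_pM; [exact: ltW|exact: ltW|exact: h|exact: h].
by move: (sigma n ^+ 2) ss => a ss; lra.
Qed.

Lemma integrand_bound : `|integrand n u| <= 2 * dom_const R / (1 + u ^+ 2).
Proof.
have D0 : 0 <= dom_const R by have [h _ _] := dom_const_facts R; apply: le_trans h.
rewrite /integrand patchE; case: ifPn => [|_]; last first.
  by rewrite normr0 divr_ge0 ?mulr_ge0 // addr_ge0 ?sqr_ge0.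
rewrite inE => /half_turnP -/(_ n0) ht.
have Md : M <= dom_const R / (1 + u ^+ 2).
  have := @modulus_dominated R n.+1 d u (small_itv d0 s200) (cutoff_small d0 s200 nE) ht.
  by rewrite delta_sqr.
have M0 : 0 < M by apply: modulus_gt0; [exact: part_size_gt0|exact: sigma_gt0].
apply: (@le_trans _ _ (2 * M)); last by rewrite -mulrA ler_pM2l.
have -> : char_fun n u = (char_fun n u - M * cos Phi) + M * cos Phi by rewrite subrK.
apply: (le_trans (ler_normD _ _)).
have h1 := char_fun_approx.
have h2 : M * (2 * (336 * sigma n ^+ 2)) <= M * 1 by apply: ler_wpM2l; [exact: ltW|exact: trunc_le1].
have h3 : `|M * cos Phi| <= M * 1.
  by rewrite normrM (gtr0_norm M0) ler_pM2l // cos_max.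
have h4 := le_trans h1 h2.
by move: h4 h3; move: `|_ * _| `|_ - _| => a b; rewrite mulr1 => *; lra.
Qed.

Lemma phase_small : `|Phi| <= (19 * `|u| + 1056 * `|u| ^+ 3) * d.
Proof.
have := @phase_approx R n.+1 d u n%:R isT (small_itv d0 s200) (tail_small d0 s200 nE) nE.
by rewrite delta_sqr.
Qed.

Let Lmod := \sum_(i : part_index n.+1) ln (rho ((part_size i)%:R * sigma n) ((part_size i)%:R * (u * d ^+ 3))).

Lemma log_modulus_close : `|Lmod - - (pi ^+ 2 / 3 * u ^+ 2)| <= (202 * u ^+ 2 + 6624 * u ^+ 4) * d.
Proof.
have := @log_modulus_approx R n.+1 d u isT (small_itv d0 s200) (tail_small d0 s200 nE).
rewrite delta_sqr -/Lmod.
have -> : 2 * Lmod + 4 * zeta2 * u ^+ 2 = 2 * (Lmod - - (pi ^+ 2 / 3 * u ^+ 2)).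
  by move: (pi : R) => p; field.
rewrite normrM ger0_norm // => h; apply: le_trans h.
by rewrite ler_peMl // ler1n.
Qed.

End Large.

Definition log_modulus n u : R := \sum_(i : part_index n.+1)
  ln (rho ((part_size i)%:R * sigma n) ((part_size i)%:R * (u * delta n ^+ 3))).

Lemma cvg_scale_delta (c : R) : (fun n => c * delta n) @ \oo --> (0 : R).
Proof. by rewrite -[X in _ --> X](mulr0 c); apply: cvgMr; exact: cvg_delta. Qed.

(** Pointwise limit: the modulus is Gaussian in the limit, the phase tends to 0,
    and the period ends up containing [u]. *)
Lemma cvg_integrand u :
  (fun n => integrand n u) @ \oo --> expR (- (pi ^+ 2 / 3 * u ^+ 2)).
Proof.
pose Phi n := phase (@part_size n.+1) (sigma n) (u * delta n ^+ 3) - n%:R * (u * delta n ^+ 3).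
have cL : (fun n => log_modulus n u) @ \oo --> - (pi ^+ 2 / 3 * u ^+ 2).
  apply: (@cvg_of_dist_le _ (fun n => (202 * u ^+ 2 + 6624 * u ^+ 4) * delta n)); last exact: cvg_scale_delta.
  by apply: filterS near_large => n gn; exact: log_modulus_close.
have cP : Phi @ \oo --> (0 : R).
  apply: (@cvg_of_dist_le _ (fun n => (19 * `|u| + 1056 * `|u| ^+ 3) * delta n)); last exact: cvg_scale_delta.
  by apply: filterS near_large => n gn; rewrite subr0; exact: phase_small.
have cG : (fun n => expR (log_modulus n u) * cos (Phi n)) @ \oo --> expR (- (pi ^+ 2 / 3 * u ^+ 2)).
  have E (a : R) : expR a = expR a * cos 0 by rewrite cos0 mulr1.
  rewrite [X in _ --> X]E; apply: cvgM.
    by apply: continuous_cvg; [exact: continuous_expR|exact: cL].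
  by apply: continuous_cvg; [exact: continuous_cos|exact: cP].
have cD : (fun n => integrand n u - expR (log_modulus n u) * cos (Phi n)) @ \oo --> (0 : R).
  apply: (@cvg_of_dist_le _ (fun n => 672 * sigma n ^+ 2)); last first.
    rewrite -[X in _ --> X](mulr0 672); apply: cvgMr.
    rewrite [X in _ --> X](_ : 0 = 0 * 0 :> R); last by rewrite mulr0.
    by under eq_fun do rewrite expr2; apply: cvgM; exact: cvg_sigma.
  have small : \forall n \near \oo, `|u| * delta n <= pi /\ delta n <= 1.
    near=> n; split.
      rewrite (le_trans (ler_norm _)) //; near: n.
      by apply: cvgr0_norm_le (pi_gt0 R); exact: cvg_scale_delta.
    rewrite (le_trans (ler_norm _)) //; near: n.
    by apply: cvgr0_norm_le ltr01; exact: cvg_delta.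
  apply: filterS2 near_large small => n gn [h1 h2].
  have n0 : (0 < n)%N by case/andP: gn.
  have d0 := delta_gt0 n0.
  have ht : `|u * delta n ^+ 3| <= pi.
    rewrite normrM (gtr0_norm (exprn_gt0 3 d0)); apply: le_trans h1.
    rewrite ler_wpM2l // exprS ler_piMr ?(ltW d0) //; apply: exprn_ile1 => //; exact: ltW.
  have -> : integrand n u = char_fun n u.
    by rewrite /integrand patchE mem_set //; apply/half_turnP.
  have M1 := modulus_le1 n.+1 (u * delta n ^+ 3) (sigma_gt0 n0).
  have h := char_fun_approx u gn.
  rewrite modulusE ?sigma_gt0 // in M1 h.
  rewrite subr0; apply: (le_trans h).
  rewrite [leRHS](_ : _ = 1 * (2 * (336 * sigma n ^+ 2))); last by ring.
  apply: ler_wpM2r; last exact: M1.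
  by apply: mulr_ge0; [exact: ler0n|apply: mulr_ge0; [exact: ler0n|exact: sqr_ge0]].
have E : (fun n => integrand n u) = (fun n => (integrand n u - expR (log_modulus n u) * cos (Phi n)) +
   expR (log_modulus n u) * cos (Phi n)) by apply/funext => n; rewrite subrK.
by rewrite E -[X in _ --> X]add0r; apply: cvgD; [exact: cD|exact: cG].
Unshelve. all: by end_near. Qed.

Lemma measurable_integrand n : measurable_fun [set: R] (integrand n).
Proof.
apply/(measurable_restrictT _ _).1; first exact: measurable_itv.
apply: measurable_funTS; apply: continuous_measurable_fun => x.
by apply: cvgMl; exact: continuous_trig_sum.
Qed.

Lemma integral_integrand n : (0 < n)%N ->
  (\int[mu]_u (integrand n u)%:E = (2 * pi / delta n ^+ 3 * expR (- (n%:R * sigma n)) *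
    (config_count n)%:R / boltzmann (@part_size n.+1) (sigma n))%:E)%E.
Proof.
move=> n0; have c0 := exprn_gt0 3 (delta_gt0 n0).
rewrite -(fourier_inversion (@part_size n.+1) n n (sigma n) c0).
have I : mu.-integrable (half_turn n) (EFin \o (fun u => trig_sum (@part_size n.+1) n n (sigma n) (u * delta n ^+ 3))).
  by apply: integrable_cc; exact: continuous_trig_sum.
rewrite -RintegralZr //.
have -> : (\int[mu]_u (integrand n u)%:E = \int[mu]_(u in half_turn n) (char_fun n u)%:E)%E.
  rewrite [RHS]integral_mkcond; apply: eq_integral => u _.
  by rewrite /integrand !patchE; case: ifP.
rewrite /Rintegral fineK //; apply: integrable_fin_num => //.
apply: integrable_cc => x; apply: cvgMl; exact: continuous_trig_sum.
Qed.

(** The local limit theorem: dominated convergence in the inversion formula. *)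
Theorem config_count_limit :
  (fun n => 2 * pi / delta n ^+ 3 * expR (- (n%:R * sigma n)) *
    (config_count n)%:R / boltzmann (@part_size n.+1) (sigma n)) @ \oo --> Num.sqrt (3 / pi : R).
Proof.
(* the domination is required at every index, hence the shift by n0 *)
have [n0 _ H] := near_large.
have G n : large (n + n0)%N by apply: H; rewrite /= leq_addl.
pose f_ n : R -> \bar R := EFin \o integrand (n + n0).
pose f : R -> \bar R := EFin \o (fun u => expR (- (pi ^+ 2 / 3 * u ^+ 2))).
pose g : R -> \bar R := EFin \o (fun u => 2 * dom_const R / (1 + u ^+ 2)).
have mf_ n : measurable_fun [set: R] (f_ n).
  by apply/measurable_EFinP; exact: measurable_integrand.
have mf : measurable_fun [set: R] f.
  apply/measurable_EFinP; apply: continuous_measurable_fun.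
  by apply: continuous_of_has_der => x; der.
have f_f : {ae mu, forall u, [set: R] u -> f_ ^~ u @ \oo --> f u}.
  apply: aeW => u _; apply: cvg_EFin; first exact: nearW.
  have := @cvg_integrand u; rewrite -(cvg_shiftn n0); exact.
have fg : {ae mu, forall u n, [set: R] u -> (`|f_ n u| <= g u)%E}.
  by apply: aeW => u n _; rewrite /f_ /g /= lee_fin; exact: integrand_bound.
have [_ _] := @dominated_convergence _ _ R mu setT measurableT f_ f g mf_ mf f_f (integrable_inv_oneDsqr (2 * dom_const R)) fg.
rewrite integral_gaussian => /fine_cvgP [_ C].
rewrite -(cvg_shiftn n0); apply: cvg_trans C.
apply: near_eq_cvg; apply: nearW => n /=.
rewrite (_ : (\int[mu]_x f_ n x = \int[mu]_u (integrand (n + n0) u)%:E)%E) //.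
by rewrite integral_integrand //; case/andP: (G n).
Qed.

End SaddlePointLimit.

(** * The asymptotic formula *)

Section Asymptotics.
Variable R : realType.
Implicit Types (s : R) (n : nat).
Local Notation zeta2 := (pi ^+ 2 / 6 : R).
Local Notation sigma := (sigma R).
Local Notation delta := (delta R).
Local Notation large := (large R).

(** Two colours of all parts, with one part 2 removed. *)
Lemma boltzmannE N s : (0 < N)%N -> 0 < s ->
  boltzmann (@part_size N) s = expR (2 * logP N.+1 s + ell (2 * s)).
Proof.
move=> N0 s0.
have -> : 2 * logP N.+1 s + ell (2 * s) = \sum_(i : part_index N) - ell ((part_size i)%:R * s).
  by rewrite sumrN (sum_part_size (fun k => ell (k%:R * s)) N0) /logP; ring.
rewrite expR_sum; apply: eq_bigr => i _.
have x0 := scaled_gt0 (@part_size_gt0 N) i s0.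
by rewrite [RHS]expRN /ell lnK // posrE onem_expRN_gt0.
Qed.

(** The error made in replacing the logarithm of the generating function at the
    saddle point by its expansion; [ell (2 s)] is expanded as [ln (2 s)]. *)
Definition log_error n : R := 2 * logP n.+2 (sigma n) + ell (2 * sigma n)
  - (2 * zeta2 / sigma n + 2 * ln (sigma n) - ln pi).

Lemma log_error_small n : large n -> `|log_error n| <= 5 * sigma n.
Proof.
move=> gn; have n0 : (0 < n)%N by case/andP: gn.
have d0 := delta_gt0 R n0; have s0 := sigma_gt0 R n0.
have s200 : delta n ^+ 2 <= 200^-1 by rewrite delta_sqr; case/andP: gn.
have nE : n%:R = 2 * zeta2 / (delta n ^+ 2) ^+ 2 by rewrite delta_sqr; exact: sigmaE.
have t1 := tail_small d0 s200 nE; rewrite delta_sqr in t1.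
have h : 0 < sigma n / 2 <= sigma n by rewrite divr_gt0 //=; lra.
have t2 := tail_decr n.+2 h.
have /andP[l1 l2] := logP_asymp n.+2 s0.
have s20 : 0 < 2 * sigma n by rewrite mulr_gt0.
have r1 := logratio_ge s20.
have r2 : logratio (2 * sigma n) <= 0.
  rewrite /logratio gt_eqF // subr_le0 ler_ln ?posrE ?onem_expRN_gt0 //; exact: onem_expRN_le.
have E := ellE s20; rewrite lnM ?posrE // in E.
rewrite ln_s_2pi // in l1 l2.
rewrite /log_error E -[2 * zeta2 / _]mulrA.
move: l1 l2 r1 r2 t1 t2 {E}.
move: (zeta2 / _) (logP _ _) (logratio _) (tail _ (_ / 2)) (tail _ _) (ln (sigma n)) (ln 2) (ln pi) => A B C D E F G H.
by move=> *; rewrite ler_norml; apply/andP; split; lra.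
Qed.

Definition target n : R :=
  pi / (6 * 3 `^ (1 / 4)) * n%:R `^ (- (7 / 4)) * expR (2 * pi * Num.sqrt (n%:R / 3)).

Lemma expR_ln x : 0 < x -> x = expR (ln x) :> R.
Proof. by move=> x0; rewrite lnK // posrE. Qed.

Lemma targetE n : (0 < n)%N -> target n = expR (ln pi - ln 2 - 5 / 4 * ln 3
  - 7 / 4 * ln n%:R + 2 * (n%:R * sigma n)).
Proof.
move=> n0; have N0 : 0 < n%:R :> R by rewrite ltr0n.
have P := pi_gt0 R; have s0 := sigma_gt0 R n0.
rewrite /target.
have -> : Num.sqrt (n%:R / 3) = n%:R * sigma n / pi.
  have E : n%:R / 3 = (n%:R * sigma n / pi) ^+ 2.
    rewrite expr_div_n exprMn /sigma sqr_sqrtr; last by rewrite divr_ge0 ?sqr_ge0 // mulr_ge0.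
    by move: N0 P; move: (n%:R : R) (pi : R) => m p N0 P; field; rewrite !gt_eqF.
  by rewrite E sqrtr_sqr ger0_norm // divr_ge0 ?mulr_ge0 // ltW.
rewrite /powR pnatr_eq0 [(n%:R == 0)]gt_eqF //.
have -> : 2 * pi * (n%:R * sigma n / pi) = 2 * (n%:R * sigma n).
  by move: P; move: (pi : R) => p P; field; rewrite gt_eqF.
have -> : 6 = expR (ln 2 + ln 3) :> R by rewrite expRD -!expR_ln // -natrM.
rewrite {1}(expR_ln P) -[expR (_ + _) * _]expRD -expRB -!expRD; congr expR.
by move: (ln _) (ln _) (ln _) (ln _) (n%:R * _) => A B C D E; field.
Qed.

Lemma ln_sigma n : (0 < n)%N -> 2 * ln (sigma n) = 2 * ln pi - ln 3 - ln n%:R.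
Proof.
move=> n0; have N0 : 0 < n%:R :> R by rewrite ltr0n.
have P := pi_gt0 R; have s0 := sigma_gt0 R n0.
rewrite mulr_natl -lnXn // sqr_sqrtr; last by rewrite divr_ge0 ?sqr_ge0 // mulr_ge0.
rewrite ln_div ?posrE ?exprn_gt0 ?mulr_gt0 // lnXn // lnM ?posrE //.
by rewrite -mulr_natl; move: (ln _) (ln _) (ln _) => a b c; ring.
Qed.

(** At the saddle point [n sigma = 2 zeta2 / sigma], so the exponentials of [n
    sigma] from the generating function and from the inversion formula add
    up to the exponent of the target; the powers of [n] combine as [sigma^2
    * sigma^(3/2)], of order [n^(-7/4)], and cancel up to the constant. *)
Lemma ratioE n : large n -> (config_count n)%:R / target n =
  2 * pi / delta n ^+ 3 * expR (- (n%:R * sigma n)) * (config_count n)%:R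
    / boltzmann (@part_size n.+1) (sigma n) * expR ((ln pi - ln 3) / 2 + log_error n).
Proof.
move=> gn; have n0 : (0 < n)%N by case/andP: gn.
have s0 := sigma_gt0 R n0; have d0 := delta_gt0 R n0; have P := pi_gt0 R.
have -> : delta n ^+ 3 = expR (3 / 2 * ln (sigma n)).
  rewrite -[delta n]lnK ?posrE // -expRM_natl; congr expR.
  by rewrite -delta_sqr lnXn // -mulr_natl; field.
rewrite boltzmannE // targetE //.
have -> : 2 * pi = expR (ln 2 + ln pi) :> R by rewrite expRD -!expR_ln.
rewrite -!expRN mulrC -!expRD.
rewrite [_ * (config_count n)%:R]mulrC -!mulrA -!expRD mulrC; congr (_ * expR _).
have n2 := sigmaE R n0.
have E : n%:R * sigma n = 2 * zeta2 / sigma n.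
  by rewrite {1}n2; move: s0; move: (sigma n) zeta2 => s z s0; field; rewrite gt_eqF.
have L := ln_sigma n0.
rewrite /log_error -E.
move: L; move: (n%:R * _) (ln (sigma n)) (ln n%:R) (ln pi) (ln 3) (ln 2) (logP _ _) (ell _) => a b c d e f g h L.
by lra.
Qed.

Theorem config_count_asymp : (fun n => (config_count n)%:R / target n) @ \oo --> (1 : R).
Proof.
have c3 : Num.sqrt (3 / pi) = expR (- ((ln pi - ln 3) / 2)) :> R.
  have P := pi_gt0 R.
  have p : 0 < 3 / pi :> R by rewrite divr_gt0.
  rewrite -[LHS]lnK ?posrE ?sqrtr_gt0 //; congr expR.
  have : 2 * ln (Num.sqrt (3 / pi)) = ln 3 - ln pi :> R.
    by rewrite mulr_natl -lnXn ?sqrtr_gt0 // sqr_sqrtr ?ltW // ln_div ?posrE.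
  by move=> ?; lra.
have one : 1 = Num.sqrt (3 / pi) * expR ((ln pi - ln 3) / 2 + 0) :> R.
  by rewrite c3 addr0 -expRD addNr expR0.
rewrite [X in _ --> X]one.
have cE : (fun n => expR ((ln pi - ln 3) / 2 + log_error n)) @ \oo --> expR ((ln pi - ln 3) / 2 + 0).
  apply: continuous_cvg; first exact: continuous_expR.
  apply: cvgD; first exact: cvg_cst.
  apply: (@cvg_of_dist_le _ _ (fun n => 5 * sigma n)).
    by apply: filterS (near_large R) => n gn; rewrite subr0; exact: log_error_small.
  by rewrite -[X in _ --> X](mulr0 5); apply: cvgMr; exact: cvg_sigma.
apply: cvg_trans (cvgM (@config_count_limit R) cE).
apply: near_eq_cvg; apply: filterS (near_large R) => n gn.
by rewrite ratioE.
Qed.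

End Asymptotics.

Theorem theorem4p1 (R : realType) :
  (fun n : nat =>
     (T n)%:R /
     (pi / (6 * 3 `^ (1 / 4)) * n%:R `^ (- (7 / 4))
        * expR (2 * pi * Num.sqrt (n%:R / 3))) : R) @ \oo --> (1 : R).
Proof.
under eq_fun do rewrite T_config_count.
exact: config_count_asymp.
Qed.
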